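(* Let $n\geq 2$, let $(M^{n+1}(c),g)$ be an $(n+1)$-dimensional Riemannian manifold of constant sectional curvature $c\in\mathbb{R}$, let $(N^n,h)$ be an $n$-dimensional Riemannian manifold, and let $\phi:(M^{n+1}(c),g)\to(N^n,h)$ be a Riemannian submersion. Then $\phi$ is biharmonic if and only if $\phi$ is harmonic.
   Context: For a smooth map $\phi:(M,g)\to(N,h)$ between Riemannian manifolds, let $\nabla^M$ and $\nabla^N$ be the Levi-Civita connections of $M$ and $N$, and let $\nabla^\phi$ be the connection induced on $\phi^{-1}TN$. The tension field is $\tau(\phi)=\sum_i\left(\nabla^\phi_{e_i}d\phi(e_i)-d\phi(\nabla^M_{e_i}e_i)\right)$, where $\{e_i\}$ is a local orthonormal frame of $M$. The map $\phi$ is harmonic if it is a critical point of the energy $E(\phi)=\frac12\int_M|d\phi|^2\,d\mu_g$, equivalently $\tau(\phi)=0$. The map $\phi$ is biharmonic if it is a critical point of the bi-energy $E_2(\phi)=\frac12\int_M|\tau(\phi)|^2\,d\mu_g$, equivalently if $$\sum_i\left[\left(\nabla^{\phi}_{e_i}\nabla^{\phi}_{e_i}-\nabla^{\phi}_{\nabla^M_{e_i}e_i}\right)\tau(\phi)-R^N(d\phi(e_i),\tau(\phi))d\phi(e_i)\right]=0,$$ where $R^N(X,Y)Z=\nabla^N_X\nabla^N_YZ-\nabla^N_Y\nabla^N_XZ-\nabla^N_{[X,Y]}Z$. *)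

(* Defs.v *)
From mathcomp Require Import all_boot all_order all_algebra ring.
From mathcomp Require Import all_classical all_reals all_analysis.

Set Implicit Arguments.
Unset Strict Implicit.
Unset Printing Implicit Defensive.

Import Order.TTheory GRing.Theory Num.Theory.
Import numFieldNormedType.Exports.

Local Open Scope classical_set_scope.
Local Open Scope ring_scope.

Fixpoint Ck (R : realType) (m : nat) (W : normedModType R) (k : nat)
    (U : set 'rV[R]_m) (f : 'rV[R]_m -> W) : Prop :=
  match k with
  | 0%N => forall x, U x -> {for x, continuous f}
  | k'.+1 => (forall x, U x -> differentiable f x) /\
             (forall v, Ck k' U (fun x => 'D_v f x))
  end.

Definition smooth_on (R : realType) (m : nat) (W : normedModType R)
    (U : set 'rV[R]_m) (f : 'rV[R]_m -> W) : Prop :=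
  forall k, Ck k U f.

(* [pt] is only meaningful on the open set [img], where it inverts [coord]. *)
Record chart (R : realType) (T : topologicalType) (m : nat) := Chart {
  dom : set T;
  coord : T -> 'rV[R]_m;
  pt : 'rV[R]_m -> T;
  img := coord @` dom;
  dom_open : open dom;
  img_open : open img;
  coordK : forall p, dom p -> pt (coord p) = p;
  coord_continuous : forall p, dom p -> {for p, continuous coord};
  pt_continuous : forall x, img x -> {for x, continuous pt} }.

Record smoothManifold (R : realType) (m : nat) := SmoothManifold {
  carrier :> topologicalType;
  carrier_hausdorff : hausdorff_space carrier;
  carrier_second_countable : @second_countable carrier;
  atlas : set (chart R carrier m);
  atlas_cover : forall p : carrier, exists2 a, atlas a & dom a p;
  atlas_compatible : forall a b, atlas a -> atlas b ->
    smooth_on (coord a @` (dom a `&` dom b)) (coord b \o pt a) }.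

Definition local_rep (R : realType) (m n : nat) (M : smoothManifold R m)
    (N : smoothManifold R n) (phi : M -> N)
    (a : chart R M m) (b : chart R N n) : 'rV[R]_m -> 'rV[R]_n :=
  coord b \o phi \o pt a.

Definition local_dom (R : realType) (m n : nat) (M : smoothManifold R m)
    (N : smoothManifold R n) (phi : M -> N)
    (a : chart R M m) (b : chart R N n) : set 'rV[R]_m :=
  coord a @` (dom a `&` phi @^-1` dom b).

Definition smooth_map (R : realType) (m n : nat) (M : smoothManifold R m)
    (N : smoothManifold R n) (phi : M -> N) : Prop :=
  continuous phi /\
  forall a b, atlas a -> atlas b ->
    smooth_on (local_dom phi a b) (local_rep phi a b).

(* [G x] is the Gram matrix (g_ij(x)) of the coordinate frame. *)
Definition inner (R : realType) (m : nat) (G : 'rV[R]_m -> 'M[R]_m)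
    (x u v : 'rV[R]_m) : R :=
  (u *m G x *m v^T) 0 0.

Record riemannianMetric (R : realType) (m : nat) (M : smoothManifold R m) :=
  RiemannianMetric {
  gram : chart R M m -> 'rV[R]_m -> 'M[R]_m;
  gram_smooth : forall a, atlas a -> smooth_on (img a) (gram a);
  gram_sym : forall a x, atlas a -> img a x -> (gram a x)^T = gram a x;
  gram_posdef : forall a x, atlas a -> img a x ->
    forall v, v != 0 -> 0 < inner (gram a) x v v;
  gram_compatible : forall a b p, atlas a -> atlas b -> dom a p -> dom b p ->
    forall u v, inner (gram a) (coord a p) u v =
      inner (gram b) (coord b p) ('D_u (coord b \o pt a) (coord a p))
                                 ('D_v (coord b \o pt a) (coord a p)) }.

(* Vector fields on a chart are maps ['rV_m -> 'rV_m], by their components in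
   the coordinate frame. *)

Definition partial (R : realType) (m : nat) (W : normedModType R) (i : 'I_m)
    (f : 'rV[R]_m -> W) (x : 'rV[R]_m) : W :=
  'D_(delta_mx 0 i) f x.

(* Gamma^k_ij = 1/2 sum_l g^kl (d_i g_jl + d_j g_il - d_l g_ij) *)
Definition christoffel (R : realType) (m : nat) (G : 'rV[R]_m -> 'M[R]_m)
    (x : 'rV[R]_m) (k i j : 'I_m) : R :=
  2^-1 * \sum_l invmx (G x) k l *
    (partial i (fun y => G y j l) x + partial j (fun y => G y i l) x
     - partial l (fun y => G y i j) x).

Lemma partial_sym (R : realType) (m : nat) (G : 'rV[R]_m -> 'M[R]_m)
  (x : 'rV[R]_m) : (\forall y \near x, (G y)^T = G y) ->
  forall k i j : 'I_m,
    partial k (fun y => G y i j) x = partial k (fun y => G y j i) x.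
Proof.
move=> Gs k i j; apply: near_eq_derive; apply: filterS Gs => y Gy.
by rewrite -{1}Gy mxE.
Qed.

(* The two lemmas below say that these symbols are torsion-free and metric,
   d_k g_ij = sum_l (Gamma^l_ki g_lj + Gamma^l_kj g_il), i.e. that they define the
   Levi-Civita connection. *)
Lemma christoffel_sym (R : realType) (m : nat) (G : 'rV[R]_m -> 'M[R]_m)
  (x : 'rV[R]_m) : (\forall y \near x, (G y)^T = G y) ->
  forall k i j, christoffel G x k i j = christoffel G x k j i.
Proof.
move=> Gs k i j; rewrite /christoffel; congr (_ * _); apply: eq_bigr => l _.
rewrite (partial_sym Gs l i j); ring.
Qed.

Lemma christoffel_metric (R : realType) (m : nat) (G : 'rV[R]_m -> 'M[R]_m)
  (x : 'rV[R]_m) : (\forall y \near x, (G y)^T = G y) -> G x \in unitmx ->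
  forall k i j, partial k (fun y => G y i j) x =
   \sum_l (christoffel G x l k i * G x l j + christoffel G x l k j * G x i l).
Proof.
move=> Gs Gu k i j; have Gsx : (G x)^T = G x by exact: nbhs_singleton Gs.
have sG a b : G x a b = G x b a by rewrite -{1}Gsx mxE.
have low a b c : \sum_l christoffel G x l a b * G x l c =
   2^-1 * (partial a (fun y => G y b c) x + partial b (fun y => G y a c) x
     - partial c (fun y => G y a b) x).
  rewrite /christoffel.
  under eq_bigr do rewrite -mulrA mulr_suml.
  rewrite -mulr_sumr exchange_big /=; congr (_ * _).
  have E p : \sum_l invmx (G x) l p * G x l c = (p == c)%:R.
    have := congr1 (fun A : 'M[R]_m => A c p) (mulmxV Gu).
    rewrite !mxE eq_sym => <-; apply: eq_bigr => l _.
    by rewrite mulrC sG.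
  transitivity (\sum_p (p == c)%:R *
      (partial a (fun y => G y b p) x + partial b (fun y => G y a p) x
       - partial p (fun y => G y a b) x)).
    apply: eq_bigr => p _; rewrite -E mulr_suml; apply: eq_bigr => l _; ring.
  rewrite (bigD1 c) //= eqxx mul1r big1 ?addr0// => p /negbTE->.
  by rewrite mul0r.
rewrite big_split /= low.
under [X in _ = _ + X]eq_bigr do rewrite sG.
rewrite low (partial_sym Gs k j i).
by field.
Qed.

Definition christoffel_form (R : realType) (m : nat) (G : 'rV[R]_m -> 'M[R]_m)
    (x u v : 'rV[R]_m) : 'rV[R]_m :=
  \row_k \sum_i \sum_j christoffel G x k i j * u 0 i * v 0 j.

Definition nabla (R : realType) (m : nat) (G : 'rV[R]_m -> 'M[R]_m)
    (X Y : 'rV[R]_m -> 'rV[R]_m) (x : 'rV[R]_m) : 'rV[R]_m :=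
  'D_(X x) Y x + christoffel_form G x (X x) (Y x).

Definition lie_bracket (R : realType) (m : nat)
    (X Y : 'rV[R]_m -> 'rV[R]_m) (x : 'rV[R]_m) : 'rV[R]_m :=
  'D_(X x) Y x - 'D_(Y x) X x.

Definition curvature (R : realType) (m : nat) (G : 'rV[R]_m -> 'M[R]_m)
    (X Y Z : 'rV[R]_m -> 'rV[R]_m) (x : 'rV[R]_m) : 'rV[R]_m :=
  nabla G X (nabla G Y Z) x - nabla G Y (nabla G X Z) x
  - nabla G (lie_bracket X Y) Z x.

(* R is tensorial, so its value on tangent vectors at a point can be computed
   on any extension; the extension with constant components is used. *)
Definition curvature_at (R : realType) (m : nat) (G : 'rV[R]_m -> 'M[R]_m)
    (x u v w : 'rV[R]_m) : 'rV[R]_m :=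
  curvature G (fun=> u) (fun=> v) (fun=> w) x.

Definition sectional_curvature (R : realType) (m : nat)
    (G : 'rV[R]_m -> 'M[R]_m) (x u v : 'rV[R]_m) : R :=
  inner G x (curvature_at G x u v v) u /
  (inner G x u u * inner G x v v - inner G x u v ^+ 2).

Definition constant_sectional_curvature (R : realType) (m : nat)
    (M : smoothManifold R m) (g : riemannianMetric M) (c : R) : Prop :=
  forall a x, atlas a -> img a x -> forall u v : 'rV[R]_m,
    free [:: u; v] -> sectional_curvature (gram g a) x u v = c.

Definition horizontal (R : realType) (m n : nat) (G : 'rV[R]_m -> 'M[R]_m)
    (f : 'rV[R]_m -> 'rV[R]_n) (x u : 'rV[R]_m) : Prop :=
  forall v, 'D_v f x = 0 -> inner G x u v = 0.

Definition riemannian_submersion (R : realType) (m n : nat)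
    (M : smoothManifold R m) (N : smoothManifold R n)
    (g : riemannianMetric M) (h : riemannianMetric N) (phi : M -> N) : Prop :=
  smooth_map phi /\
  forall a b, atlas a -> atlas b ->
    let f := local_rep phi a b in
    forall x, local_dom phi a b x ->
      (forall w, exists v, 'D_v f x = w) /\
      (forall u v, horizontal (gram g a) f x u -> horizontal (gram g a) f x v ->
         inner (gram h b) (f x) ('D_u f x) ('D_v f x) = inner (gram g a) x u v).

(* The connection on f^{-1}TN; sections along [f] are maps ['rV_m -> 'rV_n], by
   their components in the coordinate frame of the target. *)
Definition nabla_along (R : realType) (m n : nat) (H : 'rV[R]_n -> 'M[R]_n)
    (f : 'rV[R]_m -> 'rV[R]_n) (X : 'rV[R]_m -> 'rV[R]_m)
    (S : 'rV[R]_m -> 'rV[R]_n) (x : 'rV[R]_m) : 'rV[R]_n :=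
  'D_(X x) S x + christoffel_form H (f x) ('D_(X x) f x) (S x).

Definition pushforward (R : realType) (m n : nat)
    (f : 'rV[R]_m -> 'rV[R]_n) (X : 'rV[R]_m -> 'rV[R]_m)
    (x : 'rV[R]_m) : 'rV[R]_n :=
  'D_(X x) f x.

Definition orthonormal_frame (R : realType) (m : nat)
    (G : 'rV[R]_m -> 'M[R]_m) (U : set 'rV[R]_m)
    (e : 'I_m -> 'rV[R]_m -> 'rV[R]_m) : Prop :=
  (forall i, smooth_on U (e i)) /\
  (forall x, U x -> forall i j, inner G x (e i x) (e j x) = (i == j)%:R).

Definition tension (R : realType) (m n : nat) (G : 'rV[R]_m -> 'M[R]_m)
    (H : 'rV[R]_n -> 'M[R]_n) (f : 'rV[R]_m -> 'rV[R]_n)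
    (e : 'I_m -> 'rV[R]_m -> 'rV[R]_m) (x : 'rV[R]_m) : 'rV[R]_n :=
  \sum_i (nabla_along H f (e i) (pushforward f (e i)) x
          - pushforward f (nabla G (e i) (e i)) x).

Definition bitension (R : realType) (m n : nat) (G : 'rV[R]_m -> 'M[R]_m)
    (H : 'rV[R]_n -> 'M[R]_n) (f : 'rV[R]_m -> 'rV[R]_n)
    (e : 'I_m -> 'rV[R]_m -> 'rV[R]_m) (x : 'rV[R]_m) : 'rV[R]_n :=
  let tau := tension G H f e in
  \sum_i (nabla_along H f (e i) (nabla_along H f (e i) tau) x
          - nabla_along H f (nabla G (e i) (e i)) tau x
          - curvature_at H (f x) (pushforward f (e i) x) (tau x)
              (pushforward f (e i) x)).

(* The tension and bitension fields do not depend on the charts or on the local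
   orthonormal frame, and every point has such a frame near it; hence their
   vanishing is asked for all charts and all local frames. *)

Definition harmonic_map (R : realType) (m n : nat)
    (M : smoothManifold R m) (N : smoothManifold R n)
    (g : riemannianMetric M) (h : riemannianMetric N) (phi : M -> N) : Prop :=
  forall a b U e, atlas a -> atlas b ->
    open U -> U `<=` local_dom phi a b -> orthonormal_frame (gram g a) U e ->
    forall x, U x ->
      tension (gram g a) (gram h b) (local_rep phi a b) e x = 0.

Definition biharmonic_map (R : realType) (m n : nat)
    (M : smoothManifold R m) (N : smoothManifold R n)
    (g : riemannianMetric M) (h : riemannianMetric N) (phi : M -> N) : Prop :=
  forall a b U e, atlas a -> atlas b ->
    open U -> U `<=` local_dom phi a b -> orthonormal_frame (gram g a) U e ->
    forall x, U x ->
      bitension (gram g a) (gram h b) (local_rep phi a b) e x = 0.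

(* Main.v *)
Require Import Defs.
From HB Require Import structures.
From mathcomp Require Import all_boot all_order all_algebra.
From mathcomp Require Import all_classical all_reals all_analysis.
From mathcomp Require Import ring lra.

Set Implicit Arguments.
Unset Strict Implicit.
Unset Printing Implicit Defensive.

Import Order.TTheory GRing.Theory Num.Theory.
Import numFieldNormedType.Exports.

Local Open Scope classical_set_scope.
Local Open Scope ring_scope.

(** Let [V] be the unit vertical field, [X_a] the horizontal lifts of the
coordinate fields of the base, [J X = nabla_X V] the (skew) integrability tensor
and [kap = nabla_V V] the curvature of the fibres; the tension field is [- kap].
By the Gauss equation the curvature of the base is [c] plus quadratic terms in
[J]; being constant along the fibres, it forces [J] to be constant along the
fibres.  The Codazzi equation then gives [J <> 0 -> nabla_V kap = 0] and, with the
Riccati equation, expresses all horizontal derivatives of [J] and [kap]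
algebraically.  Biharmonicity becomes
[(2 tr J^2 + |kap|^2 + (2n-1)c) kap - J^2 kap + nabla_V nabla_V kap = 0].

Suppose [kap <> 0].  Where [J <> 0], this makes [kap] an eigenvector of [J^2], and
differentiating the eigenvalue equation twice gives [c = 0], [J kap = 0],
[2 tr J^2 = - |kap|^2] and [J^4 = - |kap|^2 J^2], so that [- J^2 / |kap|^2] is a
projection of trace 1/2.  Where [J = 0], commuting [nabla_V] with the horizontal
derivatives of [nabla_V kap] determines [|nabla_V kap|^2] and leaves a quadratic
equation for [|kap|^2] without admissible root. *)

(** * Derivations and connections over a commutative ring *)

(** The computations are carried out over the ring of smooth functions on an open set, where every
    identity may be differentiated. This ring has zero divisors, so a function cannot be split into
    the cases zero and invertible inside it: what holds for every function is deduced from the ring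
    being reduced and torsion-free, while [kap <> 0] and [J <> 0] are turned into the invertibility
    of a function by shrinking the open set. Both final contradictions are reached by evaluating at
    one point. The fields [X_a] are not orthonormal. They are chosen because they project to
    coordinate fields: their brackets with each other and with [V] are vertical, and the metric, the
    Christoffel symbols and the curvature of the base become functions killed by [V]. Orthonormal
    frames occur only in the definitions of the tension and bitension fields, whose traces are
    rewritten with the inverse metric. *)

Lemma mx_linE (A : comPzRingType) p q (i : 'I_p) (j : 'I_q) :
  (forall B C : 'M[A]_(p, q), (B + C) i j = B i j + C i j) *
  (forall B : 'M[A]_(p, q), (- B) i j = - B i j) *
  (forall a (B : 'M[A]_(p, q)), (a *: B) i j = a * B i j) *
  (forall (B : 'M[A]_(p, q)) l, (B *+ l) i j = B i j *+ l) *
  ((0 : 'M[A]_(p, q)) i j = 0).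
Proof. by do 4?split=> *; rewrite ?mulmxnE ?mxE. Qed.

(** Only linear operations are expanded entrywise. Matrix products stay opaque, so [ring] sees their
    entries as atoms. *)
Ltac mx_ring := apply/matrixP => ? ?; rewrite !mx_linE; ring.

Record derivation (A : comPzRingType) (d : A -> A) : Prop := Derivation {
  derivD : forall x y, d (x + y) = d x + d y;
  derivM : forall x y, d (x * y) = d x * y + x * d y }.

Section Derivation.
Variables (A : comPzRingType) (d : A -> A) (dd : derivation d).

Lemma deriv0 : d 0 = 0.
Proof. by apply: (addrI (d 0)); rewrite -(derivD dd) !addr0. Qed.

Lemma derivN x : d (- x) = - d x.
Proof. by apply: (addrI (d x)); rewrite -(derivD dd) !subrr deriv0. Qed.

Lemma derivB x y : d (x - y) = d x - d y.
Proof. by rewrite (derivD dd) derivN. Qed.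

Lemma deriv1 : d 1 = 0.
Proof.
apply: (addrI (d 1)); rewrite addr0 -[in RHS](mulr1 1) (derivM dd).
by rewrite mul1r mulr1.
Qed.

Lemma deriv_nat n : d n%:R = 0.
Proof.
by elim: n => [|n IH]; rewrite ?deriv0// -natr1 (derivD dd) IH deriv1 addr0.
Qed.

Lemma derivMn x n : d (x *+ n) = d x *+ n.
Proof. by rewrite -mulr_natr (derivM dd) deriv_nat mulr0 addr0 mulr_natr. Qed.

Lemma deriv_sum (I : Type) (r : seq I) (P : pred I) (E : I -> A) :
  d (\sum_(i <- r | P i) E i) = \sum_(i <- r | P i) d (E i).
Proof. exact: (big_morph d (derivD dd) deriv0). Qed.

Lemma deriv_mxD p q (B C : 'M[A]_(p, q)) :
  map_mx d (B + C) = map_mx d B + map_mx d C.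
Proof. by apply/matrixP => i j; rewrite !mxE (derivD dd). Qed.

Lemma deriv_mxN p q (B : 'M[A]_(p, q)) : map_mx d (- B) = - map_mx d B.
Proof. by apply/matrixP => i j; rewrite !mxE derivN. Qed.

Lemma deriv_mxB p q (B C : 'M[A]_(p, q)) :
  map_mx d (B - C) = map_mx d B - map_mx d C.
Proof. by rewrite deriv_mxD deriv_mxN. Qed.

Lemma deriv_mx0 p q : map_mx d (0 : 'M[A]_(p, q)) = 0.
Proof. by apply/matrixP => i j; rewrite !mxE deriv0. Qed.

Lemma deriv_mx1 p : map_mx d (1%:M : 'M[A]_p) = 0.
Proof. by apply/matrixP => i j; rewrite !mxE deriv_nat. Qed.

Lemma deriv_mxM p q r (B : 'M[A]_(p, q)) (C : 'M[A]_(q, r)) :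
  map_mx d (B *m C) = map_mx d B *m C + B *m map_mx d C.
Proof.
apply/matrixP => i j; rewrite !mxE deriv_sum -big_split/=.
by apply: eq_bigr => k _; rewrite (derivM dd) !mxE.
Qed.

Lemma deriv_mxZ p q (a : A) (B : 'M[A]_(p, q)) :
  map_mx d (a *: B) = d a *: B + a *: map_mx d B.
Proof. by apply/matrixP => i j; rewrite !mxE (derivM dd). Qed.

Lemma deriv_mx_sum (I : Type) (r : seq I) (P : pred I) p q
    (E : I -> 'M[A]_(p, q)) :
  map_mx d (\sum_(i <- r | P i) E i) = \sum_(i <- r | P i) map_mx d (E i).
Proof. exact: (big_morph (map_mx d) (@deriv_mxD p q) (@deriv_mx0 p q)). Qed.

Lemma deriv_tr p (B : 'M[A]_p) : d (\tr B) = \tr (map_mx d B).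
Proof. by rewrite /mxtrace deriv_sum; apply: eq_bigr => i _; rewrite mxE. Qed.

End Derivation.

Section Connection.
Variables (A : comPzRingType) (m : nat) (pd : 'I_m -> A -> A).
Hypothesis pd_deriv : forall i, derivation (pd i).
Hypothesis pdC : forall i j a, pd i (pd j a) = pd j (pd i a).

Definition dird (X : 'rV[A]_m) (a : A) : A := \sum_i X 0 i * pd i a.

Lemma dird_deriv X : derivation (dird X).
Proof.
split=> x y; rewrite /dird.
  by rewrite -big_split; apply: eq_bigr => i _; rewrite (derivD (pd_deriv i)) mulrDr.
rewrite mulr_suml mulr_sumr -big_split; apply: eq_bigr => i _ /=.
rewrite (derivM (pd_deriv i)); ring.
Qed.

Lemma dird_mxE X p q (B : 'M[A]_(p, q)) :
  map_mx (dird X) B = \sum_i X 0 i *: map_mx (pd i) B.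
Proof.
by apply/matrixP => i j; rewrite summxE !mxE; apply: eq_bigr => k _; rewrite !mxE.
Qed.

Definition bracket (X Y : 'rV[A]_m) : 'rV[A]_m :=
  map_mx (dird X) Y - map_mx (dird Y) X.

Lemma dird_bracket X Y a :
  dird (bracket X Y) a = dird X (dird Y a) - dird Y (dird X a).
Proof.
have E (Z W : 'rV[A]_m) : dird Z (dird W a) =
    dird (map_mx (dird Z) W) a + \sum_i \sum_j Z 0 i * W 0 j * pd i (pd j a).
  transitivity (\sum_i \sum_j (Z 0 i * pd i (W 0 j) * pd j a
                                + Z 0 i * W 0 j * pd i (pd j a))).
    apply: eq_bigr => i _; rewrite (deriv_sum (pd_deriv i)) mulr_sumr.
    by apply: eq_bigr => j _; rewrite (derivM (pd_deriv i)) mulrDr !mulrA.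
  under eq_bigr do rewrite big_split/=.
  rewrite big_split/= exchange_big/=; congr (_ + _); apply: eq_bigr => j _.
  by rewrite mxE /dird mulr_suml.
have -> : dird (bracket X Y) a =
    dird (map_mx (dird X) Y) a - dird (map_mx (dird Y) X) a.
  by rewrite /dird -sumrB; apply: eq_bigr => i _; rewrite /bracket !mxE mulrBl.
rewrite !E [X in _ = _ - (_ + X)]exchange_big/=.
under [X in _ = _ - (_ + X)]eq_bigr do under eq_bigr do
  rewrite pdC [_ 0 _ * _ 0 _]mulrC.
ring.
Qed.

(** * Connections and their curvature *)

Section Cov.
Variables (p : nat) (th : 'I_m -> 'M[A]_p).

Definition conn_form (X : 'rV[A]_m) : 'M[A]_p := \sum_i X 0 i *: th i.

(** The rows of [B] are [q] sections, differentiated simultaneously; the row index carries no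
    connection term. *)
Definition cov (X : 'rV[A]_m) q (B : 'M[A]_(q, p)) : 'M[A]_(q, p) :=
  map_mx (dird X) B + B *m conn_form X.

(** The products come in the order opposite to the usual one because sections are row vectors:
    differentiating along [j] and then along [i] multiplies by [th j *m th i] on the right. *)
Definition curv_coef i j : 'M[A]_p :=
  map_mx (pd i) (th j) - map_mx (pd j) (th i) + th j *m th i - th i *m th j.

Definition curv_form (X Y : 'rV[A]_m) : 'M[A]_p :=
  \sum_i \sum_j (X 0 i * Y 0 j) *: curv_coef i j.

Lemma covD X q (B C : 'M[A]_(q, p)) : cov X (B + C) = cov X B + cov X C.
Proof. by rewrite /cov (deriv_mxD (dird_deriv X)) mulmxDl addrACA. Qed.

Lemma covN X q (B : 'M[A]_(q, p)) : cov X (- B) = - cov X B.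
Proof. by rewrite /cov (deriv_mxN (dird_deriv X)) mulNmx opprD. Qed.

Lemma covB X q (B C : 'M[A]_(q, p)) : cov X (B - C) = cov X B - cov X C.
Proof. by rewrite covD covN. Qed.

Lemma covM X q r (B : 'M[A]_(r, q)) (C : 'M[A]_(q, p)) :
  cov X (B *m C) = map_mx (dird X) B *m C + B *m cov X C.
Proof. by rewrite /cov (deriv_mxM (dird_deriv X)) mulmxDr mulmxA addrA. Qed.

Lemma covZ X q a (B : 'M[A]_(q, p)) :
  cov X (a *: B) = dird X a *: B + a *: cov X B.
Proof. by rewrite /cov (deriv_mxZ (dird_deriv X)) scalerDr -scalemxAl addrA. Qed.

Lemma row_cov X q (B : 'M[A]_(q, p)) a : row a (cov X B) = cov X (row a B).
Proof. by rewrite /cov raddfD/= row_mul map_row. Qed.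

Lemma conn_formD X Y : conn_form (X + Y) = conn_form X + conn_form Y.
Proof.
by rewrite /conn_form -big_split; apply: eq_bigr => i _; rewrite mxE scalerDl.
Qed.

Lemma conn_formZ a X : conn_form (a *: X) = a *: conn_form X.
Proof.
by rewrite /conn_form scaler_sumr; apply: eq_bigr => i _; rewrite mxE scalerA.
Qed.

Lemma dird_addl X Y a : dird (X + Y) a = dird X a + dird Y a.
Proof.
by rewrite /dird -big_split; apply: eq_bigr => i _; rewrite mxE mulrDl.
Qed.

Lemma dird_scalel b X a : dird (b *: X) a = b * dird X a.
Proof.
by rewrite /dird mulr_sumr; apply: eq_bigr => i _; rewrite mxE mulrA.
Qed.

Lemma cov_addl X Y q (B : 'M[A]_(q, p)) : cov (X + Y) B = cov X B + cov Y B.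
Proof.
rewrite /cov conn_formD mulmxDr addrACA; congr (_ + _).
by apply/matrixP => i j; rewrite !mxE dird_addl.
Qed.

Lemma cov_scalel a X q (B : 'M[A]_(q, p)) : cov (a *: X) B = a *: cov X B.
Proof.
rewrite /cov conn_formZ -scalemxAr scalerDr; congr (_ + _).
by apply/matrixP => i j; rewrite !mxE dird_scalel.
Qed.

Lemma cov_suml (I : Type) (r : seq I) (P : pred I) (X : I -> 'rV[A]_m)
    q (B : 'M[A]_(q, p)) :
  cov (\sum_(i <- r | P i) X i) B = \sum_(i <- r | P i) cov (X i) B.
Proof.
apply: (big_morph (fun Y => cov Y B)) => [Y Z|]; first exact: cov_addl.
by rewrite -(scale0r (0 : 'rV[A]_m)) cov_scalel scale0r.
Qed.

(** The second derivatives of [B] cancel by [dird_bracket] and its first derivatives cancel in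
    pairs, so only a term of order zero in [B] survives. *)
Lemma cov_curv X Y q (B : 'M[A]_(q, p)) :
  cov X (cov Y B) - cov Y (cov X B) - cov (bracket X Y) B
  = B *m curv_form X Y.
Proof.
have dconn (Z W : 'rV[A]_m) : map_mx (dird Z) (conn_form W) =
    conn_form (map_mx (dird Z) W)
    + \sum_i \sum_j (Z 0 i * W 0 j) *: map_mx (pd i) (th j).
  rewrite [in LHS]/conn_form (deriv_mx_sum (dird_deriv Z)).
  under eq_bigr do rewrite (deriv_mxZ (dird_deriv Z)).
  rewrite big_split/= exchange_big/=; congr (_ + _).
    by apply: eq_bigr => j _; rewrite !mxE.
  apply: eq_bigr => j _; rewrite dird_mxE scaler_sumr; apply: eq_bigr => i _.
  by rewrite scalerA mulrC.
have mconn (Z W : 'rV[A]_m) : conn_form Z *m conn_form W =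
    \sum_i \sum_j (Z 0 i * W 0 j) *: (th i *m th j).
  rewrite /conn_form mulmx_suml; apply: eq_bigr => i _; rewrite mulmx_sumr.
  by apply: eq_bigr => j _; rewrite -scalemxAl -scalemxAr scalerA.
have -> : curv_form X Y = map_mx (dird X) (conn_form Y)
    - map_mx (dird Y) (conn_form X) - conn_form (bracket X Y)
    + conn_form Y *m conn_form X - conn_form X *m conn_form Y.
  have -> : conn_form (bracket X Y) =
      conn_form (map_mx (dird X) Y) - conn_form (map_mx (dird Y) X).
    by rewrite /bracket conn_formD -scaleN1r conn_formZ scaleN1r.
  rewrite !dconn !mconn.
  have -> : curv_form X Y = \sum_i \sum_j (X 0 i * Y 0 j) *: map_mx (pd i) (th j)
      - \sum_i \sum_j (Y 0 i * X 0 j) *: map_mx (pd i) (th j)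
      + \sum_i \sum_j (Y 0 i * X 0 j) *: (th i *m th j)
      - \sum_i \sum_j (X 0 i * Y 0 j) *: (th i *m th j).
    rewrite [X in _ = _ - X + _ - _]exchange_big.
    rewrite [X in _ = _ + X - _]exchange_big/=.
    rewrite -sumrB -big_split -sumrB/=; apply: eq_bigr => i _.
    rewrite -sumrB -big_split -sumrB/=; apply: eq_bigr => j _.
    rewrite /curv_coef [Y 0 j * X 0 i]mulrC; mx_ring.
  mx_ring.
have dB : map_mx (dird (bracket X Y)) B =
    map_mx (dird X) (map_mx (dird Y) B) - map_mx (dird Y) (map_mx (dird X) B).
  by apply/matrixP => i j; rewrite mx_linE mx_linE !mxE dird_bracket.
rewrite /cov !(deriv_mxD (dird_deriv _)) !(deriv_mxM (dird_deriv _)) dB.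
rewrite !mulmxDl !mulmxDr ?mulmxN ?mulmxA; mx_ring.
Qed.

End Cov.
End Connection.

(** * The structure equations of a one-dimensional fibration *)

Lemma row_mul_tr_row (A : comPzRingType) p q r (B : 'M[A]_(p, q))
    (C : 'M[A]_(r, q)) i j :
  row i B *m (row j C)^T = ((B *m C^T) i j)%:M.
Proof.
rewrite [LHS]mx11_scalar; congr _%:M; rewrite !mxE.
by apply: eq_bigr => l _; rewrite !mxE.
Qed.

Lemma row_mul_col (A : comPzRingType) p q (B : 'M[A]_(p, q)) (v : 'cV[A]_q) i :
  row i B *m v = ((B *m v) i 0)%:M.
Proof. by rewrite [LHS]mx11_scalar -row_mul mxE. Qed.

(* [D a] and [Dv] are the derivatives along [X_a] and [V], [h] is the base metric,
   [hi] its inverse and [om a] the Christoffel matrix of the base, all pulled back;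
   [Om a b] is the inner product of [nabla_(X_a) V] with [X_b].  Sections are row
   vectors, so endomorphisms act on them from the right. *)
Section StructureEquations.
Variables (A : comPzRingType) (n : nat).
Variables (D : 'I_n -> A -> A) (Dv : A -> A).
Hypothesis D_deriv : forall a, derivation (D a).
Hypothesis Dv_deriv : derivation Dv.
Hypothesis A_red : forall x : A, x * x = 0 -> x = 0.
Hypothesis A_tf : forall (x : A) l, x *+ l.+1 = 0 -> x = 0.
Variable c : A.
Hypothesis D_c : forall a, D a c = 0.
Hypothesis Dv_c : Dv c = 0.
Variables (h hi J Om : 'M[A]_n) (kap : 'rV[A]_n) (k : 'cV[A]_n).
Variable om : 'I_n -> 'M[A]_n.
Hypothesis hT : h^T = h.
Hypothesis hiT : hi^T = hi.
Hypothesis hhi : h *m hi = 1%:M.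
Hypothesis hih : hi *m h = 1%:M.
Hypothesis OmE : Om = J *m h.
Hypothesis kE : k = h *m kap^T.
Hypothesis Om_skew : Om^T = - Om.
Hypothesis om_sym : forall a b d, om a b d = om b a d.
Hypothesis D_h : forall a, map_mx (D a) h = om a *m h + h *m (om a)^T.
Hypothesis Dv_h : map_mx Dv h = 0.
Hypothesis Dv_om : forall a, map_mx Dv (om a) = 0.
Hypothesis D_comm : forall a x, D a (Dv x) - Dv (D a x) = k a 0 * Dv x.
(** With [nabla] and [R] those of the total space, of constant curvature [c], the equations
    [riccati], [codazzi] and [gauss] are the horizontal parts of [R(X_a, V) V], [R(X_a, X_b) V] and
    [R(X_a, X_b) X_d]. [D_comm] says that the bracket of [X_a] and [V] is [k a 0] times [V]. *)
Hypothesis riccati : forall a,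
  map_mx (D a) kap + kap *m om a - map_mx Dv (row a J)
  - row a J *m J - k a 0 *: kap = c *: delta_mx 0 a.
Hypothesis codazzi : forall a b,
  map_mx (D a) (row b J) + row b J *m om a
  - (map_mx (D b) (row a J) + row a J *m om b) + (Om a b *+ 2) *: kap = 0.

Definition base_curv a b : 'M[A]_n := map_mx (D a) (om b) + om b *m om a
  - (map_mx (D b) (om a) + om a *m om b).

Hypothesis gauss : forall a b,
  base_curv a b
  - (row b Om)^T *m row a J + (row a Om)^T *m row b J + (Om a b *+ 2) *: J =
  c *: ((row b h)^T *m delta_mx 0 a - (row a h)^T *m delta_mx 0 b).

Lemma A_tf2 (x : A) : x + x = 0 -> x = 0.
Proof. by rewrite -mulr2n => /A_tf. Qed.

Lemma A_cube (x : A) : x * x * x = 0 -> x = 0.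
Proof. by move=> x3; apply/A_red/A_red; rewrite mulrA x3 mul0r. Qed.

Lemma OmC a b : Om b a = - Om a b.
Proof. by rewrite -[Om in LHS]trmxK Om_skew !mxE. Qed.

Lemma Omhi : Om *m hi = J.
Proof. by rewrite OmE -mulmxA hhi mulmx1. Qed.

Lemma D_Dv_mx p q (B : 'M[A]_(p, q)) a :
  map_mx Dv (map_mx (D a) B) =
  map_mx (D a) (map_mx Dv B) - k a 0 *: map_mx Dv B.
Proof. by apply/matrixP => i j; rewrite !mx_linE !mxE -D_comm; ring. Qed.

(** The commutator of [D a] and [Dv] is a multiple of [Dv], so [D a] preserves the kernel of
    [Dv]. *)
Lemma Dv_base_curv a b : map_mx Dv (base_curv a b) = 0.
Proof.
rewrite /base_curv !(deriv_mxB Dv_deriv) !(deriv_mxD Dv_deriv).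
rewrite !(deriv_mxM Dv_deriv) !D_Dv_mx !Dv_om !(deriv_mx0 (D_deriv _)).
by rewrite !(mulmx0, mul0mx, scaler0, subr0, addr0).
Qed.

Lemma gauss_Om a b d e :
  (base_curv a b *m h) d e - Om b d * Om a e + Om a d * Om b e
  + (Om a b *+ 2) * Om d e = c * (h b d * h a e - h a d * h b e).
Proof.
have /(congr1 (fun B => (B *m h) d e)) := gauss a b.
rewrite !(mulmxDl, mulNmx) -!scalemxAl mulmxBl -!mulmxA -!row_mul -OmE.
rewrite -!rowE !mx_linE ![(_^T *m _) d e]mxE !big_ord1 ![(_^T) d _]mxE.
by rewrite ![row _ _ _ _]mxE.
Qed.

(* By [gauss], [Om a b ^ 2] is constant along the fibres; differentiating this twice
   gives [(Dv (Om a b)) ^ 3 = 0], also where [Om a b] vanishes. *)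
Lemma Dv_Om : map_mx Dv Om = 0.
Proof.
have DRh a b d e : Dv ((base_curv a b *m h) d e) = 0.
  have -> : Dv ((base_curv a b *m h) d e) = (map_mx Dv (base_curv a b *m h)) d e.
    by rewrite [RHS]mxE.
  by rewrite (deriv_mxM Dv_deriv) Dv_base_curv Dv_h mulmx0 mul0mx addr0 mxE.
have Dh a b : Dv (h a b) = 0.
  by have /matrixP/(_ a b) := Dv_h; rewrite !mxE.
apply/matrixP => a b; rewrite !mxE; set x := Om a b.
have xx : x * x *+ 3 =
    c * (h b a * h a b - h a a * h b b) - (base_curv a b *m h) a b.
  have O0 : Om a a = 0 by apply: A_tf2; rewrite {1}OmC addNr.
  by rewrite -gauss_Om O0 (OmC a b) -/x; ring.
have xDx : x * Dv x = 0.
  have /(congr1 Dv) := xx.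
  rewrite (derivB Dv_deriv) DRh (derivM Dv_deriv) Dv_c (derivB Dv_deriv).
  rewrite !(derivM Dv_deriv) !Dh -mulr_natr (derivM Dv_deriv) (deriv_nat Dv_deriv).
  rewrite (derivM Dv_deriv) !(mulr0, mul0r, addr0, subr0) => E.
  by apply: (@A_tf _ 5); rewrite -E; ring.
apply: A_cube; have /(congr1 Dv) := xDx.
rewrite (derivM Dv_deriv) (deriv0 Dv_deriv) => /(congr1 (fun y => y * Dv x)).
by rewrite mul0r mulrDl [x * _ * _]mulrAC xDx mul0r addr0.
Qed.

Lemma Dv_hi : map_mx Dv hi = 0.
Proof.
have /(congr1 (fun B => hi *m map_mx Dv B)) := hhi.
by rewrite (deriv_mxM Dv_deriv) Dv_h mul0mx add0r (deriv_mx1 Dv_deriv) mulmx0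
  mulmxA hih mul1mx.
Qed.

Lemma Dv_J : map_mx Dv J = 0.
Proof. by rewrite -Omhi (deriv_mxM Dv_deriv) Dv_Om Dv_hi mul0mx mulmx0 addr0. Qed.

(** In [codazzi] everything except [kap] is built from [J], [om] and [Om], which are constant along
    the fibres; hence its derivative along [V] reduces to the last term. *)
Lemma Om_Dv_kap a b : Om a b *: map_mx Dv kap = 0.
Proof.
have DJ l : map_mx Dv (row l J) = 0 by rewrite map_row Dv_J linear0.
have /(congr1 (map_mx Dv)) := codazzi a b.
rewrite (deriv_mxD Dv_deriv) (deriv_mxB Dv_deriv) !(deriv_mxD Dv_deriv).
rewrite !(deriv_mxM Dv_deriv) !D_Dv_mx !DJ !Dv_om !(deriv_mx0 (D_deriv _)).
rewrite (deriv_mxZ Dv_deriv) (deriv_mx0 Dv_deriv).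
have -> : Dv (Om a b *+ 2) = 0.
  rewrite -mulr_natr (derivM Dv_deriv) (deriv_nat Dv_deriv).
  by have /matrixP/(_ a b) := Dv_Om; rewrite !mxE => ->; rewrite mul0r mulr0 addr0.
rewrite !(mulmx0, mul0mx, scaler0, scale0r, subr0, addr0, add0r) => /matrixP E.
apply/matrixP => i j; have := E i j; rewrite !mx_linE mulrnAl.
by rewrite !(oppr0, addr0, add0r) => /A_tf.
Qed.

(** * Horizontal derivatives of [J] and [kap] *)

Definition cov_row a p (S : 'M[A]_(p, n)) := map_mx (D a) S + S *m om a.
Definition cov_end a (B : 'M[A]_n) := map_mx (D a) B + B *m om a - om a *m B.
(** The horizontal covariant differential of [kap], as an endomorphism. It is [riccati] solved for
    the derivative of [kap], the term in [Dv J] having vanished; see [cov_row_kap]. *)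
Definition Dkap : 'M[A]_n := J *m J + k *m kap + c%:M.

Lemma row_Dkap a :
  row a Dkap = row a J *m J + k a 0 *: kap + c *: delta_mx 0 a.
Proof.
rewrite /Dkap !linearD/= row_mul; congr (_ + _ + _).
  by rewrite row_mul [row a k]mx11_scalar mxE mul_scalar_mx.
by rewrite -scalemx1 linearZ/= row1.
Qed.

Lemma cov_row_kap a : cov_row a kap = row a Dkap.
Proof.
have := riccati a; rewrite map_row Dv_J linear0 row_Dkap => <-.
by rewrite /cov_row; mx_ring.
Qed.

Lemma cov_end_mul a B C :
  cov_end a (B *m C) = cov_end a B *m C + B *m cov_end a C.
Proof.
rewrite /cov_end (deriv_mxM (D_deriv a)) !(mulmxDl, mulmxDr, mulmxBl, mulmxBr).
by rewrite !mulmxA mulmxN mulNmx ?mulmxA; mx_ring.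
Qed.

Lemma row_cov_end a b B :
  row b (cov_end a B) = cov_row a (row b B) - row b (om a) *m B.
Proof. by rewrite /cov_end /cov_row raddfB raddfD/= !row_mul map_row. Qed.

(* As for the Levi-Civita connection, a tensor that is skew in its last two
   arguments is determined by its antisymmetrisation in the first two, which is
   what [codazzi] provides. *)
Lemma cov_end_J a : cov_end a J =
  - ((row a Om)^T *m kap) + k *m row a J + k a 0 *: J.
Proof.
pose T a b d := (cov_end a J *m h) b d.
have kaph : kap *m h = k^T by rewrite kE trmx_mul trmxK hT.
have Tsym a' b d : T a' b d - T b a' d = - (Om a' b *+ 2) * k d 0.
  have E i j : T i j d = ((cov_row i (row j J) - row j (om i) *m J) *m h) 0 d.
    by rewrite -row_cov_end -row_mul mxE.
  rewrite !E; have -> : row b (om a') = row a' (om b).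
    by apply/rowP => l; rewrite !mxE om_sym.
  have := codazzi a' b; rewrite -/(cov_row a' (row b J)) -/(cov_row b (row a' J)).
  set P := cov_row _ _; set Q := cov_row _ _ => /(congr1 (mulmx^~ h)).
  rewrite !(mulmxDl, mulNmx) -!scalemxAl kaph mul0mx => /matrixP/(_ 0 d).
  rewrite !mx_linE [k^T _ _]mxE => E'.
  by rewrite -[RHS]add0r -E'; ring.
have Tskew a' b d : T a' b d = - T a' d b.
  have -> : T a' b d = (map_mx (D a') Om - om a' *m Om - Om *m (om a')^T) b d.
    rewrite /T /cov_end OmE (deriv_mxM (D_deriv a')) D_h.
    rewrite !(mulmxDl, mulmxDr, mulNmx) -!mulmxA; congr ((_ : 'M[A]_n) _ _); mx_ring.
  have -> : T a' d b = (map_mx (D a') Om - om a' *m Om - Om *m (om a')^T)^T b d.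
    rewrite [RHS]mxE /T /cov_end OmE (deriv_mxM (D_deriv a')) D_h.
    rewrite !(mulmxDl, mulmxDr, mulNmx) -!mulmxA; congr ((_ : 'M[A]_n) _ _); mx_ring.
  rewrite !linearB/= !trmx_mul map_trmx trmxK Om_skew (deriv_mxN (D_deriv a')).
  by rewrite mulmxN mulNmx !mx_linE; ring.
suff E : cov_end a J *m h =
    - ((row a Om)^T *m k^T) + k *m row a Om + k a 0 *: Om.
  rewrite -[LHS]mulmx1 -hhi mulmxA E !(mulmxDl, mulNmx) -scalemxAl.
  rewrite -!mulmxA -row_mul Omhi; congr (- (_ *m _) + _ + _).
  by rewrite kE trmx_mul trmxK hT -mulmxA hhi mulmx1.
apply/matrixP => b d; rewrite -/(T a b d); apply/eqP; rewrite -subr_eq0; apply/eqP.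
apply: A_tf2; rewrite !mx_linE ![(_ *m _) b d]mxE !big_ord1 ![_^T _ _]mxE.
rewrite ![row _ _ _ _]mxE.
have TT : T a b d + T a b d =
    (T a b d - T b a d) - (T b d a - T d b a) + (T d a b - T a d b).
  by rewrite (Tskew b d a) (Tskew d b a) (Tskew a d b); ring.
rewrite addrACA TT !Tsym (OmC a d); ring.
Qed.

(** * Divergences, Ricci curvature of the base and the bitension field *)

Lemma hik : hi *m k = kap^T.
Proof. by rewrite kE mulmxA hih mul1mx. Qed.

Lemma trkhi : k^T *m hi = kap.
Proof. by apply: trmx_inj; rewrite trmx_mul trmxK hiT hik. Qed.

Lemma kaph : kap *m h = k^T.
Proof. by rewrite kE trmx_mul trmxK hT. Qed.

Lemma tr_hi_Om : \tr (hi *m Om^T) = 0.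
Proof.
apply: A_tf2; rewrite -[in X in X + _]mxtrace_tr trmx_mul trmxK hiT mxtrace_mulC.
by rewrite Om_skew mulmxN raddfN/= subrr.
Qed.

Lemma sum_col_row p (v : 'cV[A]_n) (B : 'M[A]_(n, p)) :
  \sum_a v a 0 *: row a B = v^T *m B.
Proof. by rewrite mulmx_sum_row; apply: eq_bigr => a _; rewrite mxE. Qed.

(** Contraction of the index [a] with the row index of [B a] by the inverse metric. For
    [B a = cov_end a T] it is the divergence of [T], and for [T = Dkap] the horizontal Laplacian of
    [kap]. *)
Definition h_trace (B : 'I_n -> 'M[A]_n) : 'rV[A]_n := \sum_a row a hi *m B a.

Lemma h_trace_cov_J : h_trace (fun a => cov_end a J) = (kap *m J) *+ 2.
Proof.
rewrite /h_trace; under eq_bigr => a _.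
  rewrite cov_end_J mulmxDr mulmxDr mulmxN !mulmxA row_mul_tr_row row_mul_col.
  rewrite !mul_scalar_mx -scalemxAr -scaleNr scalemxAl.
over.
rewrite !big_split/= -scaler_suml sumrN -/(mxtrace _) tr_hi_Om oppr0 scale0r add0r.
by rewrite sum_col_row -mulmx_suml sum_col_row hik trmxK trkhi -mulr2n.
Qed.

(** In [cov_end_J] only the first term contributes: [J] is skew for [h], which makes the
    contributions of the other two opposite. *)
Lemma h_trace_J_cov_J :
  h_trace (fun a => J *m cov_end a J) = \tr (J *m J) *: kap.
Proof.
have JOm : hi *m J *m Om^T = - (hi *m (J *m J) *m h) by rewrite Om_skew OmE mulmxN !mulmxA.
have hiJk : hi *m J *m k = - (kap *m J)^T.
  have OmN : Om = - (h *m J^T) by rewrite -[Om]opprK -Om_skew OmE trmx_mul hT.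
  rewrite kE !mulmxA -[hi *m J *m h]mulmxA -OmE OmN mulmxN mulmxA hih mul1mx.
  by rewrite mulNmx trmx_mul.
rewrite /h_trace; under eq_bigr => a _.
  rewrite cov_end_J !mulmxDr !mulmxN !mulmxA -row_mul row_mul_tr_row row_mul_col.
  rewrite !mul_scalar_mx -!scalemxAr -scaleNr scalemxAl row_mul scalemxAl.
over.
rewrite !big_split/= -scaler_suml sumrN -/(mxtrace _).
rewrite sum_col_row -!mulmx_suml sum_col_row hiJk trkhi JOm.
rewrite raddfN/= opprK mxtrace_mulC !mulmxA hhi mul1mx linearN/= trmxK mulNmx.
by rewrite addrNK.
Qed.

Lemma cov_end_kkap a :
  cov_end a (k *m kap) = h *m (row a Dkap)^T *m kap + k *m row a Dkap.
Proof.
rewrite -cov_row_kap /cov_end /cov_row (deriv_mxM (D_deriv a)) kE.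
rewrite (deriv_mxM (D_deriv a)) D_h -map_trmx [(_ + _)^T]linearD/= trmx_mul.
by rewrite !(mulmxDl, mulmxDr) !mulmxA; mx_ring.
Qed.

Lemma h_trace_cov_kkap :
  h_trace (fun a => cov_end a (k *m kap)) = \tr Dkap *: kap + kap *m Dkap.
Proof.
rewrite /h_trace; under eq_bigr => a _.
  rewrite cov_end_kkap mulmxDr !mulmxA row_mul_col mul_scalar_mx -row_mul hih.
  rewrite row_mul_tr_row mul_scalar_mx mul1mx.
over.
rewrite big_split/= -scaler_suml -/(mxtrace _) mxtrace_tr.
by rewrite sum_col_row hik trmxK.
Qed.

Lemma h_trace_cov_Dkap : h_trace (fun a => cov_end a Dkap) =
  (\tr (J *m J) + \tr Dkap) *: kap + kap *m (J *m J *+ 2 + Dkap).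
Proof.
have -> : h_trace (fun a => cov_end a Dkap) =
    h_trace (fun a => cov_end a J) *m J + h_trace (fun a => J *m cov_end a J)
    + h_trace (fun a => cov_end a (k *m kap)).
  rewrite /h_trace mulmx_suml -!big_split; apply: eq_bigr => a _ /=.
  rewrite -mulmxA -!mulmxDr -cov_end_mul; congr (_ *m _).
  have c0 : map_mx (D a) c%:M = 0 :> 'M[A]_n.
    apply/matrixP => i j; rewrite !mxE -mulr_natr (derivM (D_deriv a)) D_c.
    by rewrite (deriv_nat (D_deriv a)) mulr0 mul0r addr0.
  rewrite /cov_end /Dkap !(deriv_mxD (D_deriv a)) c0 !(mulmxDl, mulmxDr).
  rewrite mul_scalar_mx mul_mx_scalar; mx_ring.
rewrite h_trace_cov_J h_trace_J_cov_J h_trace_cov_kkap.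
rewrite !mulr2n !(mulmxDl, mulmxDr) !mulmxA scalerDl; mx_ring.
Qed.

Definition kap2 : A := (kap *m k) 0 0.

Lemma tr_Dkap : \tr Dkap = \tr (J *m J) + kap2 + c *+ n.
Proof.
rewrite /Dkap !raddfD/= mxtrace_scalar [\tr (k *m kap)]mxtrace_mulC; congr (_ + _ + _).
by rewrite /mxtrace big_ord1.
Qed.

Lemma kap_Dkap : kap *m Dkap = kap *m J *m J + (kap2 + c) *: kap.
Proof.
rewrite /Dkap !mulmxDr mulmxA [kap *m (k *m kap)]mulmxA [kap *m k]mx11_scalar.
by rewrite mul_scalar_mx mul_mx_scalar scalerDl addrA.
Qed.

(** This contraction is minus the Ricci tensor of the base. The factor 3 is that of O'Neill's
    formula: one [J *m J] comes from the first product of [gauss] and two come from its term in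
    [Om a b *+ 2]. *)
Lemma h_trace_base_curv d : h_trace (fun a => base_curv a d) =
  row d (J *m J) *+ 3 + (c * (1 - n%:R)) *: delta_mx 0 d.
Proof.
have E a : base_curv a d = (row d Om)^T *m row a J - (row a Om)^T *m row d J
    - (Om a d *+ 2) *: J
    + c *: ((row d h)^T *m delta_mx 0 a - (row a h)^T *m delta_mx 0 d).
  by rewrite -gauss; mx_ring.
have trm1 : \sum_a row a hi *m ((row d Om)^T *m row a J) = row d (J *m J).
  under eq_bigr do rewrite mulmxA row_mul_tr_row mul_scalar_mx.
  rewrite row_mul mulmx_sum_row; apply: eq_bigr => a _; congr (_ *: _).
  by rewrite -Omhi -[in RHS]hiT -[Om in RHS]trmxK -trmx_mul !mxE.
have trm2 : \sum_a row a hi *m ((row a Om)^T *m row d J) = 0.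
  under eq_bigr do rewrite mulmxA row_mul_tr_row mul_scalar_mx.
  by rewrite -scaler_suml -/(mxtrace _) tr_hi_Om scale0r.
have trm3 : \sum_a row a hi *m ((Om a d *+ 2) *: J) = - row d (J *m J) *+ 2.
  have E' a : row a hi *m ((Om a d *+ 2) *: J) = - (Om d a *: row a hi *m J) *+ 2.
    by rewrite OmC -scalemxAr -scalemxAl; mx_ring.
  rewrite (eq_bigr _ (fun a _ => E' a)) sumrMnl sumrN -mulmx_suml.
  congr (- _ *+ 2); rewrite row_mul -[X in row d X]Omhi row_mul; congr (_ *m _).
  by rewrite mulmx_sum_row; apply: eq_bigr => a _; rewrite mxE.
have trm4 : \sum_a row a hi *m ((row d h)^T *m delta_mx 0 a) = delta_mx 0 d.
  under eq_bigr do rewrite mulmxA row_mul_tr_row mul_scalar_mx hT hih.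
  rewrite (bigD1 d)//= mxE eqxx scale1r big1 ?addr0// => a ad.
  by rewrite mxE (negbTE ad) scale0r.
have trm5 : \sum_a row a hi *m ((row a h)^T *m delta_mx 0 d) = n%:R *: delta_mx 0 d.
  under eq_bigr do rewrite mulmxA row_mul_tr_row mul_scalar_mx hT hih mxE eqxx.
  by rewrite -scaler_suml sumr_const card_ord.
have E2 a : row a hi *m base_curv a d =
    row a hi *m ((row d Om)^T *m row a J) - row a hi *m ((row a Om)^T *m row d J)
    - row a hi *m ((Om a d *+ 2) *: J)
    + c *: (row a hi *m ((row d h)^T *m delta_mx 0 a)
            - row a hi *m ((row a h)^T *m delta_mx 0 d)).
  by rewrite E mulmxDr [_ *m (c *: _)]linearZ/= !mulmxBr.
rewrite /h_trace.
under eq_bigr do rewrite E2.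
rewrite !big_split/= !sumrN -scaler_sumr sumrB trm1 trm2 trm3 trm4 trm5.
mx_ring.
Qed.

Lemma sum_h_trace_base_curv (u : 'rV[A]_n) :
  \sum_d u 0 d *: h_trace (fun a => base_curv a d) =
  (u *m J *m J) *+ 3 + (c * (1 - n%:R)) *: u.
Proof.
have E d : u 0 d *: h_trace (fun a => base_curv a d) =
    (u 0 d *: row d (J *m J)) *+ 3 + (c * (1 - n%:R)) *: (u 0 d *: delta_mx 0 d).
  by rewrite h_trace_base_curv; mx_ring.
under eq_bigr do rewrite E.
rewrite big_split/= -scaler_sumr -row_sum_delta sumrMnl.
by rewrite -mulmxA mulmx_sum_row.
Qed.

Definition bitension_coef : A :=
  \tr (J *m J) *+ 2 + kap2 + (n.*2%:R - 1) * c.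

(** In the coefficient [2n - 1] of [c], the part [n] comes from the trace of [Dkap] and [n - 1] from
    the Ricci term. The product [kap *m Dkap] in the Laplacian cancels the one subtracted here, and
    two copies of [kap *m J *m J] meet three from the Ricci term. *)
Lemma bitension_kap :
  h_trace (fun a => cov_end a Dkap) + map_mx Dv (map_mx Dv kap) - kap *m Dkap
  - \sum_d kap 0 d *: h_trace (fun a => base_curv a d) =
  bitension_coef *: kap - kap *m J *m J + map_mx Dv (map_mx Dv kap).
Proof.
rewrite h_trace_cov_Dkap sum_h_trace_base_curv mulmxDr kap_Dkap tr_Dkap.
rewrite /bitension_coef mulr2n mulmxDr mulmxA -mul2n natrM; mx_ring.
Qed.

Lemma cov_row_mul a p (S : 'M[A]_(p, n)) B :
  cov_row a (S *m B) = cov_row a S *m B + S *m cov_end a B.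
Proof.
rewrite /cov_row /cov_end (deriv_mxM (D_deriv a)) !(mulmxDl, mulmxDr, mulmxN).
by rewrite !mulmxA; mx_ring.
Qed.

Lemma cov_rowZ a p x (S : 'M[A]_(p, n)) :
  cov_row a (x *: S) = D a x *: S + x *: cov_row a S.
Proof. by rewrite /cov_row (deriv_mxZ (D_deriv a)) scalerDr -scalemxAl addrA. Qed.

Lemma cov_row_tr a (S : 'rV[A]_n) :
  map_mx (D a) (S *m k) = cov_row a S *m k + S *m (h *m (row a Dkap)^T).
Proof.
rewrite -cov_row_kap /cov_row (deriv_mxM (D_deriv a)) kE.
rewrite (deriv_mxM (D_deriv a)) D_h -map_trmx [(_ + _)^T]linearD/= trmx_mul.
by rewrite !(mulmxDl, mulmxDr) !mulmxA; mx_ring.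
Qed.

Lemma mx11_tr (S : 'M[A]_1) : S^T = S.
Proof. by apply/matrixP => i j; rewrite mxE !ord1. Qed.

Lemma D_kap2 a : D a kap2 = (row a Dkap *m k) 0 0 *+ 2.
Proof.
have /matrixP/(_ 0 0) := cov_row_tr a kap; rewrite cov_row_kap.
have -> : kap *m (h *m (row a Dkap)^T) = row a Dkap *m k.
  rewrite mulmxA kaph -trmx_mul mx11_tr //.
by rewrite mxE mx_linE /kap2 mulr2n.
Qed.

Lemma row_Dkap_k a :
  row a Dkap *m k = row a J *m J *m k + ((kap2 + c) * k a 0)%:M.
Proof.
rewrite row_Dkap !mulmxDl -!scalemxAl -rowE -addrA; congr (_ + _).
rewrite [kap *m k]mx11_scalar [row a k]mx11_scalar -/kap2 mxE.
by rewrite !scale_scalar_mx -raddfD/=; congr _%:M; ring.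
Qed.

(** A trace does not see the commutator with [om a], so [D a] may be replaced by [cov_end a] and
    [cov_end_J] applies. *)
Lemma D_trJJ a : D a (\tr (J *m J)) =
  ((row a J *m J *m k) 0 0 - (kap *m J *m (row a Om)^T) 0 0
   + k a 0 * \tr (J *m J)) *+ 2.
Proof.
have tr1 (B : 'M[A]_1) : \tr B = B 0 0 by rewrite /mxtrace big_ord1.
have -> : D a (\tr (J *m J)) = \tr (cov_end a (J *m J)).
  rewrite (deriv_tr (D_deriv a)) /cov_end raddfB raddfD/=.
  by rewrite [\tr (om a *m _)]mxtrace_mulC addrK.
rewrite cov_end_mul raddfD/= [X in _ + X = _]mxtrace_mulC -mulr2n; congr (_ *+ 2).
rewrite cov_end_J !mulmxDl !raddfD/= mulNmx -scalemxAl raddfN/= linearZ/=.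
rewrite -[_^T *m kap *m J]mulmxA [\tr (_^T *m _)]mxtrace_mulC tr1.
rewrite -[k *m _ *m J]mulmxA [\tr (k *m _)]mxtrace_mulC tr1.
by rewrite [X in X + _]addrC.
Qed.

(** * The algebraic consequences of biharmonicity where [kap] does not vanish *)

Section IntegrableCase.
Hypothesis n_ge2 : (2 <= n)%N.
Hypothesis h_nondeg : forall v : 'rV[A]_n, v *m h *m v^T = 0 -> v = 0.
Hypothesis kap2_unit : exists ai, kap2 * ai = 1.
Hypothesis bitension0 :
  bitension_coef *: kap - kap *m J *m J + map_mx Dv (map_mx Dv kap) = 0.

Lemma kap2_reg x : kap2 * x = 0 -> x = 0.
Proof.
by have [ai aE] := kap2_unit; move=> e; rewrite -[x]mul1r -aE mulrAC e mul0r.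
Qed.

Lemma kap_reg x : x *: kap = 0 -> x = 0.
Proof.
move=> /(congr1 (mulmx^~ k)); rewrite -scalemxAl mul0mx => /matrixP/(_ 0 0).
by rewrite !mx_linE mulrC -/kap2 => /kap2_reg.
Qed.

(** With [Dv kap = 0], biharmonicity reads [kap *m J *m J = l *: kap]. Its horizontal derivatives
    form one matrix identity [E]; applying [E] to [kap] makes [l] constant, and the formula for the
    derivative of [l] then forces [l = 0] and [c = 0]. What is left of [l = 0] and of [E] are the
    two conclusions. *)
Lemma nonintegrable_case : (exists a b x, Om a b * x = 1) ->
  [/\ \tr (J *m J) *+ 2 + kap2 = 0 &
      kap2 *: (J *m J) + J *m J *m (J *m J) = 0].
Proof.
move=> [a0 [b0 [x Omx]]].
have nu0 : map_mx Dv kap = 0.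
  by rewrite -[LHS]scale1r -Omx mulrC -scalerA Om_Dv_kap scaler0.
set l := bitension_coef.
have kJJ : kap *m J *m J = l *: kap.
  have := bitension0; rewrite nu0 (deriv_mx0 Dv_deriv) addr0 => /eqP.
  by rewrite subr_eq0 => /eqP.
have hJT : h *m J^T = - Om by rewrite -Om_skew OmE trmx_mul hT.
have JJk : J *m J *m k = l *: k.
  have : h *m (kap *m J *m J)^T = l *: k by rewrite kJJ linearZ/= -scalemxAr kE.
  rewrite !trmx_mul !mulmxA hJT mulNmx OmE !mulNmx -[J *m h *m J^T]mulmxA hJT.
  by rewrite mulmxN mulNmx opprK OmE !mulmxA -[_ *m h *m _]mulmxA -kE.
(* [J] is skew for the metric, so this 1 by 1 matrix equals its own opposite. *)
have kJk : kap *m J *m k = 0.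
  have kJkN : (kap *m J *m k)^T = - (kap *m J *m k).
    rewrite !trmx_mul kE trmx_mul trmxK hT !mulmxA -[kap *m h *m J^T]mulmxA hJT.
    by rewrite OmE mulmxN mulNmx !mulmxA.
  apply/matrixP => i j; rewrite [RHS]mxE; apply: A_tf2.
  have /matrixP/(_ i j) := kJkN; rewrite mx11_tr mx_linE => {1}->; exact: addNr.
have kJOm a : kap *m J *m (row a Om)^T = - (l * k a 0)%:M.
  rewrite -[LHS]mx11_tr trmx_mul trmxK -row_mul OmE trmx_mul -mulmxA [h *m _]mulmxA.
  rewrite hJT mulNmx OmE !mulmxN !mulmxA -[_ *m h *m _]mulmxA -kE JJk.
  by rewrite linearN/= linearZ/= [row a k]mx11_scalar mxE scale_scalar_mx.
have JJka a : row a J *m J *m k = (l * k a 0)%:M.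
  by rewrite -!row_mul JJk linearZ/= [row a k]mx11_scalar mxE scale_scalar_mx.
(* The derivatives of [\tr (J *m J)] and [kap2] can be written with [l] alone, because the
   eigenvalue equation evaluates the terms quadratic in [J]. *)
have Dl a : D a l = k a 0 * (l *+ 12 - (n%:R - 1) * c *+ 4).
  rewrite {1}/l /bitension_coef 2!(derivD (D_deriv a)) (derivMn (D_deriv a)).
  rewrite (derivM (D_deriv a)) D_c mulr0 addr0 (derivB (D_deriv a)).
  rewrite (deriv_nat (D_deriv a)) (deriv1 (D_deriv a)) D_trJJ D_kap2 row_Dkap_k.
  rewrite JJka kJOm !mx_linE !mxE !eqxx !mulr1n /l /bitension_coef -mul2n natrM.
  ring.
have Ea a : row a J *m J *m J *m J + (kap2 + c - l) *: (row a J *m J)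
    + (l *+ 3 * k a 0) *: kap - (row a J *m k) 0 0 *: (kap *m J)
    - (l * c) *: delta_mx 0 a - D a l *: kap = 0.
  have kOm : kap *m (row a Om)^T = ((row a J *m k) 0 0)%:M.
    rewrite -[LHS]mx11_tr trmx_mul trmxK OmE row_mul -mulmxA -kE.
    exact: mx11_scalar.
  have := congr1 (@cov_row a 1) kJJ.
  rewrite cov_rowZ !cov_row_mul cov_row_kap row_Dkap cov_end_J.
  rewrite !(mulmxDl, mulmxDr, mulmxN, mulNmx) -!scalemxAl -!scalemxAr -!rowE.
  rewrite ![kap *m (_ *m _)]mulmxA ![kap *m J *m (_ *m _)]mulmxA kOm kJOm kJk.
  rewrite kJJ [kap *m k]mx11_scalar -/kap2 mulNmx !mul_scalar_mx mul0mx -!scalemxAl.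
  rewrite kJJ => /eqP; rewrite -subr_eq0 => /eqP E; rewrite -E; mx_ring.
pose e : A := l *+ 12 - (n%:R - 1) * c *+ 4.
(* The equations [Ea] are the rows of a single matrix equation. *)
have E : J *m J *m J *m J + (kap2 + c - l) *: (J *m J) + (l *+ 3 - e) *: (k *m kap)
    - (J *m k) *m (kap *m J) - (l * c)%:M = 0.
  apply/row_matrixP => a; rewrite linear0 -(Ea a) Dl -/e.
  rewrite !(linearB, linearD)/= !linearZ/= !row_mul -scalemx1 linearZ/= row1.
  rewrite [row a k]mx11_scalar mxE mul_scalar_mx.
  by rewrite [X in _ - X *m (kap *m J)]mx11_scalar mul_scalar_mx; mx_ring.
(* Multiplying [E] by [kap] on the left turns it into [kap2 * (4 l - e) = 0] times [kap]. *)
have e4l : e = l *+ 4.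
  apply/eqP; rewrite -subr_eq0; apply/eqP/kap2_reg/kap_reg.
  have /(congr1 (mulmx kap)) := E.
  rewrite !(mulmxDr, mulmxN) -!scalemxAr ![kap *m (_ *m _)]mulmxA !mulmxA kJJ kJk.
  rewrite mul_mx_scalar mulmx0 !mul0mx -!scalemxAl kJJ [kap *m k]mx11_scalar -/kap2.
  rewrite mul_scalar_mx => E'; rewrite -[RHS]oppr0 -E'; mx_ring.
(* Now [8 l = 4 (n - 1) c], so [l] has no horizontal derivative, whereas [Dl] gives [k a 0 * e];
   contracting with [kap] yields [kap2 * e = 0]. *)
have e0 : e = 0.
  apply/kap2_reg; rewrite mulrC; have Dl0 a : D a l = 0.
    apply: (@A_tf _ 7); rewrite -(derivMn (D_deriv a)).
    have -> : l *+ 8 = (n%:R - 1) * c *+ 4 by rewrite -[RHS](subKr (l *+ 12)) -/e e4l; ring.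
    rewrite (derivMn (D_deriv a)) (derivM (D_deriv a)) D_c (derivB (D_deriv a)).
    by rewrite (deriv_nat (D_deriv a)) (deriv1 (D_deriv a)); ring.
  rewrite /kap2 mxE mulr_sumr big1// => a _.
  by rewrite mulrCA [e * _]mulrC -Dl Dl0 mulr0.
have l0 : l = 0 by apply: (@A_tf _ 3); rewrite -e4l.
have c0 : c = 0.
  have E0 : c *+ (n.-1 * 4) = 0.
    have := e0; rewrite /e l0 mul0rn sub0r => /eqP; rewrite oppr_eq0 => /eqP <-.
    rewrite mulrnA; congr (_ *+ 4).
    by rewrite -[LHS]mulr_natl -subn1 natrB// ltnW.
  by apply: (@A_tf _ (n.-1 * 4).-1); rewrite prednK// muln_gt0 -subn1 subn_gt0 n_ge2.
(* The squared norm of [kap *m J] is [- l * kap2], which is zero. *)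
have kJ0 : kap *m J = 0.
  apply: h_nondeg; rewrite trmx_mul mulmxA -[_ *m h *m _]mulmxA hJT mulmxN mulNmx.
  by rewrite OmE !mulmxA kJJ l0 scale0r !mul0mx oppr0.
split.
  by have := l0; rewrite /l /bitension_coef c0 mulr0 addr0.
have := E; rewrite e0 l0 c0 kJ0 !(mulmx0, mul0rn, mulr0, raddf0, subr0, addr0, scale0r).
by rewrite addrC !mulmxA.
Qed.

(** Write [nu] for [Dv kap], [b] for its squared norm and [s] for its inner product with [kap].
    Biharmonicity becomes [Dv nu = - f kap], which closes the system: [kap2], [s], [b] and [f] have
    [Dv]-derivatives polynomial in each other. The trace identity [T] differentiated along [V]
    yields [s = 0]; then [Dv s = 0] gives [b = f * kap2], and substituting this into [T] gives the
    second conclusion. *)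
Lemma integrable_case : J = 0 ->
  [/\ (map_mx Dv kap *m h *m (map_mx Dv kap)^T) 0 0
        = (kap2 + (n.*2%:R - 1) * c) * kap2 &
      (kap2 + (n.*2%:R - 1) * c) * c *+ n = - (kap2 * (kap2 + c)) *+ 2].
Proof.
move=> J0; pose nu := map_mx Dv kap; rewrite -/nu.
pose f : A := kap2 + (n.*2%:R - 1) * c.
pose nu' := h *m nu^T.
pose s := (kap *m nu') 0 0; pose b := (nu *m nu') 0 0.
have Dvh S : map_mx Dv (h *m S^T) = h *m (map_mx Dv S)^T :> 'cV_n.
  by rewrite (deriv_mxM Dv_deriv) Dv_h mul0mx add0r map_trmx.
have Dnu : map_mx Dv nu = - f *: kap.
  have := bitension0; rewrite /bitension_coef J0 !mulmx0 raddf0 mul0rn add0r subr0 -/nu -/f.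
  by move=> /eqP; rewrite addrC addr_eq0 -scaleNr => /eqP.
(* There is no curvature term, since [V] projects to zero; only the bracket of [X_a] and [V]
   contributes. *)
have comm a (S : 'rV[A]_n) :
    cov_row a (map_mx Dv S) = map_mx Dv (cov_row a S) + k a 0 *: map_mx Dv S.
  rewrite /cov_row (deriv_mxD Dv_deriv) (deriv_mxM Dv_deriv) D_Dv_mx Dv_om mulmx0.
  mx_ring.
have Dvk a : Dv (k a 0) = nu' a 0.
  by have /matrixP/(_ a 0) := Dvh kap; rewrite -kE mxE.
have Dvnu' a : Dv (nu' a 0) = - f * k a 0.
  have /matrixP/(_ a 0) := Dvh nu; rewrite mxE => ->.
  by rewrite Dnu linearZ/= -scalemxAr -kE mxE.
have rK a : row a Dkap = k a 0 *: kap + c *: delta_mx 0 a.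
  by rewrite row_Dkap J0 mulmx0 add0r.
have covnu a : cov_row a nu = (k a 0 *+ 2) *: nu + nu' a 0 *: kap.
  rewrite comm cov_row_kap rK (deriv_mxD Dv_deriv) !(deriv_mxZ Dv_deriv) Dvk Dv_c.
  have -> : map_mx Dv (delta_mx 0 a) = 0 :> 'rV_n.
    by apply/matrixP => i j; rewrite !mxE (deriv_nat Dv_deriv).
  mx_ring.
have Df a : D a f = (kap2 + c) * k a 0 *+ 2.
  rewrite /f (derivD (D_deriv a)) D_kap2 row_Dkap_k J0 mulmx0 !mul0mx add0r.
  rewrite (derivM (D_deriv a)) D_c (derivB (D_deriv a)) (deriv_nat (D_deriv a)).
  by rewrite (deriv1 (D_deriv a)) mxE eqxx mulr1n; ring.
(* [comm] for [nu], where the vertical derivative of [nu] is known on one side and its horizontal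
   derivative on the other. *)
have star a : (nu' a 0 *+ 3) *: nu
    + (((kap2 + c) *+ 2 - f *+ 3) * k a 0) *: kap + (f * c) *: delta_mx 0 a = 0.
  have := comm a nu; rewrite covnu Dnu cov_rowZ cov_row_kap rK (derivN (D_deriv a)) Df.
  rewrite (deriv_mxD Dv_deriv) !(deriv_mxZ Dv_deriv) Dvnu' Dnu -/nu.
  rewrite (derivMn Dv_deriv) Dvk => /eqP; rewrite -subr_eq0 => /eqP E.
  by rewrite -[RHS]oppr0 -E; mx_ring.
have T : b *+ 3 + ((kap2 + c) *+ 2 - f *+ 3) * kap2 + f * c *+ n = 0.
  have E : (nu' *+ 3) *m nu + (((kap2 + c) *+ 2 - f *+ 3) *: k) *m kap
      + (f * c)%:M = 0.
    apply/row_matrixP => a; rewrite linear0 -(star a) !linearD/= ![row a (_ *m _)]row_mul.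
    rewrite -[(f * c)%:M]scalemx1 [row a ((f * c) *: _)]linearZ/= row1 [row a (nu' *+ 3)]mx11_scalar.
    by rewrite [row a (_ *: k)]mx11_scalar !mxE !mul_scalar_mx.
  have := congr1 mxtrace E; rewrite !raddfD/= mxtrace0 mxtrace_scalar.
  rewrite [\tr (_ *+ 3 *m nu)]mxtrace_mulC [\tr (_ *m kap)]mxtrace_mulC.
  rewrite /mxtrace !big_ord1 => <-.
  by rewrite -scaler_nat -!scalemxAr !mx_linE -/kap2 -/b; ring.
have Dv11 (S S' : 'rV[A]_n) : Dv ((S *m (h *m S'^T)) 0 0) =
    (map_mx Dv S *m (h *m S'^T)) 0 0 + (S *m (h *m (map_mx Dv S')^T)) 0 0.
  transitivity ((map_mx Dv (S *m (h *m S'^T))) 0 0); first by rewrite [RHS]mxE.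
  by rewrite (deriv_mxM Dv_deriv) Dvh mxE.
have ipC (S S' : 'rV[A]_n) : (S *m (h *m S'^T)) 0 0 = (S' *m (h *m S^T)) 0 0.
  transitivity ((S *m (h *m S'^T))^T 0 0); first by rewrite mx11_tr.
  by rewrite !trmx_mul trmxK hT mulmxA.
have Dva : Dv kap2 = s *+ 2 by rewrite /kap2 kE Dv11 -/nu ipC mulr2n.
have Dvb : Dv b = - (f * s) *+ 2.
  by rewrite /b Dv11 Dnu [X in _ + X]ipC -scalemxAl mx_linE -/nu' -/s; ring.
have Dvs : Dv s = b - f * kap2.
  by rewrite /s Dv11 Dnu linearZ/= -!scalemxAr mx_linE -kE -/kap2 -/nu -/nu' -/b; ring.
have Dvf : Dv f = s *+ 2.
  rewrite /f (derivD Dv_deriv) Dva (derivM Dv_deriv) Dv_c (derivB Dv_deriv).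
  by rewrite (deriv_nat Dv_deriv) (deriv1 Dv_deriv); ring.
(* The vertical derivative of [T], divided by -2. *)
have sq : s * (kap2 *+ 5 + (n%:R *+ 11 - 8) * c) = 0.
  have /(congr1 Dv) := T.
  rewrite (deriv0 Dv_deriv) 2!(derivD Dv_deriv) !(derivMn Dv_deriv).
  rewrite !(derivM Dv_deriv) (derivB Dv_deriv) !(derivMn Dv_deriv) (derivD Dv_deriv).
  rewrite Dvb Dvf Dva Dv_c /f => E; apply: (@A_tf _ 1).
  rewrite -[LHS]opprK -[RHS]oppr0 -E -mul2n natrM; ring.
(* The second factor of [sq] has derivative [10 s]; differentiating [sq] once more and multiplying
   by [s] leaves [10 s^3 = 0]. *)
have s0 : s = 0.
  apply: A_cube; apply: (@A_tf _ 9).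
  have /(congr1 (fun y => Dv y * s)) := sq.
  rewrite (deriv0 Dv_deriv) mul0r (derivM Dv_deriv) (derivD Dv_deriv).
  rewrite (derivMn Dv_deriv) Dva (derivM Dv_deriv) Dv_c (derivB Dv_deriv).
  rewrite (derivMn Dv_deriv) !(deriv_nat Dv_deriv) => E.
  set q := kap2 *+ 5 + _ in sq E.
  rewrite -E mulrDl -[Dv s * q * s]mulrA [q * s]mulrC sq; ring.
have bf : b = f * kap2.
  by apply/eqP; rewrite -subr_eq0 -Dvs s0 (deriv0 Dv_deriv).
split; first by rewrite -/f -bf -mulmxA.
rewrite -/f; apply/eqP; rewrite -subr_eq0 -T bf; apply/eqP; ring.
Qed.
End IntegrableCase.
End StructureEquations.

(** * Adapted frames *)

(** The sum depends on the family [P] only through [P^T *m S *m P]. This is what allows an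
    orthonormal frame to be exchanged for the frame made of the lifts and [V]. *)
Lemma bilinear_trace (A : comPzRingType) m p q
    (Q : 'rV[A]_m -> 'rV[A]_m -> 'rV[A]_q) :
  (forall u, (forall x y, Q (x + y) u = Q x u + Q y u) /\
             (forall a x, Q (a *: x) u = a *: Q x u)) ->
  (forall u, (forall x y, Q u (x + y) = Q u x + Q u y) /\
             (forall a x, Q u (a *: x) = a *: Q u x)) ->
  forall (P : 'M[A]_(p, m)) (S : 'M[A]_p),
  \sum_i \sum_j S i j *: Q (row i P) (row j P) =
  \sum_i \sum_j (P^T *m S *m P) i j *: Q (delta_mx 0 i) (delta_mx 0 j).
Proof.
move=> Ql Qr P S.
have Q0l u : Q 0 u = 0 by rewrite -(scale0r (0 : 'rV_m)) (Ql u).2 scale0r.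
have Q0r u : Q u 0 = 0 by rewrite -(scale0r (0 : 'rV_m)) (Qr u).2 scale0r.
have QE u v : Q u v = \sum_i \sum_j (u 0 i * v 0 j) *: Q (delta_mx 0 i) (delta_mx 0 j).
  rewrite {1}[u]row_sum_delta (big_morph (Q^~ v) (Ql v).1 (Q0l v)).
  apply: eq_bigr => i _; rewrite (Ql v).2 {1}[v]row_sum_delta.
  rewrite (big_morph (Q _) (Qr _).1 (Q0r _)) scaler_sumr; apply: eq_bigr => j _.
  by rewrite (Qr _).2 scalerA.
under eq_bigr do under eq_bigr do rewrite QE scaler_sumr.
under eq_bigr do rewrite exchange_big/=.
rewrite exchange_big/=; apply: eq_bigr => i _.
under eq_bigr do under eq_bigr do rewrite scaler_sumr.
under eq_bigr do rewrite exchange_big/=.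
rewrite exchange_big/=; apply: eq_bigr => j _.
rewrite mxE scaler_suml exchange_big/=; apply: eq_bigr => b _.
rewrite [(P^T *m S) i b]mxE mulr_suml scaler_suml; apply: eq_bigr => a _.
by rewrite scalerA !mxE; congr (_ *: _); ring.
Qed.

(** * Second fundamental form, tension and bitension of a map over a ring *)

Section FieldsAlong.
Variables (A : comPzRingType) (m n : nat) (pd : 'I_m -> A -> A).
Variables (C : 'I_m -> 'M[A]_m) (F : 'M[A]_(m, n)).
Variables (om : 'I_n -> 'M[A]_n) (RN : 'I_n -> 'I_n -> 'M[A]_n).

Definition pull_conn (i : 'I_m) : 'M[A]_n := \sum_a F i a *: om a.

Lemma conn_form_pull Y : conn_form pull_conn Y = \sum_a (Y *m F) 0 a *: om a.
Proof.
rewrite /conn_form /pull_conn; under eq_bigr do rewrite scaler_sumr.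
rewrite exchange_big/=; apply: eq_bigr => a _; rewrite mxE scaler_suml.
by apply: eq_bigr => i _; rewrite scalerA.
Qed.

(** [F] is the matrix of the differential, so [Z *m F] is the image of [Z] and this is the covariant
    derivative of the differential. *)
Definition second_form (Y Z : 'rV[A]_m) : 'rV[A]_n :=
  cov pd pull_conn Y (Z *m F) - cov pd C Y Z *m F.

Definition hessian_along (S : 'rV[A]_n) (Y Z : 'rV[A]_m) : 'rV[A]_n :=
  cov pd pull_conn Y (cov pd pull_conn Z S) - cov pd pull_conn (cov pd C Y Z) S.

Definition tensor_form (S T : 'rV[A]_n) : 'M[A]_n :=
  \sum_a \sum_b (S 0 a * T 0 b) *: RN a b.

Definition jacobi_term (S : 'rV[A]_n) (Y Z : 'rV[A]_m) : 'rV[A]_n :=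
  Z *m F *m tensor_form (Y *m F) S.

Definition tension_alg (E : 'M[A]_m) : 'rV[A]_n :=
  \sum_i second_form (row i E) (row i E).

Definition bitension_alg (E : 'M[A]_m) (S : 'rV[A]_n) : 'rV[A]_n :=
  \sum_i (hessian_along S (row i E) (row i E) - jacobi_term S (row i E) (row i E)).
End FieldsAlong.

(** * Covariant derivatives in the frame of the lifts and the unit vertical field *)

Section AdaptedFrame.
Variables (A : comPzRingType) (m n : nat) (pd : 'I_m -> A -> A).
Hypothesis pd_deriv : forall i, derivation (pd i).
Hypothesis pdC : forall i j a, pd i (pd j a) = pd j (pd i a).
Hypothesis A_red : forall x : A, x * x = 0 -> x = 0.
Hypothesis A_tf : forall (x : A) l, x *+ l.+1 = 0 -> x = 0.
Variables (c : A) (G Gi : 'M[A]_m) (h hi : 'M[A]_n) (F : 'M[A]_(m, n)).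
Variables (X : 'M[A]_(n, m)) (V : 'rV[A]_m).
Variables (C : 'I_m -> 'M[A]_m) (om : 'I_n -> 'M[A]_n).
Variable dom : 'I_n -> 'I_n -> 'M[A]_n.
Hypothesis pd_c : forall i, pd i c = 0.
Hypothesis GT : G^T = G.
Hypothesis hT : h^T = h.
Hypothesis hiT : hi^T = hi.
Hypothesis hhi : h *m hi = 1%:M.
Hypothesis hih : hi *m h = 1%:M.
Hypothesis XF : X *m F = 1%:M.
Hypothesis VF : V *m F = 0.
Hypothesis XGX : X *m G *m X^T = h.
Hypothesis XGV : X *m G *m V^T = 0.
Hypothesis VGV : V *m G *m V^T = 1%:M.
Hypothesis GGi : G *m Gi = 1%:M.
Hypothesis complete : Gi = X^T *m hi *m X + V^T *m V.
Hypothesis F_closed : forall i j a, pd i (F j a) = pd j (F i a).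
Hypothesis C_sym : forall i j l, C i j l = C j i l.
Hypothesis C_metric : forall i, map_mx (pd i) G = C i *m G + G *m (C i)^T.
Hypothesis C_curv : forall i j,
  curv_coef pd C i j = c *: (G *m (delta_mx j i - delta_mx i j)).
Hypothesis om_sym : forall a b d, om a b d = om b a d.
Hypothesis pd_h : forall i,
  map_mx (pd i) h = \sum_a F i a *: (om a *m h + h *m (om a)^T).
Hypothesis pd_om : forall i b, map_mx (pd i) (om b) = \sum_a F i a *: dom a b.

Local Notation nab := (cov pd C).
Local Notation D := (dird pd).

Variables (J Om : 'M[A]_n) (kap : 'rV[A]_n) (k : 'cV[A]_n).
Hypothesis row_shape : forall a, row a J = nab (row a X) V *m G *m X^T *m hi.
Hypothesis kapE : kap = nab V V *m G *m X^T *m hi.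
Hypothesis OmE : Om = J *m h.
Hypothesis kE : k = h *m kap^T.

Lemma addrr_eq0 (x : A) : x + x = 0 -> x = 0.
Proof. by rewrite -mulr2n => /A_tf. Qed.

Lemma dird_c Y : D Y c = 0.
Proof. by rewrite /dird big1// => i _; rewrite pd_c mulr0. Qed.

(** The hypothesis is the chain rule for a function pulled back from the base with partial
    derivatives [B']; [X_a] projects to the coordinate field [a]. *)
Lemma dirdX_pull p q (B : 'M[A]_(p, q)) (B' : 'I_n -> 'M[A]_(p, q)) a :
  (forall i, map_mx (pd i) B = \sum_b F i b *: B' b) ->
  map_mx (D (row a X)) B = B' a.
Proof.
move=> dB; rewrite dird_mxE.
under eq_bigr do rewrite dB scaler_sumr.
rewrite exchange_big/= (bigD1 a)//= [X in _ + X]big1 => [|b ba].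
  under eq_bigr do rewrite scalerA.
  rewrite -scaler_suml addr0; have -> : \sum_i row a X 0 i * F i a = (X *m F) a a.
    by rewrite mxE; apply: eq_bigr => i _; rewrite mxE.
  by rewrite XF mxE eqxx scale1r.
under eq_bigr do rewrite scalerA.
rewrite -scaler_suml; have -> : \sum_i row a X 0 i * F i b = (X *m F) a b.
  by rewrite mxE; apply: eq_bigr => i _; rewrite mxE.
by rewrite XF mxE eq_sym (negbTE ba) scale0r.
Qed.

Lemma dirdV_pull p q (B : 'M[A]_(p, q)) (B' : 'I_n -> 'M[A]_(p, q)) :
  (forall i, map_mx (pd i) B = \sum_b F i b *: B' b) -> map_mx (D V) B = 0.
Proof.
move=> dB; rewrite dird_mxE.
under eq_bigr do rewrite dB scaler_sumr.
rewrite exchange_big/= big1// => b _.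
under eq_bigr do rewrite scalerA.
rewrite -scaler_suml; have -> : \sum_i V 0 i * F i b = (V *m F) 0 b by rewrite mxE.
by rewrite VF mxE scale0r.
Qed.

Lemma dird_h a : map_mx (D (row a X)) h = om a *m h + h *m (om a)^T.
Proof.
exact: (@dirdX_pull _ _ _ (fun a => om a *m h + h *m (om a)^T)).
Qed.

Lemma dirdV_h : map_mx (D V) h = 0.
Proof.
exact: (@dirdV_pull _ _ _ (fun a => om a *m h + h *m (om a)^T)).
Qed.

Lemma dird_om a b : map_mx (D (row a X)) (om b) = dom a b.
Proof. exact: (@dirdX_pull _ _ _ (fun a => dom a b)). Qed.

Lemma dirdV_om b : map_mx (D V) (om b) = 0.
Proof. exact: (@dirdV_pull _ _ _ (fun a => dom a b)). Qed.

Lemma nab_metric Y p q (P : 'M[A]_(p, m)) (Q : 'M[A]_(q, m)) :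
  map_mx (D Y) (P *m G *m Q^T) = nab Y P *m G *m Q^T + P *m G *m (nab Y Q)^T.
Proof.
have dG : map_mx (D Y) G = conn_form C Y *m G + G *m (conn_form C Y)^T.
  rewrite dird_mxE /conn_form mulmx_suml linear_sum/= mulmx_sumr -big_split/=.
  by apply: eq_bigr => i _; rewrite C_metric scalerDr linearZ/= -scalemxAl -scalemxAr.
rewrite !(deriv_mxM (dird_deriv pd_deriv Y)) dG /cov -map_trmx.
rewrite [(_ + _)^T]linearD/= trmx_mul !(mulmxDl, mulmxDr) !mulmxA; mx_ring.
Qed.

Lemma nab_torsion Y Z : nab Y Z - nab Z Y = bracket pd Y Z.
Proof.
rewrite /cov /bracket; suff -> : Z *m conn_form C Y = Y *m conn_form C Z by mx_ring.
apply/matrixP => i l; rewrite !mxE ord1.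
have E (S T : 'rV[A]_m) : \sum_j S 0 j * conn_form C T j l =
    \sum_j \sum_i S 0 j * T 0 i * C i j l.
  apply: eq_bigr => j _; rewrite /conn_form summxE mulr_sumr.
  by apply: eq_bigr => r _; rewrite mxE mulrA.
rewrite !E exchange_big/=; apply: eq_bigr => j _; apply: eq_bigr => r _.
by rewrite C_sym; ring.
Qed.

(** Because [F] is closed, the terms containing its derivatives cancel. In particular fields whose
    images have constant components have a vertical bracket. *)
Lemma bracketF Y Z : bracket pd Y Z *m F =
  map_mx (D Y) (Z *m F) - map_mx (D Z) (Y *m F).
Proof.
rewrite /bracket !(deriv_mxM (dird_deriv pd_deriv _)) mulmxBl.
suff -> : Z *m map_mx (D Y) F = Y *m map_mx (D Z) F by mx_ring.
apply/matrixP => i a; rewrite !mxE ord1.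
under eq_bigr do rewrite mxE /dird mulr_sumr.
under [RHS]eq_bigr do rewrite mxE /dird mulr_sumr.
rewrite exchange_big/=; apply: eq_bigr => j _; apply: eq_bigr => r _.
by rewrite F_closed; ring.
Qed.

Lemma frame_decomp p (W : 'M[A]_(p, m)) :
  W = W *m G *m X^T *m hi *m X + W *m G *m V^T *m V.
Proof. by rewrite -[LHS]mulmx1 -GGi complete !mulmxDr !mulmxA. Qed.

Lemma verticalX p (W : 'M[A]_(p, m)) : W *m F = 0 -> W *m G *m X^T = 0.
Proof.
move=> WF; have : W *m F *m h = 0 by rewrite WF mul0mx.
rewrite [W in X in X -> _]frame_decomp mulmxDl.
by rewrite -[_ *m X *m F]mulmxA XF mulmx1 -[_ *m V *m F]mulmxA VF mulmx0 addr0
  -mulmxA hih mulmx1.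
Qed.

Lemma bracketXX a b : bracket pd (row a X) (row b X) *m G *m X^T = 0.
Proof.
apply: verticalX; rewrite bracketF -!row_mul XF !map_row.
by rewrite !(deriv_mx1 (dird_deriv pd_deriv _)) !linear0 addr0.
Qed.

Lemma bracketXV a : bracket pd (row a X) V *m G *m X^T = 0.
Proof.
apply: verticalX; rewrite bracketF -!row_mul XF VF !map_row.
rewrite !(deriv_mx1 (dird_deriv pd_deriv _)) !(deriv_mx0 (dird_deriv pd_deriv _)).
by rewrite !linear0 addr0.
Qed.

Lemma VGX : V *m G *m X^T = 0.
Proof. by apply: trmx_inj; rewrite !trmx_mul trmxK GT mulmxA XGV trmx0. Qed.

Lemma nabVGV Y : nab Y V *m G *m V^T = 0.
Proof.
have := nab_metric Y V V; rewrite VGV (deriv_mx1 (dird_deriv pd_deriv _)).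
have -> : V *m G *m (nab Y V)^T = (nab Y V *m G *m V^T)^T.
  by rewrite !trmx_mul trmxK GT mulmxA.
move=> /matrixP E; apply/matrixP => i j; have := E i j.
by rewrite !mx_linE [_^T _ _]mxE !ord1 => /esym /addrr_eq0.
Qed.

Lemma nabXV a : nab (row a X) V = row a J *m X.
Proof. by rewrite {1}[nab _ _]frame_decomp nabVGV mul0mx addr0 row_shape. Qed.

Lemma nabVV : nab V V = kap *m X.
Proof. by rewrite {1}[nab _ _]frame_decomp nabVGV mul0mx addr0 kapE. Qed.

Lemma row_Om a : row a Om = nab (row a X) V *m G *m X^T.
Proof. by rewrite OmE row_mul row_shape -mulmxA hih mulmx1. Qed.

(** The bracket of [X_a] and [V] is vertical, so the derivatives of [X_a] along [V] and of [V] along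
    [X_a] have the same horizontal part. *)
Lemma nabVX_GX : nab V X *m G *m X^T = Om.
Proof.
apply/row_matrixP => a; rewrite row_Om !row_mul row_cov.
have -> : nab V (row a X) = nab (row a X) V - bracket pd (row a X) V.
  by rewrite -nab_torsion; mx_ring.
by rewrite [(_ - _) *m G]mulmxBl mulmxBl bracketXV subr0.
Qed.

(** The inner products of the lifts are those of the base, hence constant along the fibres; their
    derivative along [V] is [Om + Om^T]. *)
Lemma Om_skew : Om^T = - Om.
Proof.
have := nab_metric V X X; rewrite XGX dirdV_h nabVX_GX.
have -> : X *m G *m (nab V X)^T = Om^T.
  by rewrite -nabVX_GX !trmx_mul trmxK GT mulmxA.
by move=> /esym /eqP; rewrite addrC addr_eq0 => /eqP.
Qed.

Lemma nabVX : nab V X = J *m X - k *m V.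
Proof.
rewrite {1}[nab _ _]frame_decomp nabVX_GX {1}OmE -[J *m h *m hi]mulmxA hhi mulmx1.
congr (_ + _); rewrite -mulNmx; congr (_ *m _).
have := nab_metric V X V; rewrite XGV (deriv_mx0 (dird_deriv pd_deriv _)).
rewrite nabVV trmx_mul mulmxA XGX -kE => /esym/eqP.
by rewrite addr_eq0 => /eqP.
Qed.

(** Uniqueness of the Levi-Civita connection: the difference [S] is symmetric in its first two
    indices, both connections being torsion-free modulo vertical brackets, and skew in its last two,
    both being metric. Such a tensor vanishes. *)
Lemma nabXX_GX a : nab (row a X) X *m G *m X^T = om a *m h.
Proof.
pose S a := nab (row a X) X *m G *m X^T - om a *m h.
suff S0 i j l : S i j l = 0.
  by apply/eqP; rewrite -subr_eq0; apply/eqP/matrixP => b d; rewrite S0 mxE.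
have Srow i' j' : row j' (S i') =
    nab (row i' X) (row j' X) *m G *m X^T - row j' (om i') *m h.
  by rewrite /S raddfB/= !row_mul row_cov.
have Ssym i' j' l' : S i' j' l' = S j' i' l'.
  have E b d x : S b d x = row d (S b) 0 x by rewrite [RHS]mxE.
  rewrite !E !Srow.
  have -> : row j' (om i') = row i' (om j') by apply/rowP => b; rewrite !mxE om_sym.
  have -> : nab (row i' X) (row j' X) =
      nab (row j' X) (row i' X) + bracket pd (row i' X) (row j' X).
    by rewrite -nab_torsion; mx_ring.
  by rewrite [(_ + _) *m G]mulmxDl [(_ + _) *m X^T]mulmxDl bracketXX addr0.
have Sskew i' j' l' : S i' j' l' = - S i' l' j'.
  have := nab_metric (row i' X) X X; rewrite XGX dird_h.
  have -> : X *m G *m (nab (row i' X) X)^T = (nab (row i' X) X *m G *m X^T)^T.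
    by rewrite !trmx_mul trmxK GT mulmxA.
  have -> : h *m (om i')^T = (om i' *m h)^T by rewrite trmx_mul hT.
  move=> /matrixP/(_ j' l'); rewrite /S !mx_linE [_^T j' l']mxE [_^T j' l']mxE.
  set p := (nab _ _ *m _ *m _) j' l'; set q := (nab _ _ *m _ *m _) l' j' => E.
  by rewrite -[p](addrK q) -E; ring.
apply: addrr_eq0; rewrite [X in X + _]Ssym [X in X + _]Sskew [S j l i]Ssym.
by rewrite [S l j i]Sskew [S l i j]Ssym [S i l j]Sskew !opprK addNr.
Qed.

Lemma nabXX a : nab (row a X) X = om a *m X - (row a Om)^T *m V.
Proof.
rewrite {1}[nab _ _]frame_decomp nabXX_GX -[om a *m h *m hi]mulmxA hhi mulmx1.
congr (_ + _); rewrite -mulNmx; congr (_ *m _).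
have := nab_metric (row a X) X V; rewrite XGV (deriv_mx0 (dird_deriv pd_deriv _)).
rewrite row_Om !trmx_mul trmxK GT mulmxA => /esym/eqP.
by rewrite addr_eq0 => /eqP.
Qed.

Lemma bracketXXE a b :
  bracket pd (row a X) (row b X) = - (Om a b *+ 2) *: V.
Proof.
have E i j : nab (row i X) (row j X) = row j (om i) *m X - Om i j *: V.
  rewrite -row_cov nabXX raddfB/= row_mul [row j (_ *m V)]row_mul; congr (_ - _).
  apply/matrixP => s t; rewrite [LHS]mxE big_ord1 [RHS]mxE.
  by rewrite [row j _ _ _]mxE [_^T _ _]mxE [row i _ _ _]mxE (ord1 s).
rewrite -nab_torsion !E.
have -> : row b (om a) = row a (om b) by apply/rowP => s; rewrite !mxE om_sym.
have -> : Om b a = - Om a b by rewrite -[Om in LHS]trmxK Om_skew !mxE.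
mx_ring.
Qed.

Lemma bracketXVE a : bracket pd (row a X) V = k a 0 *: V.
Proof.
rewrite -nab_torsion nabXV -row_cov nabVX raddfB/= row_mul [row a (k *m V)]row_mul.
rewrite opprB addrC subrK; apply/matrixP => s t.
by rewrite [LHS]mxE big_ord1 [RHS]mxE [row a _ _ _]mxE (ord1 s).
Qed.

Lemma dird_comm a x :
  D (row a X) (D V x) - D V (D (row a X) x) = k a 0 * D V x.
Proof. by rewrite -dird_bracket// bracketXVE dird_scalel. Qed.

(** Acting on a row [W], this matrix gives [c] times [<W, Z> Y - <W, Y> Z], the curvature of a space
    form. *)
Lemma curv_formE Y Z : curv_form pd C Y Z = c *: (G *m (Z^T *m Y - Y^T *m Z)).
Proof.
rewrite /curv_form.
under eq_bigr do under eq_bigr do rewrite C_curv scalerA mulrC -scalerA scalemxAr.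
under eq_bigr do rewrite -scaler_sumr -mulmx_sumr.
rewrite -scaler_sumr -mulmx_sumr; congr (_ *: (_ *m _)); 
rewrite [Z^T *m Y]matrix_sum_delta [Y^T *m Z]matrix_sum_delta [X in _ = X - _]exchange_big/=.
rewrite -sumrB; apply: eq_bigr => i _; rewrite -sumrB; apply: eq_bigr => j _.
by rewrite scalerBr !mxE !big_ord1 !mxE [Z 0 j * _]mulrC.
Qed.

Lemma XGrowX b : X *m G *m (row b X)^T = (row b h)^T.
Proof. by rewrite -XGX !row_mul !trmx_mul trmxK GT mulmxA. Qed.

Lemma VGrowX b : V *m G *m (row b X)^T = 0.
Proof. by rewrite tr_row colE mulmxA VGX mul0mx. Qed.

(** Here and in the next two lemmas the curvature identity is expanded in the frame, and
    multiplication by [F] on the right keeps only the horizontal components. *)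
Lemma riccati_eq a :
  map_mx (D (row a X)) kap + kap *m om a - map_mx (D V) (row a J)
  - row a J *m J - k a 0 *: kap = c *: delta_mx 0 a.
Proof.
have := cov_curv pd_deriv pdC C (row a X) V V.
rewrite nabVV nabXV bracketXVE cov_scalel !covM// nabXX nabVX nabVV curv_formE.
move=> /(congr1 (mulmx^~ F)).
rewrite !(mulmxBl, mulmxDl, mulmxBr, mulmxDr, =^~ scalemxAl, =^~ scalemxAr, mulNmx, mulmxN) -!mulmxA.
rewrite !XF !VF !mulmx0 !mulmx1 -[row a X *m F]row_mul XF ?mulmxA VGV mul1mx row1.
by rewrite !subr0 => <-; mx_ring.
Qed.

Lemma codazzi_eq a b :
  map_mx (D (row a X)) (row b J) + row b J *m om a
  - (map_mx (D (row b X)) (row a J) + row a J *m om b) + (Om a b *+ 2) *: kap = 0.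
Proof.
have := cov_curv pd_deriv pdC C (row a X) (row b X) V.
rewrite bracketXXE cov_scalel !nabXV nabVV !covM// !nabXX curv_formE.
move=> /(congr1 (mulmx^~ F)).
rewrite !(mulmxBl, mulmxDl, mulmxBr, mulmxDr, =^~ scalemxAl, =^~ scalemxAr, mulNmx, mulmxN) -!mulmxA.
rewrite !XF !VF !mulmx0 !mulmx1 ![V *m (G *m _)]mulmxA ![V *m G *m (_ *m _)]mulmxA.
rewrite !VGrowX !mul0mx !subr0 scaler0.
by move=> E; rewrite -E; mx_ring.
Qed.

Lemma gauss_eq a b :
  map_mx (D (row a X)) (om b) + om b *m om a
  - (map_mx (D (row b X)) (om a) + om a *m om b)
  - (row b Om)^T *m row a J + (row a Om)^T *m row b J + (Om a b *+ 2) *: J =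
  c *: ((row b h)^T *m delta_mx 0 a - (row a h)^T *m delta_mx 0 b).
Proof.
have := cov_curv pd_deriv pdC C (row a X) (row b X) X.
rewrite bracketXXE cov_scalel !nabXX nabVX !covB// !covM// !nabXX !nabXV curv_formE.
move=> /(congr1 (mulmx^~ F)).
rewrite !(mulmxBl, mulmxDl, mulmxBr, mulmxDr, =^~ scalemxAl, =^~ scalemxAr, mulNmx, mulmxN) -!mulmxA.
rewrite !XF !VF !mulmx0 !mulmx1 ![X *m (G *m _)]mulmxA ![X *m G *m (_ *m _)]mulmxA.
rewrite !XGrowX -![row _ X *m F]row_mul XF !row1 => <-.
mx_ring.
Qed.

(** * Tension and bitension fields in the adapted frame *)

Local Notation nabN := (cov pd (pull_conn F om)).

Lemma nabN_X a q (S : 'M[A]_(q, n)) :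
  nabN (row a X) S = map_mx (D (row a X)) S + S *m om a.
Proof.
rewrite /cov conn_form_pull -row_mul XF row1; congr (_ + _ *m _).
rewrite (bigD1 a)//= mxE !eqxx scale1r big1 ?addr0// => b ba.
by rewrite mxE (negbTE ba) andbF scale0r.
Qed.

Lemma nabN_V q (S : 'M[A]_(q, n)) : nabN V S = map_mx (D V) S.
Proof.
rewrite /cov conn_form_pull VF big1 ?mulmx0 ?addr0// => a _.
by rewrite mxE scale0r.
Qed.

Lemma nabN_rowX (u : 'rV[A]_n) q (S : 'M[A]_(q, n)) :
  nabN (u *m X) S = \sum_a u 0 a *: (map_mx (D (row a X)) S + S *m om a).
Proof.
rewrite mulmx_sum_row cov_suml; apply: eq_bigr => a _.
by rewrite cov_scalel nabN_X.
Qed.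

Lemma adapted_trace q (Q : 'rV[A]_m -> 'rV[A]_m -> 'rV[A]_q) (E : 'M[A]_m) :
  (forall u, (forall x y, Q (x + y) u = Q x u + Q y u) /\
             (forall a x, Q (a *: x) u = a *: Q x u)) ->
  (forall u, (forall x y, Q u (x + y) = Q u x + Q u y) /\
             (forall a x, Q u (a *: x) = a *: Q u x)) ->
  E^T *m E = Gi ->
  \sum_i Q (row i E) (row i E) =
  \sum_a \sum_b hi a b *: Q (row a X) (row b X) + Q V V.
Proof.
move=> Ql Qr EE.
have H p (P : 'M[A]_(p, m)) : \sum_i Q (row i P) (row i P) =
    \sum_i \sum_j (P^T *m P) i j *: Q (delta_mx 0 i) (delta_mx 0 j).
  rewrite -[P^T in RHS]mulmx1 -bilinear_trace//; apply: eq_bigr => i _.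
  rewrite (bigD1 i)//= mxE eqxx scale1r big1 ?addr0// => j ji.
  by rewrite mxE eq_sym (negbTE ji) scale0r.
have -> : Q V V = \sum_(i < 1) Q (row i V) (row i V).
  by rewrite big_ord1; congr Q; apply/rowP => j; rewrite mxE.
rewrite !H EE complete bilinear_trace// -big_split/=; apply: eq_bigr => i _.
by rewrite -big_split/=; apply: eq_bigr => j _; rewrite mx_linE scalerDl.
Qed.

Lemma second_form_bilinear :
  (forall u, (forall x y, second_form pd C F om (x + y) u =
      second_form pd C F om x u + second_form pd C F om y u) /\
             (forall a x, second_form pd C F om (a *: x) u =
      a *: second_form pd C F om x u)) /\
  (forall u, (forall x y, second_form pd C F om u (x + y) =
      second_form pd C F om u x + second_form pd C F om u y) /\
             (forall a x, second_form pd C F om u (a *: x) =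
      a *: second_form pd C F om u x)).
Proof.
rewrite /second_form; split=> u; split=> [x y|a x].
- by rewrite !cov_addl mulmxDl; mx_ring.
- by rewrite !cov_scalel -scalemxAl scalerBr.
- by rewrite mulmxDl !covD// mulmxDl; mx_ring.
- by rewrite -scalemxAl !covZ// mulmxDl -!scalemxAl; mx_ring.
Qed.

(** Linearity in the second argument holds over functions as well: the derivative of a coefficient
    cancels against the one produced inside [cov pd C Y Z]. *)
Lemma hessian_along_bilinear S :
  (forall u, (forall x y, hessian_along pd C F om S (x + y) u =
      hessian_along pd C F om S x u + hessian_along pd C F om S y u) /\
             (forall a x, hessian_along pd C F om S (a *: x) u =
      a *: hessian_along pd C F om S x u)) /\
  (forall u, (forall x y, hessian_along pd C F om S u (x + y) =
      hessian_along pd C F om S u x + hessian_along pd C F om S u y) /\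
             (forall a x, hessian_along pd C F om S u (a *: x) =
      a *: hessian_along pd C F om S u x)).
Proof.
rewrite /hessian_along; split=> u; split=> [x y|a x].
- by rewrite !cov_addl; mx_ring.
- by rewrite !cov_scalel scalerBr.
- by rewrite cov_addl !covD// !cov_addl; mx_ring.
- by rewrite cov_scalel !covZ// cov_addl !cov_scalel; mx_ring.
Qed.

Lemma jacobi_term_bilinear RN S :
  (forall u, (forall x y, jacobi_term F RN S (x + y) u =
      jacobi_term F RN S x u + jacobi_term F RN S y u) /\
             (forall a x, jacobi_term F RN S (a *: x) u =
      a *: jacobi_term F RN S x u)) /\
  (forall u, (forall x y, jacobi_term F RN S u (x + y) =
      jacobi_term F RN S u x + jacobi_term F RN S u y) /\
             (forall a x, jacobi_term F RN S u (a *: x) =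
      a *: jacobi_term F RN S u x)).
Proof.
rewrite /jacobi_term; split=> u; split=> [x y|a x].
- rewrite -mulmxDr; congr (_ *m _); rewrite /tensor_form mulmxDl -big_split/=.
  apply: eq_bigr => a _; rewrite -big_split/=; apply: eq_bigr => b _.
  by rewrite mx_linE mulrDl scalerDl.
- rewrite scalemxAr; congr (_ *m _); rewrite /tensor_form -scalemxAl scaler_sumr.
  apply: eq_bigr => i _; rewrite scaler_sumr; apply: eq_bigr => b _.
  by rewrite mx_linE scalerA mulrA.
- by rewrite !mulmxDl.
- by rewrite -!scalemxAl.
Qed.

(** By [nabXX] the second fundamental form vanishes on pairs of lifts, so the trace reduces to its
    value on [V], [V]. *)
Lemma tension_adapted (E : 'M[A]_m) : E^T *m E = Gi ->
  tension_alg pd C F om E = - kap.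
Proof.
move=> EE; have [Ql Qr] := second_form_bilinear.
rewrite /tension_alg (adapted_trace Ql Qr EE) big1 ?add0r => [|a _].
  rewrite /second_form VF nabN_V (deriv_mx0 (dird_deriv pd_deriv _)) sub0r nabVV.
  by rewrite -mulmxA XF mulmx1.
rewrite big1// => b _; rewrite /second_form -(row_cov pd C) nabXX nabN_X -row_mul XF.
rewrite map_row (deriv_mx1 (dird_deriv pd_deriv _)) linear0 add0r -[_ *m F]row_mul mulmxBl.
by rewrite -!mulmxA XF VF mulmx0 subr0 mulmx1 -row_mul mul1mx subrr scaler0.
Qed.

(** Discharges the hypotheses of the structure equations, with [D a] the derivative along [row a X]
    and [Dv] the one along [V]. *)
Ltac structure_eqs := solve [ assumption | move=> *; solve [
  exact: dird_deriv | exact: dird_c | exact: dird_h | exact: dirdV_h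
| exact: dirdV_om | exact: dird_comm | exact: Om_skew | exact: riccati_eq
| exact: codazzi_eq | exact: gauss_eq ] ].

Local Notation RN := (base_curv (fun a => D (row a X)) om).

Lemma nabN_X_kap a : nabN (row a X) kap = row a (Dkap c J kap k).
Proof.
rewrite nabN_X -[LHS]/(cov_row (fun a => D (row a X)) om a kap).
by rewrite (@cov_row_kap A n (fun a => D (row a X)) (D V) _ _ _ _ c _ h hi J Om
  kap k om); try structure_eqs.
Qed.

Lemma nabN_rowX_kap (u : 'rV[A]_n) : nabN (u *m X) kap = u *m Dkap c J kap k.
Proof.
rewrite nabN_rowX [RHS]mulmx_sum_row; apply: eq_bigr => a _.
by rewrite -nabN_X nabN_X_kap.
Qed.

Lemma bitension_adapted (E : 'M[A]_m) : E^T *m E = Gi ->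
  bitension_alg pd C F om RN E kap =
  bitension_coef c J kap k *: kap - kap *m J *m J + map_mx (D V) (map_mx (D V) kap).
Proof.
move=> EE; have [Hl Hr] := hessian_along_bilinear kap.
have [Jl Jr] := jacobi_term_bilinear RN kap.
rewrite /bitension_alg sumrB (adapted_trace Hl Hr EE) (adapted_trace Jl Jr EE).
have -> : jacobi_term F RN kap V V = 0 by rewrite /jacobi_term VF mul0mx.
have -> : hessian_along pd C F om kap V V =
    map_mx (D V) (map_mx (D V) kap) - kap *m Dkap c J kap k.
  by rewrite /hessian_along nabVV nabN_rowX_kap !nabN_V.
(* The derivative of [X_b] along [X_a] has the vertical part [- Om a b *: V], whence the second
   term. It is skew in [a] and [b] and disappears in the trace. *)
have hess a b : hessian_along pd C F om kap (row a X) (row b X) =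
    row b (cov_end (fun a => D (row a X)) om a (Dkap c J kap k))
    + Om a b *: map_mx (D V) kap.
  rewrite /hessian_along nabN_X_kap -(row_cov pd C) nabXX nabN_X raddfB/=.
  rewrite row_mul [row b (_ *m V)]row_mul cov_addl -[- (_ *m V)]scaleN1r cov_scalel scaleN1r.
  rewrite nabN_rowX_kap row_cov_end /cov_row.
  have -> : row b (row a Om)^T *m V = Om a b *: V.
    apply/matrixP => s t; rewrite [LHS]mxE big_ord1 [RHS]mxE.
    by rewrite [row b _ _ _]mxE [_^T _ _]mxE [row a _ _ _]mxE (ord1 s).
  rewrite cov_scalel nabN_V; mx_ring.
have jac a b : jacobi_term F RN kap (row a X) (row b X) =
    \sum_d kap 0 d *: row b (RN a d).
  rewrite /jacobi_term -!row_mul XF mul1mx /tensor_form (bigD1 a)//= [X in _ + X]big1 ?addr0.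
    rewrite raddf_sum/=; apply: eq_bigr => d _.
    by rewrite linearZ/= ![row _ _ _ _]mxE mxE eqxx mul1r.
  by move=> d da; rewrite big1// => l _; rewrite !mxE eq_sym (negbTE da) mul0r scale0r.
have sum_row (B : 'I_n -> 'M[A]_n) :
    \sum_a \sum_b hi a b *: row b (B a) = h_trace hi B.
  by rewrite /h_trace; apply: eq_bigr => a _; rewrite mulmx_sum_row;
    apply: eq_bigr => b _; rewrite mxE.
have hiOm : \sum_a \sum_b (hi a b * Om a b) = 0.
  transitivity (\tr (hi *m Om^T)); last by apply: tr_hi_Om; structure_eqs.
  rewrite /mxtrace; apply: eq_bigr => a _; rewrite [RHS]mxE;
    by apply: eq_bigr => b _; rewrite [_^T _ _]mxE.
under eq_bigr do under eq_bigr do rewrite hess scalerDr scalerA.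
under eq_bigr do rewrite big_split/= -scaler_suml.
rewrite big_split/= -scaler_suml hiOm scale0r addr0 sum_row.
have -> : \sum_a \sum_b hi a b *: jacobi_term F RN kap (row a X) (row b X) =
    \sum_d kap 0 d *: h_trace hi (fun a => RN a d).
  under eq_bigr do under eq_bigr do rewrite jac scaler_sumr.
  under eq_bigr do rewrite exchange_big/=.
  rewrite exchange_big/=; apply: eq_bigr => d _.
  rewrite -sum_row scaler_sumr; apply: eq_bigr => a _; rewrite scaler_sumr.
  by apply: eq_bigr => b _; rewrite !scalerA mulrC.
rewrite -(@bitension_kap A n (fun a => D (row a X)) (D V) _ _ _ _ c _ _
  h hi J Om kap k om); try structure_eqs.
by rewrite addr0 !addrA.
Qed.

Lemma bitension_algN RN' E S :
  bitension_alg pd C F om RN' E (- S) = - bitension_alg pd C F om RN' E S.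
Proof.
rewrite /bitension_alg -sumrN; apply: eq_bigr => i _.
rewrite /hessian_along /jacobi_term !covN//.
have -> T : tensor_form RN' T (- S) = - tensor_form RN' T S.
  rewrite /tensor_form -sumrN; apply: eq_bigr => a _; rewrite -sumrN.
  by apply: eq_bigr => b _; rewrite mxE mulrN scaleNr.
by rewrite mulmxN; mx_ring.
Qed.

Lemma bitension_alg_ext RN' E S : (forall a b, RN a b = RN' a b) ->
  bitension_alg pd C F om RN' E S = bitension_alg pd C F om RN E S.
Proof.
move=> RR; apply: eq_bigr => i _; congr (_ - _ *m _).
by apply: eq_bigr => a _; apply: eq_bigr => b _; rewrite RR.
Qed.

Section Biharmonic.
Variable E : 'M[A]_m.
Hypothesis E_orthonormal : E^T *m E = Gi.
Hypothesis n_ge2 : (2 <= n)%N.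
Hypothesis h_nondeg : forall v : 'rV[A]_n, v *m h *m v^T = 0 -> v = 0.
Local Notation tau := (tension_alg pd C F om E).
Hypothesis biharmonic : bitension_alg pd C F om
  (fun a b => dom a b + om b *m om a - (dom b a + om a *m om b)) E tau = 0.
Hypothesis tau_unit : exists ai, (tau *m h *m tau^T) 0 0 * ai = 1.

Lemma tension_norm : (tau *m h *m tau^T) 0 0 = kap2 kap k.
Proof.
by rewrite tension_adapted// mulNmx linearN/= mulNmx mulmxN opprK -mulmxA -kE.
Qed.

Lemma bracket_vertical a b :
  (bracket pd (row a X) (row b X) *m G *m V^T) 0 0 = - (Om a b *+ 2).
Proof. by rewrite bracketXXE -!scalemxAl VGV !mxE eqxx mulr1. Qed.

Lemma kap2_unit : exists ai, kap2 kap k * ai = 1.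
Proof. by have := tau_unit; rewrite tension_norm. Qed.

Lemma bitension_eq0 : bitension_coef c J kap k *: kap - kap *m J *m J
  + map_mx (D V) (map_mx (D V) kap) = 0.
Proof.
have := biharmonic; rewrite bitension_alg_ext => [|a b]; last first.
  by rewrite /base_curv !dird_om.
rewrite tension_adapted// bitension_algN bitension_adapted//.
by move=> /eqP; rewrite oppr_eq0 => /eqP.
Qed.

(** The witness is [J *m J]; the conclusion keeps only what is needed to make a multiple of it an
    idempotent. The assumption is phrased with the bracket of two lifts, whose vertical component is
    [- 2 Om a b]. *)
Lemma biharmonic_nonintegrable :
  (exists a b x, (bracket pd (row a X) (row b X) *m G *m V^T) 0 0 * x = 1) ->
  exists B : 'M[A]_n, \tr B *+ 2 + (tau *m h *m tau^T) 0 0 = 0 /\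
    (tau *m h *m tau^T) 0 0 *: B + B *m B = 0.
Proof.
move=> [a [b [x]]]; rewrite bracket_vertical => bx; rewrite tension_norm.
have U : exists a b x, Om a b * x = 1.
  by exists a, b, (- (x *+ 2)); rewrite -bx; ring.
have := bitension_eq0 => B; have := kap2_unit => K.
have [] := @nonintegrable_case A n (fun a => D (row a X)) (D V) _ _ _ _ c _ _
  h hi J Om kap k om; try structure_eqs.
by exists (J *m J).
Qed.

Lemma biharmonic_integrable :
  (forall a b, (bracket pd (row a X) (row b X) *m G *m V^T) 0 0 = 0) ->
  exists nu : 'rV[A]_n, let a := (tau *m h *m tau^T) 0 0 in
  (nu *m h *m nu^T) 0 0 = (a + (n.*2%:R - 1) * c) * a /\
  (a + (n.*2%:R - 1) * c) * c *+ n = - (a * (a + c)) *+ 2.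
Proof.
move=> b0; rewrite tension_norm; exists (map_mx (D V) kap).
have J0 : J = 0.
  rewrite -[J]mulmx1 -hhi mulmxA -OmE; suff -> : Om = 0 by rewrite mul0mx.
  apply/matrixP => a b; rewrite mxE; have := b0 a b; rewrite bracket_vertical.
  by move=> /eqP; rewrite oppr_eq0 => /eqP/A_tf.
have := bitension_eq0 => B; have := kap2_unit => K.
have [] := @integrable_case A n (fun a => D (row a X)) (D V) _ _ _ _ c _ _
  h hi J Om kap k om; try structure_eqs.
by [].
Qed.
End Biharmonic.
End AdaptedFrame.

(** * Smooth functions *)

Lemma near_eq_differentiable (R : realType) (V W : normedModType R) (f g : V -> W) (x : V) :
  {near x, f =1 g} -> differentiable f x -> differentiable g x.
Proof.
move=> fg df; have gx : f x = g x by exact: nbhs_singleton fg.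
have [dc /eqaddoP E] := (diff_locallyP _ _).1 df.
have E' : g \o shift x = cst (g x) + 'd f x +o_ 0 id.
  apply/eqaddoP => e e0; have := E e e0.
  have fg0 : \forall h \near (0 : V), f (h + x) = g (h + x).
    have /nbhs0P := fg; apply: filterS => h; by rewrite addrC.
  apply: filterS2 fg0 => h fgh; rewrite /= -gx.
  by rewrite -[(_ - _) h]/(f (h + x) - _) -[X in _ -> `|X| <= _]/(g (h + x) - _) fgh.
by apply/diff_locallyP; rewrite (diff_unique dc E').
Qed.

Section Smooth.
Variables (R : realType) (m : nat).
Implicit Types (U : set 'rV[R]_m) (x v : 'rV[R]_m).

(** Openness makes the functions agree near each point, so that their derivatives agree on [U] again
    and the induction goes on. *)
Lemma Ck_near (W : normedModType R) U k (f g : 'rV[R]_m -> W) : open U ->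
  (forall x, U x -> f x = g x) -> Ck k U f -> Ck k U g.
Proof.
move=> oU; elim: k f g => [|k IH] f g fg /=.
  move=> cf x Ux; have nfg : {near x, f =1 g}.
    by apply: filterS (open_nbhs_nbhs (conj oU Ux)) => y; exact: fg.
  rewrite /prop_for /continuous_at -(fg x Ux); apply: cvg_trans (cf x Ux).
  by apply: (@near_eq_cvg _ _ (nbhs x) _ f g); exact: nfg.
have nfg x : U x -> {near x, f =1 g}.
  by move=> Ux; apply: filterS (open_nbhs_nbhs (conj oU Ux)) => y; exact: fg.
move=> [df Df]; split=> [x Ux|v].
  exact: near_eq_differentiable (nfg x Ux) (df x Ux).
by apply: IH (Df v) => x Ux; apply: near_eq_derive; exact: nfg.
Qed.

Lemma smooth_near (W : normedModType R) U (f g : 'rV[R]_m -> W) : open U ->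
  (forall x, U x -> f x = g x) -> smooth_on U f -> smooth_on U g.
Proof. by move=> oU fg sf k; exact: Ck_near oU fg (sf k). Qed.

Lemma Ck_sub (W : normedModType R) U U' k (f : 'rV[R]_m -> W) : U' `<=` U ->
  Ck k U f -> Ck k U' f.
Proof.
move=> UU; elim: k f => [|k IH] f /=; first by move=> cf x /UU; exact: cf.
by move=> [df Df]; split=> [x /UU|v]; [exact: df|exact: IH].
Qed.

Lemma smooth_sub (W : normedModType R) U U' (f : 'rV[R]_m -> W) : U' `<=` U ->
  smooth_on U f -> smooth_on U' f.
Proof. by move=> UU sf k; exact: Ck_sub UU (sf k). Qed.

Lemma CkW (W : normedModType R) U k (f : 'rV[R]_m -> W) : Ck k.+1 U f -> Ck k U f.
Proof.
elim: k f => [|k IH] f /= [df Df].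
  by move=> x Ux; apply: differentiable_continuous; exact: df.
by split=> // v; apply: IH; exact: Df.
Qed.

Lemma smooth_differentiable (W : normedModType R) U (f : 'rV[R]_m -> W) x :
  smooth_on U f -> U x -> differentiable f x.
Proof. by move=> sf Ux; have [+ _] := sf 1%N; apply. Qed.

Lemma smooth_derive (W : normedModType R) U (f : 'rV[R]_m -> W) v :
  smooth_on U f -> smooth_on U (fun x => 'D_v f x).
Proof. by move=> sf k; have [_ +] := sf k.+1; apply. Qed.

Lemma smooth_continuous (W : normedModType R) U (f : 'rV[R]_m -> W) x :
  smooth_on U f -> U x -> {for x, continuous f}.
Proof. by move=> sf Ux; exact: (sf 0%N). Qed.

Lemma Ck_cst (W : normedModType R) U k (a : W) : Ck k U (fun=> a).
Proof.
elim: k a => [|k IH] a /=; first by move=> x _; exact: cst_continuous.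
split=> [x _|v]; first exact: differentiable_cst.
rewrite (_ : (fun x => 'D_v (fun=> a) x) = fun=> 0)//.
by apply/funext => x; exact: derive_cst.
Qed.

Lemma CkD (W : normedModType R) U k (f g : 'rV[R]_m -> W) : open U ->
  Ck k U f -> Ck k U g -> Ck k U (fun x => f x + g x).
Proof.
move=> oU; elim: k f g => [|k IH] f g /=.
  by move=> cf cg x Ux; apply: continuousD; [exact: cf|exact: cg].
move=> [df Df] [dg Dg]; split=> [x Ux|v].
  exact: (differentiableD (df x Ux) (dg x Ux)).
apply: (@Ck_near _ _ _ (fun x => 'D_v f x + 'D_v g x)) (IH _ _ (Df v) (Dg v)) => //.
move=> x Ux; rewrite -deriveD//; first exact: diff_derivable (df x Ux).
exact: diff_derivable (dg x Ux).
Qed.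

Lemma CkM U k (f g : 'rV[R]_m -> R) : open U ->
  Ck k U f -> Ck k U g -> Ck k U (fun x => f x * g x).
Proof.
move=> oU; elim: k f g => [|k IH] f g.
  by move=> cf cg x Ux; apply: continuousM; [exact: cf|exact: cg].
move=> /[dup] /CkW Cf [df Df] /[dup] /CkW Cg [dg Dg]; split=> [x Ux|v].
  exact: (differentiableM (df x Ux) (dg x Ux)).
apply: (@Ck_near _ _ _ (fun x => f x * 'D_v g x + g x * 'D_v f x)) => //.
  move=> x Ux; rewrite -[RHS]/('D_v (f * g) x) deriveM//.
    exact: diff_derivable (df x Ux).
  exact: diff_derivable (dg x Ux).
by apply: CkD => //; apply: IH => //; [exact: Dg|exact: Df].
Qed.

Lemma CkN U k (f : 'rV[R]_m -> R) : open U -> Ck k U f -> Ck k U (fun x => - f x).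
Proof.
move=> oU Cf; apply: (@Ck_near _ _ _ (fun x => -1 * f x)) => //.
  by move=> x _; rewrite mulN1r.
by apply: CkM => //; exact: Ck_cst.
Qed.

Lemma CkV U k (f : 'rV[R]_m -> R) : open U -> (forall x, U x -> f x != 0) ->
  Ck k U f -> Ck k U (fun x => (f x)^-1).
Proof.
move=> oU f0; elim: k => [|k IH].
  by move=> cf x Ux; apply: continuousV; [exact: f0|exact: cf].
move=> /[dup] /CkW Cf [df Df]; split=> [x Ux|v].
  by apply: differentiableV; [exact: df|exact: f0].
apply: (@Ck_near _ _ _ (fun x => - ((f x)^-1 * (f x)^-1 * 'D_v f x))) => //.
  move=> x Ux; rewrite -[RHS]/('D_v (fun y => (f y)^-1) x) deriveV ?f0//; last first.
    exact: diff_derivable (df x Ux).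
  by rewrite -mulNr -exprVn expr2.
by apply: CkN => //; apply: CkM (Df v) => //; apply: CkM => //; exact: IH.
Qed.

(** The derivative of the root involves the root itself, but only to the previous order, which the
    induction provides. *)
Lemma Ck_sqrt U k (f : 'rV[R]_m -> R) : open U -> (forall x, U x -> 0 < f x) ->
  Ck k U f -> Ck k U (fun x => Num.sqrt (f x)).
Proof.
move=> oU f0; elim: k => [|k IH].
  move=> cf x Ux; apply: continuous_comp; first exact: cf.
  exact: sqrt_continuous.
move=> /[dup] /CkW Cf [df Df].
have ds x : U x -> is_diff (f x) Num.sqrt ( *:%R^~ (2 * Num.sqrt (f x))^-1).
  move=> Ux; have [dsx dsE] := is_derive1_sqrt (f0 x Ux).
  split; first exact/derivable1_diffP.
  by rewrite deriv1E// derive1E dsE.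
split=> [x Ux|v].
  by apply: differentiable_comp; [exact: df|have [] := ds x Ux].
apply: (@Ck_near _ _ _ (fun x => (2 * Num.sqrt (f x))^-1 * 'D_v f x)) => //.
  move=> x Ux; have dfx := df x Ux; have [ds1 ds2] := ds x Ux.
  rewrite -[RHS]/('D_v (Num.sqrt \o f) x) [RHS]deriveE; last exact: differentiable_comp.
  have -> : 'd (Num.sqrt \o f) x = 'd Num.sqrt (f x) \o 'd f x :> (_ -> _).
    by apply: diff_comp.
  by rewrite /= ds2 deriveE//; exact: mulrC.
apply: CkM (Df v) => //; apply: CkV => //.
  by move=> x Ux; rewrite mulf_neq0// sqrtr_eq0 -ltNge f0.
by apply: CkM (IH Cf) => //; exact: Ck_cst.
Qed.

Lemma derive_delta (W : normedModType R) (f : 'rV[R]_m -> W) x v :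
  differentiable f x -> 'D_v f x = \sum_i v 0 i *: partial i f x.
Proof.
move=> df; rewrite deriveE// [X in 'd f x X]row_sum_delta linear_sum.
by apply: eq_bigr => i _; rewrite linearZ /partial deriveE.
Qed.

Lemma Ck_coord p q U k (f : 'rV[R]_m -> 'M[R]_(p, q)) i j : open U ->
  Ck k U f -> Ck k U (fun x => f x i j).
Proof.
move=> oU; elim: k f => [|k IH] f.
  move=> cf x Ux; apply: (@continuous_comp _ _ _ f (fun N : 'M[R]_(p, q) => N i j)).
    exact: cf.
  exact: coord_continuous.
move=> [df Df]; split=> [x Ux|v].
  apply: (@differentiable_comp _ _ _ _ f (fun N : 'M[R]_(p, q) => N i j)).
    exact: df.
  exact: differentiable_coord.
apply: (@Ck_near _ _ _ (fun x => ('D_v f x) i j)) (IH _ (Df v)) => //.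
by move=> x Ux; rewrite derive_mx ?mxE//; exact: diff_derivable (df x Ux).
Qed.

Lemma smooth_coord p q U (f : 'rV[R]_m -> 'M[R]_(p, q)) i j : open U ->
  smooth_on U f -> smooth_on U (fun x => f x i j).
Proof. by move=> oU sf k; exact: Ck_coord. Qed.

Lemma Ck_sum (I : Type) (r : seq I) U k (f : I -> 'rV[R]_m -> R) : open U ->
  (forall i, Ck k U (f i)) -> Ck k U (fun x => \sum_(i <- r) f i x).
Proof.
move=> oU Cf; elim: r => [|i r IH].
  by apply: (Ck_near oU _ (Ck_cst U k 0)) => x _; rewrite big_nil.
by apply: (Ck_near oU _ (CkD oU (Cf i) IH)) => x _; rewrite big_cons.
Qed.

(** * Symmetry of second derivatives and the chain rule *)

Lemma derivable_line (f : 'rV[R]_m -> R) x v (r : R) :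
  differentiable f (r *: v + x) ->
  is_derive r 1 (fun t : R => f (t *: v + x)) ('D_v f (r *: v + x)).
Proof.
move=> df; have dv : derivable f (r *: v + x) v by exact: diff_derivable.
have E : (fun h : R => h^-1 *: (((fun t : R => f (t *: v + x)) \o shift r) (h *: 1)
      - f (r *: v + x))) =
    (fun h : R => h^-1 *: ((f \o shift (r *: v + x)) (h *: v) - f (r *: v + x))).
  by apply/funext => h /=; rewrite [h *: 1]mulr1 scalerDl addrA.
by split; rewrite ?/derivable ?/derive E.
Qed.

(** The mean value theorem is applied twice: to the increment of [f] in the direction [v] as a
    function of the step along [u], then to the derivative along [u] as a function of the step along
    [v]. *)
Lemma mixed_difference U (f : 'rV[R]_m -> R) x u v (s : R) : 0 <= s ->
  smooth_on U f ->
  (forall a b : R, 0 <= a <= s -> 0 <= b <= s -> U (a *: u + (b *: v + x))) ->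
  exists a b : R, [/\ 0 <= a <= s, 0 <= b <= s &
    f (s *: u + (s *: v + x)) - f (s *: u + x) - f (s *: v + x) + f x =
    'D_v (fun y => 'D_u f y) (a *: u + (b *: v + x)) * s * s].
Proof.
move=> s0 sf Us.
have ss : 0 <= s <= s by rewrite s0 lexx.
have z0 : (0 : R) <= 0 <= s by rewrite lexx s0.
pose psi r := f (r *: u + (s *: v + x)) - f (r *: u + x).
have dpsi r : 0 <= r <= s -> is_derive r 1 psi
    ('D_u f (r *: u + (s *: v + x)) - 'D_u f (r *: u + x)).
  move=> rs; apply: is_deriveB; apply: derivable_line.
    by apply: (smooth_differentiable sf); exact: Us.
  by apply: (smooth_differentiable sf); have := Us r 0 rs z0; rewrite scale0r add0r.
have [a as_ Ea] : exists2 a, a \in `[0, s]%R & psi s - psi 0 =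
    ('D_u f (a *: u + (s *: v + x)) - 'D_u f (a *: u + x)) * (s - 0).
  apply: (@MVT_segment R psi (fun r => 'D_u f (r *: u + (s *: v + x))
    - 'D_u f (r *: u + x))) => [|r|]; first exact: s0.
    by rewrite in_itv/= => /andP[r0 rs]; apply: dpsi; rewrite !ltW.
  apply: continuous_in_subspaceT => r; rewrite inE/= in_itv/= => rs.
  by apply: differentiable_continuous; apply/derivable1_diffP; have [] := dpsi r rs.
rewrite in_itv/= in as_.
pose chi r := 'D_u f (r *: v + (a *: u + x)).
have swap r : r *: v + (a *: u + x) = a *: u + (r *: v + x) by rewrite addrCA.
have dchi r : 0 <= r <= s -> is_derive r 1 chi
    ('D_v (fun y => 'D_u f y) (r *: v + (a *: u + x))).
  move=> rs; apply: derivable_line.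
  by apply: (smooth_differentiable (smooth_derive u sf)); rewrite swap; exact: Us.
have [b bs Eb] : exists2 b, b \in `[0, s]%R & chi s - chi 0 =
    ('D_v (fun y => 'D_u f y) (b *: v + (a *: u + x))) * (s - 0).
  apply: (@MVT_segment R chi (fun r =>
    'D_v (fun y => 'D_u f y) (r *: v + (a *: u + x)))) => [|r|]; first exact: s0.
    by rewrite in_itv/= => /andP[r0 rs]; apply: dchi; rewrite !ltW.
  apply: continuous_in_subspaceT => r; rewrite inE/= in_itv/= => rs.
  by apply: differentiable_continuous; apply/derivable1_diffP; have [] := dchi r rs.
rewrite in_itv/= in bs.
exists a, b; split=> //; rewrite -[in RHS]swap.
move: Eb; rewrite subr0 /chi scale0r add0r swap => <-.
by move: Ea; rewrite subr0 /psi !scale0r !add0r => <-; ring.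
Qed.

Lemma derive_comm U (f : 'rV[R]_m -> R) x u v : open U -> smooth_on U f -> U x ->
  'D_u (fun y => 'D_v f y) x = 'D_v (fun y => 'D_u f y) x.
Proof.
move=> oU sf Ux; apply/eqP; rewrite -subr_eq0 -normr_le0; apply/ler_addgt0Pl => e e0; rewrite addr0.
have near_duv u' v' : \forall y \near x,
    `|'D_v' (fun y => 'D_u' f y) x - 'D_v' (fun y => 'D_u' f y) y| <= e / 2.
  have := smooth_continuous (smooth_derive v' (smooth_derive u' sf)) Ux.
  by move=> /cvgrPdist_le; apply; rewrite divr_gt0.
have [d d0 dU] : exists2 d : R, 0 < d & forall y, `|y - x| < d -> [/\ U y,
    `|'D_v (fun y => 'D_u f y) x - 'D_v (fun y => 'D_u f y) y| <= e / 2 &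
    `|'D_u (fun y => 'D_v f y) x - 'D_u (fun y => 'D_v f y) y| <= e / 2].
  have /nbhs_ballP[d d0 dH] : \forall y \near x, [/\ U y,
    `|'D_v (fun y => 'D_u f y) x - 'D_v (fun y => 'D_u f y) y| <= e / 2 &
    `|'D_u (fun y => 'D_v f y) x - 'D_u (fun y => 'D_v f y) y| <= e / 2].
    by apply: filterS3 (open_nbhs_nbhs (conj oU Ux)) (near_duv u v) (near_duv v u).
  by exists d => // y yx; apply: dH; rewrite -ball_normE/= distrC.
(* The parallelogram with sides [s *: u] and [s *: v] at [x] stays in the ball of radius [d]; the
   summand 1 covers [u = v = 0]. *)
pose s := d / (`|u| + `|v| + 1) / 2.
have N0 : 0 < `|u| + `|v| + 1 by rewrite ltr_wpDl// addr_ge0.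
have s0 : 0 < s by rewrite !divr_gt0.
have sd u' v' (a b : R) : `|u'| + `|v'| = `|u| + `|v| -> 0 <= a <= s -> 0 <= b <= s ->
    `|a *: u' + (b *: v' + x) - x| < d.
  move=> uv /andP[a0 as_] /andP[b0 bs]; rewrite addrA addrK.
  apply: (@le_lt_trans _ _ (s * (`|u| + `|v|))).
    rewrite -uv mulrDr (le_trans (ler_normD _ _))// !normrZ.
    by rewrite lerD// ler_wpM2r// ger0_norm.
  have -> : d = s * 2 * (`|u| + `|v| + 1) by rewrite /s; field; rewrite gt_eqF.
  have n0 : 0 <= `|u| + `|v| by rewrite addr_ge0.
  nra.
have [a [b [as_ bs E]]] := mixed_difference (ltW s0) sf
  (fun a b as_ bs => let: And3 H _ _ := dU _ (sd u v a b erefl as_ bs) in H).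
have [a' [b' [as' bs' E']]] := mixed_difference (ltW s0) sf
  (fun a b as_ bs => let: And3 H _ _ := dU _ (sd v u a b (addrC _ _) as_ bs) in H).
have [_ H1 _] := dU _ (sd u v a b erefl as_ bs).
have [_ _ H2] := dU _ (sd v u a' b' (addrC _ _) as' bs').
move: E E' H1 H2; move: ('D_v (fun y => 'D_u f y) _) => P.
move: ('D_u (fun y => 'D_v f y) (_ + _)) => Q E E' H1 H2.
(* The second difference is symmetric in [u] and [v], so the two mixed derivatives take the same
   value, possibly at different points; both points are close to [x]. *)
have PQ : P = Q.
  have ss0 : s * s != 0 by rewrite mulf_neq0// gt_eqF.
  apply: (mulIf ss0); rewrite [LHS]mulrA [RHS]mulrA -E -E'.
  have -> : s *: v + (s *: u + x) = s *: u + (s *: v + x) by rewrite addrCA.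
  ring.
rewrite -PQ in H2.
move: H1 H2; move: ('D_u _ x) ('D_v _ x) => p q H1 H2.
rewrite (splitr e) -(subrKA P) (le_trans (ler_normD _ _))//.
by rewrite lerD// distrC.
Qed.

End Smooth.

Lemma derive_comp (R : realType) (m n : nat) (f : 'rV[R]_m -> 'rV[R]_n)
    (H : 'rV[R]_n -> R) x v : differentiable f x -> differentiable H (f x) ->
  'D_v (fun y => H (f y)) x = \sum_a ('D_v f x) 0 a * partial a H (f x).
Proof.
move=> dfx dHx.
rewrite -[LHS]/('D_v (H \o f) x) [LHS]deriveE; last exact: differentiable_comp.
have -> : 'd (H \o f) x = 'd H (f x) \o 'd f x :> (_ -> _) by apply: diff_comp.
by rewrite /= -[in LHS](deriveE _ dfx) -(deriveE _ dHx) derive_delta.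
Qed.

(** The induction is on the order of [H] alone: the derivative is a sum of smooth functions times
    partial derivatives of [H] composed with [f]. *)
Lemma Ck_comp (R : realType) (m n : nat) (U : set 'rV[R]_m) (W : set 'rV[R]_n) k
    (f : 'rV[R]_m -> 'rV[R]_n) (H : 'rV[R]_n -> R) : open U ->
  smooth_on U f -> (forall x, U x -> W (f x)) -> Ck k W H ->
  Ck k U (fun x => H (f x)).
Proof.
move=> oU sf fUW; elim: k H => [|k IH] H.
  move=> cH x Ux; apply: continuous_comp; first exact: smooth_continuous Ux.
  by apply: cH; exact: fUW.
move=> [dH DH]; have df x (Ux : U x) := smooth_differentiable sf Ux.
split=> [x Ux|v].
  by apply: differentiable_comp; [exact: df|apply/dH/fUW].
apply: (@Ck_near _ _ _ _ _ (fun x => \sum_a ('D_v f x) 0 a * partial a H (f x))) => //.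
  by move=> x Ux; rewrite derive_comp//; [exact: df|apply/dH/fUW].
apply: Ck_sum => // a; apply: CkM => //.
  by apply: Ck_coord => //; exact: smooth_derive.
exact: IH (DH _).
Qed.

(** * The ring of smooth functions on an open set *)

(* Functions are normalised to be zero outside of [U], so that equality in the
   ring is equality on [U]. *)
Record sfun (R : realType) (m : nat) (U : set 'rV[R]_m) (oU : open U) := SFun {
  sfun_val :> 'rV[R]_m -> R;
  sfun_smooth : smooth_on U sfun_val;
  sfun_out : forall x, ~ U x -> sfun_val x = 0 }.

HB.instance Definition _ (R : realType) m (U : set 'rV[R]_m) (oU : open U) := gen_eqMixin (sfun oU).
HB.instance Definition _ (R : realType) m (U : set 'rV[R]_m) (oU : open U) := gen_choiceMixin (sfun oU).

Section SmoothRing.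
Variables (R : realType) (m : nat) (U : set 'rV[R]_m) (oU : open U).
Implicit Types (f g : sfun oU) (F : 'rV[R]_m -> R).

Lemma sfunP f g : (forall x, U x -> f x = g x) -> f = g.
Proof.
move=> fg; have E : sfun_val f = sfun_val g.
  apply/funext => x; have [/fg//|nUx] := pselect (U x).
  by rewrite !sfun_out.
case: f g E {fg} => f sf f0 [g sg g0]/= E; rewrite E in sf f0 *.
by congr SFun; exact: Prop_irrelevance.
Qed.

Definition restrict0 F x := if `[< U x >] then F x else 0.

Lemma restrict0E F x : U x -> restrict0 F x = F x.
Proof. by move=> Ux; rewrite /restrict0 asboolT. Qed.

Lemma restrict0_smooth F : smooth_on U F -> smooth_on U (restrict0 F).
Proof. by apply: smooth_near => // x Ux; rewrite restrict0E. Qed.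

Lemma restrict0_out F x : ~ U x -> restrict0 F x = 0.
Proof. by move=> nUx; rewrite /restrict0 asboolF. Qed.

Definition smk F (sF : smooth_on U F) : sfun oU :=
  SFun oU (restrict0_smooth sF) (@restrict0_out F).

Lemma sadd_subproof f g : smooth_on U (fun x => f x + g x).
Proof. by move=> k; apply: CkD => //; exact: sfun_smooth. Qed.
Lemma sopp_subproof f : smooth_on U (fun x => - f x).
Proof. by move=> k; apply: CkN => //; exact: sfun_smooth. Qed.
Lemma smul_subproof f g : smooth_on U (fun x => f x * g x).
Proof. by move=> k; apply: CkM => //; exact: sfun_smooth. Qed.
Lemma scst_subproof (a : R) : smooth_on U (fun=> a).
Proof. by move=> k; exact: Ck_cst. Qed.

Definition sadd f g := smk (sadd_subproof f g).
Definition sopp f := smk (sopp_subproof f).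
Definition smul f g := smk (smul_subproof f g).
Definition scst a := smk (scst_subproof a).

Ltac sfun_ring := move=> *; apply: sfunP => x Ux /=; do 3?rewrite ?restrict0E//=; ring.

Let saddA : associative sadd.
Proof. sfun_ring. Qed.
Let saddC : commutative sadd.
Proof. sfun_ring. Qed.
Let sadd0 : left_id (scst 0) sadd.
Proof. sfun_ring. Qed.
Let saddN : left_inverse (scst 0) sopp sadd.
Proof. sfun_ring. Qed.
HB.instance Definition _ := GRing.isZmodule.Build (sfun oU) saddA saddC sadd0 saddN.

Let smulA : associative smul.
Proof. sfun_ring. Qed.
Let smulC : commutative smul.
Proof. sfun_ring. Qed.
Let smul1 : left_id (scst 1) smul.
Proof. sfun_ring. Qed.
Let smulD : left_distributive smul +%R.
Proof. sfun_ring. Qed.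
HB.instance Definition _ := GRing.Zmodule_isComPzRing.Build (sfun oU) smulA smulC smul1 smulD.

Lemma saddE f g x : U x -> (f + g) x = f x + g x.
Proof. by move=> Ux; rewrite -[LHS]/(restrict0 _ x) restrict0E. Qed.
Lemma soppE f x : U x -> (- f) x = - f x.
Proof. by move=> Ux; rewrite -[LHS]/(restrict0 _ x) restrict0E. Qed.
Lemma smulE f g x : U x -> (f * g) x = f x * g x.
Proof. by move=> Ux; rewrite -[LHS]/(restrict0 _ x) restrict0E. Qed.
Lemma scstE a x : U x -> scst a x = a.
Proof. by move=> Ux; rewrite -[LHS]/(restrict0 _ x) restrict0E. Qed.
Lemma s0E x : (0 : sfun oU) x = 0.
Proof. by rewrite -[LHS]/(restrict0 _ x) /restrict0; case: ifP. Qed.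
Lemma s1E x : U x -> (1 : sfun oU) x = 1.
Proof. by move=> Ux; rewrite -[LHS]/(restrict0 _ x) restrict0E. Qed.

Lemma s_sumE (I : Type) (r : seq I) (P : pred I) (E : I -> sfun oU) x : U x ->
  (\sum_(i <- r | P i) E i) x = \sum_(i <- r | P i) E i x.
Proof.
move=> Ux; apply: (big_morph (fun f : sfun oU => f x)); last exact: s0E.
by move=> f g; exact: saddE.
Qed.

Lemma smulrnE f k x : U x -> (f *+ k) x = f x *+ k.
Proof.
by move=> Ux; elim: k => [|k IH]; rewrite ?mulr0n ?s0E// !mulrS saddE// IH.
Qed.

Lemma snatE k x : U x -> (k%:R : sfun oU) x = k%:R.
Proof. by move=> Ux; rewrite smulrnE// s1E. Qed.

Lemma s_reduced f : f * f = 0 -> f = 0.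
Proof.
move=> ff; apply: sfunP => x Ux; rewrite s0E; apply/eqP.
have : f x * f x = 0 by rewrite -smulE// ff s0E.
by move=> /eqP; rewrite mulf_eq0 orbb.
Qed.

Lemma s_torsionfree f k : f *+ k.+1 = 0 -> f = 0.
Proof.
move=> fk; apply: sfunP => x Ux; rewrite s0E; apply/eqP.
have : f x *+ k.+1 = 0 by rewrite -smulrnE// fk s0E.
by move=> /eqP; rewrite mulrn_eq0.
Qed.

(** The passage from pointwise conditions to the invertibility assumptions of the algebraic part. *)
Lemma s_unit f : (forall x, U x -> f x != 0) -> exists g, f * g = 1.
Proof.
move=> f0; have sV : smooth_on U (fun x => (f x)^-1).
  by move=> k; apply: CkV => //; exact: sfun_smooth.
exists (smk sV); apply: sfunP => x Ux.
by rewrite smulE// s1E//= restrict0E// mulfV// f0.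
Qed.

Lemma spd_subproof i f : smooth_on U (fun x => partial i f x).
Proof. by apply: smooth_derive; exact: sfun_smooth. Qed.
Definition spd i f : sfun oU := smk (spd_subproof i f).

Lemma spdE i f x : U x -> spd i f x = partial i f x.
Proof. by move=> Ux; rewrite /= restrict0E. Qed.

Lemma sderivable f x v : U x -> derivable f x v.
Proof.
by move=> Ux; exact: diff_derivable (smooth_differentiable (@sfun_smooth _ _ _ _ f) Ux).
Qed.

Lemma near_open (P : 'rV[R]_m -> Prop) x : U x -> (forall y, U y -> P y) ->
  \forall y \near x, P y.
Proof. by move=> Ux UP; apply: filterS (open_nbhs_nbhs (conj oU Ux)). Qed.

Lemma spd_deriv i : derivation (spd i).
Proof.
split=> f g; apply: sfunP => x Ux.
  rewrite saddE// !spdE// -deriveD; [|exact: sderivable|exact: sderivable].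
  by apply: near_eq_derive; apply: near_open => // y Uy; rewrite saddE.
rewrite saddE// !smulE// !spdE//.
rewrite [RHS](_ : _ = 'D_(delta_mx 0 i) (sfun_val f * sfun_val g) x); last first.
  rewrite deriveM; [|exact: sderivable|exact: sderivable].
  rewrite addrC; congr (_ + _); exact: mulrC.
by apply: near_eq_derive; apply: near_open => // y Uy; rewrite smulE.
Qed.

Lemma spdC i j f : spd i (spd j f) = spd j (spd i f).
Proof.
have E i' j' x : U x -> spd i' (spd j' f) x =
    'D_(delta_mx 0 i') (fun y => 'D_(delta_mx 0 j') f y) x.
  move=> Ux; rewrite spdE//; apply: near_eq_derive; apply: near_open => // y Uy.
  exact: spdE.
apply: sfunP => x Ux; apply: (etrans (E i j x Ux)).
apply: (etrans _ (esym (E j i x Ux))).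
exact: (derive_comm _ _ oU (@sfun_smooth _ _ _ _ f) Ux).
Qed.

Lemma spd_cst i a : spd i (scst a) = 0.
Proof.
apply: sfunP => x Ux; rewrite spdE// s0E -[RHS](derive_cst a x (delta_mx 0 i)).
by apply: near_eq_derive; apply: near_open => // y Uy; rewrite scstE.
Qed.

(* [0] when [F] is not smooth on [U]. *)
Definition smake F : sfun oU :=
  if pselect (smooth_on U F) is left sF then smk sF else 0.

Lemma smakeE F x : smooth_on U F -> U x -> smake F x = F x.
Proof.
move=> sF Ux; rewrite /smake; case: pselect => // sF' /=; exact: restrict0E.
Qed.

Lemma partial_smake i F x : smooth_on U F -> U x ->
  partial i (smake F) x = partial i F x.
Proof.
move=> sF Ux; apply: near_eq_derive; apply: near_open => // y Uy.
exact: smakeE.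
Qed.

Definition mx_smooth p q (B : 'rV[R]_m -> 'M[R]_(p, q)) :=
  forall i j, smooth_on U (fun x => B x i j).

Definition evm p q (B : 'M[sfun oU]_(p, q)) (x : 'rV[R]_m) : 'M[R]_(p, q) :=
  map_mx (fun f : sfun oU => f x) B.

Definition mxmake p q (B : 'rV[R]_m -> 'M[R]_(p, q)) : 'M[sfun oU]_(p, q) :=
  \matrix_(i, j) smake (fun x => B x i j).

Lemma evmE p q (B : 'M[sfun oU]_(p, q)) x i j : evm B x i j = B i j x.
Proof. by rewrite mxE. Qed.

Lemma evm_mxmake p q (B : 'rV[R]_m -> 'M[R]_(p, q)) x : mx_smooth B -> U x ->
  evm (mxmake B) x = B x.
Proof. by move=> sB Ux; apply/matrixP => i j; rewrite !mxE smakeE. Qed.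

Lemma evmP p q (B C : 'M[sfun oU]_(p, q)) :
  (forall x, U x -> evm B x = evm C x) -> B = C.
Proof.
move=> BC; apply/matrixP => i j; apply: sfunP => x Ux.
by have /matrixP/(_ i j) := BC x Ux; rewrite !mxE.
Qed.

Lemma evm_smooth p q (B : 'M[sfun oU]_(p, q)) : mx_smooth (evm B).
Proof.
move=> i j; apply: smooth_near (@sfun_smooth _ _ _ _ (B i j)) => // x _.
by rewrite mxE.
Qed.

Lemma evmD p q (B C : 'M[sfun oU]_(p, q)) x : U x ->
  evm (B + C) x = evm B x + evm C x.
Proof. by move=> Ux; apply/matrixP => i j; rewrite !mxE saddE. Qed.
Lemma evmN p q (B : 'M[sfun oU]_(p, q)) x : U x -> evm (- B) x = - evm B x.
Proof. by move=> Ux; apply/matrixP => i j; rewrite !mxE soppE. Qed.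
Lemma evmB p q (B C : 'M[sfun oU]_(p, q)) x : U x ->
  evm (B - C) x = evm B x - evm C x.
Proof. by move=> Ux; rewrite evmD// evmN. Qed.
Lemma evm0 p q x : evm (0 : 'M[sfun oU]_(p, q)) x = 0.
Proof. by apply/matrixP => i j; rewrite !mxE s0E. Qed.
Lemma evm1 p x : U x -> evm (1%:M : 'M[sfun oU]_p) x = 1%:M.
Proof. by move=> Ux; apply/matrixP => i j; rewrite !mxE snatE. Qed.
Lemma evmM p q r (B : 'M[sfun oU]_(p, q)) (C : 'M[sfun oU]_(q, r)) x : U x ->
  evm (B *m C) x = evm B x *m evm C x.
Proof.
move=> Ux; apply/matrixP => i j; rewrite !mxE s_sumE//.
by apply: eq_bigr => k _; rewrite smulE// !mxE.
Qed.
Lemma evmZ p q f (B : 'M[sfun oU]_(p, q)) x : U x -> evm (f *: B) x = f x *: evm B x.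
Proof. by move=> Ux; apply/matrixP => i j; rewrite !mxE smulE. Qed.
Lemma evmT p q (B : 'M[sfun oU]_(p, q)) x : evm B^T x = (evm B x)^T.
Proof. by apply/matrixP => i j; rewrite !mxE. Qed.
Lemma evm_row p q (B : 'M[sfun oU]_(p, q)) i x : evm (row i B) x = row i (evm B x).
Proof. by apply/matrixP => j k; rewrite !mxE. Qed.
Lemma evm_sum (I : Type) (r : seq I) (P : pred I) p q
    (E : I -> 'M[sfun oU]_(p, q)) x : U x ->
  evm (\sum_(i <- r | P i) E i) x = \sum_(i <- r | P i) evm (E i) x.
Proof.
move=> Ux; apply: (big_morph (fun B => evm B x)); last exact: evm0.
by move=> B C; exact: evmD.
Qed.
Lemma evm_tr p (B : 'M[sfun oU]_p) x : U x -> (\tr B) x = \tr (evm B x).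
Proof. by move=> Ux; rewrite /mxtrace s_sumE//; apply: eq_bigr => i _; rewrite mxE. Qed.
Lemma evm_delta p q i j x : U x ->
  evm (delta_mx i j : 'M[sfun oU]_(p, q)) x = delta_mx i j.
Proof. by move=> Ux; apply/matrixP => k l; rewrite !mxE snatE. Qed.

End SmoothRing.

(** * The Levi-Civita connection over the ring of smooth functions *)

Section SmoothMatrix.
Variables (R : realType) (m : nat) (U : set 'rV[R]_m) (oU : open U).

Lemma smooth_cst (a : R) : smooth_on U (fun=> a).
Proof. by move=> k; exact: Ck_cst. Qed.

Lemma smoothD (f g : 'rV[R]_m -> R) :
  smooth_on U f -> smooth_on U g -> smooth_on U (fun x => f x + g x).
Proof. by move=> sf sg k; exact: CkD. Qed.

Lemma smoothN (f : 'rV[R]_m -> R) : smooth_on U f -> smooth_on U (fun x => - f x).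
Proof. by move=> sf k; exact: CkN. Qed.

Lemma smoothM (f g : 'rV[R]_m -> R) :
  smooth_on U f -> smooth_on U g -> smooth_on U (fun x => f x * g x).
Proof. by move=> sf sg k; exact: CkM. Qed.

Lemma smooth_sum (I : Type) (r : seq I) (f : I -> 'rV[R]_m -> R) :
  (forall i, smooth_on U (f i)) -> smooth_on U (fun x => \sum_(i <- r) f i x).
Proof. by move=> sf k; apply: Ck_sum => // i; exact: sf. Qed.

Lemma smooth_prod (I : Type) (r : seq I) (f : I -> 'rV[R]_m -> R) :
  (forall i, smooth_on U (f i)) -> smooth_on U (fun x => \prod_(i <- r) f i x).
Proof.
move=> sf; elim: r => [|i r IH].
  by apply: (smooth_near oU _ (smooth_cst 1)) => x _; rewrite big_nil.
by apply: (smooth_near oU _ (smoothM (sf i) IH)) => x _; rewrite big_cons.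
Qed.

Lemma smooth_det p (B : 'rV[R]_m -> 'M[R]_p) : mx_smooth U B ->
  smooth_on U (fun x => \det (B x)).
Proof.
move=> sB; apply: smooth_sum => s; apply: smoothM; first exact: smooth_cst.
by apply: smooth_prod => i; exact: sB.
Qed.

Lemma mx_smooth_inv p (B : 'rV[R]_m -> 'M[R]_p) : mx_smooth U B ->
  (forall x, U x -> B x \in unitmx) -> mx_smooth U (fun x => invmx (B x)).
Proof.
move=> sB uB i j.
apply: (@smooth_near _ _ _ _ (fun x => (\det (B x))^-1 * \adj (B x) i j)) => //.
  by move=> x Ux; rewrite /invmx uB// [RHS]mxE.
apply: smoothM.
  move=> k; apply: CkV => //; last exact: smooth_det.
  by move=> x Ux; rewrite -unitfE -unitmxE uB.
rewrite (_ : (fun x => _) = (fun x => (-1) ^+ (j + i) *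
    \det (row' j (col' i (B x))))); last by apply/funext => x; rewrite mxE.
apply: smoothM; first exact: smooth_cst.
apply: smooth_det => s t.
rewrite (_ : (fun x => _) = (fun x => B x (lift j s) (lift i t))) ?sB//.
by apply/funext => x; rewrite !mxE.
Qed.

Lemma mx_smoothM p q r (B : 'rV[R]_m -> 'M[R]_(p, q)) (C : 'rV[R]_m -> 'M[R]_(q, r)) :
  mx_smooth U B -> mx_smooth U C -> mx_smooth U (fun x => B x *m C x).
Proof.
move=> sB sC i j; rewrite (_ : (fun x => _) = (fun x => \sum_k B x i k * C x k j)).
  by apply: smooth_sum => k; apply: smoothM.
by apply/funext => x; rewrite mxE.
Qed.

Lemma mx_smoothT p q (B : 'rV[R]_m -> 'M[R]_(p, q)) :
  mx_smooth U B -> mx_smooth U (fun x => (B x)^T).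
Proof.
move=> sB i j; rewrite (_ : (fun x => _) = (fun x => B x j i)) ?sB//.
by apply/funext => x; rewrite mxE.
Qed.

Lemma derive_evm p q (S : 'M[sfun oU]_(p, q)) v x : U x ->
  'D_v (evm S) x = \sum_i v 0 i *: evm (map_mx (spd i) S) x.
Proof.
move=> Ux; rewrite derive_mx; last first.
  apply/derivable_mxP => i j; apply: diff_derivable.
  by apply: (smooth_differentiable (evm_smooth S i j)).
apply/matrixP => i j; rewrite mxE summxE derive_delta; last first.
  by apply: (smooth_differentiable (evm_smooth S i j)).
apply: eq_bigr => k _; rewrite !mxE spdE//; congr (_ * _).
by apply: near_eq_derive; apply: (near_open oU Ux) => y _; rewrite mxE.
Qed.

Lemma derive_evm_dir p q (S : 'M[sfun oU]_(p, q)) (X : 'rV[sfun oU]_m) x : U x ->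
  'D_(evm X x) (evm S) x = evm (map_mx (dird (@spd _ _ _ oU) X) S) x.
Proof.
move=> Ux; rewrite derive_evm// dird_mxE evm_sum//; apply: eq_bigr => i _.
by rewrite evmZ// mxE.
Qed.

Lemma derive_mxmake p q (B : 'rV[R]_m -> 'M[R]_(p, q)) i x : mx_smooth U B -> U x ->
  evm (map_mx (spd i) (mxmake oU B)) x = \matrix_(j, l) partial i (fun y => B y j l) x.
Proof.
move=> sB Ux; apply/matrixP => j l; rewrite !mxE spdE//.
exact: partial_smake.
Qed.
End SmoothMatrix.

Section MetricRing.
Variables (R : realType) (m : nat) (U : set 'rV[R]_m) (oU : open U).
Variable G : 'rV[R]_m -> 'M[R]_m.
Hypothesis G_smooth : mx_smooth U G.
Hypothesis G_sym : forall x, U x -> (G x)^T = G x.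
Hypothesis G_unit : forall x, U x -> G x \in unitmx.
Local Notation A := (sfun oU).
Local Notation pd := (@spd _ _ _ oU).

(** Row [j] holds the components of the derivative of the coordinate field [j] along the coordinate
    field [i], so this matrix acts on row vectors from the right. *)
Definition christoffel_mx (i : 'I_m) (x : 'rV[R]_m) : 'M[R]_m :=
  \matrix_(j, l) christoffel G x l i j.

Lemma christoffel_smooth i : mx_smooth U (christoffel_mx i).
Proof.
move=> j l; rewrite (_ : (fun x => _) = (fun x => christoffel G x l i j)).
  apply: smoothM => //; first exact: smooth_cst.
  apply: smooth_sum => // k; apply: smoothM => //; first exact: mx_smooth_inv.
  apply: smoothD => //; last by apply: smoothN => //; apply: smooth_derive.
  by apply: smoothD => //; apply: smooth_derive.
by apply/funext => x; rewrite mxE.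
Qed.

Definition metric_mx : 'M[A]_m := mxmake oU G.
Definition levi_civita (i : 'I_m) : 'M[A]_m := mxmake oU (christoffel_mx i).
Local Notation C := levi_civita.

Lemma evm_metric x : U x -> evm metric_mx x = G x.
Proof. by move=> Ux; rewrite evm_mxmake. Qed.

Lemma evm_levi_civita i x : U x -> evm (C i) x = christoffel_mx i x.
Proof. by move=> Ux; rewrite evm_mxmake//; exact: christoffel_smooth. Qed.

Lemma G_sym_near x : U x -> \forall y \near x, (G y)^T = G y.
Proof. by move=> Ux; apply: (near_open oU Ux) => y; exact: G_sym. Qed.

Lemma levi_civita_sym i j l : C i j l = C j i l.
Proof.
apply: sfunP => x Ux; have E a b : C a b l x = christoffel G x l a b.
  by have /matrixP/(_ b l) := evm_levi_civita a Ux; rewrite !mxE.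
by rewrite !E christoffel_sym//; exact: G_sym_near.
Qed.

Lemma levi_civita_metric i :
  map_mx (pd i) metric_mx = C i *m metric_mx + metric_mx *m (C i)^T.
Proof.
apply: evmP => x Ux; rewrite derive_mxmake// evmD// !evmM// evmT evm_metric//.
rewrite evm_levi_civita//; apply/matrixP => j l; rewrite mxE.
rewrite (christoffel_metric (G_sym_near Ux) (G_unit Ux)) big_split/= !mxE.
congr (_ + _); apply: eq_bigr => k _; rewrite !mxE//.
by rewrite mulrC.
Qed.

Lemma christoffel_formE (u v x : 'rV[R]_m) :
  christoffel_form G x u v = v *m \sum_i u 0 i *: christoffel_mx i x.
Proof.
apply/rowP => k; rewrite !mxE exchange_big/=; apply: eq_bigr => j _.
rewrite summxE mulr_sumr; apply: eq_bigr => i _; rewrite !mxE.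
by rewrite mulrC [u 0 i * _]mulrC.
Qed.

Lemma nabla_evm (X Y : 'rV[A]_m) x : U x ->
  nabla G (evm X) (evm Y) x = evm (cov pd C X Y) x.
Proof.
move=> Ux; rewrite /nabla /cov evmD// derive_evm_dir//; congr (_ + _).
rewrite christoffel_formE evmM//; congr (_ *m _); rewrite /conn_form evm_sum//.
by apply: eq_bigr => i _; rewrite evmZ// evm_levi_civita// mxE.
Qed.

Lemma nabla_near (X X' Y Y' : 'rV[R]_m -> 'rV[R]_m) x : X x = X' x ->
  (\forall y \near x, Y y = Y' y) -> nabla G X Y x = nabla G X' Y' x.
Proof.
move=> XX YY; rewrite /nabla XX (nbhs_singleton YY); congr (_ + _).
exact: near_eq_derive.
Qed.

Lemma curvature_evm (X Y Z : 'rV[A]_m) x : U x ->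
  curvature G (evm X) (evm Y) (evm Z) x = evm (Z *m curv_form pd C X Y) x.
Proof.
move=> Ux; rewrite -(cov_curv (@spd_deriv _ _ _ oU) (@spdC _ _ _ oU)) !evmB//.
rewrite /curvature -!nabla_evm//.
have nn (V W : 'rV[A]_m) : nabla G (evm V) (nabla G (evm W) (evm Z)) x =
    nabla G (evm V) (evm (cov pd C W Z)) x.
  by apply: nabla_near => //; apply: (near_open oU Ux) => y Uy; rewrite nabla_evm.
rewrite !nn; congr (_ - _ - _); apply: nabla_near => //.
  by rewrite /lie_bracket /bracket evmB// !derive_evm_dir.
by near=> y.
Unshelve. all: by end_near. Qed.

Definition cst_mx p q (B : 'M[R]_(p, q)) : 'M[A]_(p, q) := map_mx (scst oU) B.

Lemma evm_cst p q (B : 'M[R]_(p, q)) x : U x -> evm (cst_mx B) x = B.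
Proof. by move=> Ux; apply/matrixP => i j; rewrite !mxE scstE. Qed.

(** Vectors extended with constant components are evaluations of matrices over the ring, so
    [curvature_evm] applies to them. Iterated derivatives need the equality in a neighbourhood, not
    only at [x]. *)
Lemma curvature_atE (u v w x : 'rV[R]_m) : U x ->
  curvature_at G x u v w = w *m \sum_i \sum_j (u 0 i * v 0 j) *: evm (curv_coef pd C i j) x.
Proof.
move=> Ux; transitivity (curvature G (evm (cst_mx u)) (evm (cst_mx v)) (evm (cst_mx w)) x).
  have E (t : 'rV[R]_m) y : U y -> t = evm (cst_mx t) y by move=> Uy; rewrite evm_cst.
  have nE (t : 'rV[R]_m) : \forall y \near x, t = evm (cst_mx t) y.
    by apply: (near_open oU Ux) => y; exact: E.
  have nn (s t : 'rV[R]_m) : nabla G (fun=> s) (nabla G (fun=> t) (fun=> w)) x =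
      nabla G (evm (cst_mx s)) (nabla G (evm (cst_mx t)) (evm (cst_mx w))) x.
    apply: nabla_near; first exact: E.
    apply: (near_open oU Ux) => y Uy; apply: nabla_near; first exact: E.
    by apply: (near_open oU Uy) => z; exact: E.
  rewrite /curvature_at /curvature !nn; congr (_ - _ - _).
  apply: nabla_near => //; rewrite /lie_bracket !evm_cst//.
  by congr (_ - _); apply: near_eq_derive; exact: nE.
rewrite curvature_evm// evmM// evm_cst//; congr (_ *m _).
rewrite /curv_form evm_sum//; apply: eq_bigr => i _; rewrite evm_sum//.
by apply: eq_bigr => j _; rewrite evmZ// !mxE smulE// !scstE.
Qed.

End MetricRing.

(** * Linear algebra at a point *)

Section CurvatureSymmetries.
Variables (A : comPzRingType) (m : nat) (pd : 'I_m -> A -> A).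
Hypothesis pd_deriv : forall i, derivation (pd i).
Hypothesis pdC : forall i j a, pd i (pd j a) = pd j (pd i a).
Variables (G : 'M[A]_m) (C : 'I_m -> 'M[A]_m).

Lemma curv_coefN i j : curv_coef pd C j i = - curv_coef pd C i j.
Proof. by rewrite /curv_coef; mx_ring. Qed.

(** Metric compatibility is differentiated once more; the symmetry of the second derivatives of [G]
    is exactly the asserted skewness. *)
Lemma curv_coef_metric i j : G^T = G ->
  (forall i, map_mx (pd i) G = C i *m G + G *m (C i)^T) ->
  (curv_coef pd C i j *m G)^T = - (curv_coef pd C i j *m G).
Proof.
move=> GT dG.
have dd a b : map_mx (pd a) (map_mx (pd b) G) = map_mx (pd a) (C b) *m G
    + C b *m (C a *m G) + C b *m G *m (C a)^T + C a *m G *m (C b)^T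
    + G *m ((C a)^T *m (C b)^T) + G *m (map_mx (pd a) (C b))^T.
  rewrite dG (deriv_mxD (pd_deriv a)) !(deriv_mxM (pd_deriv a)) dG -map_trmx.
  by rewrite !(mulmxDl, mulmxDr) !mulmxA; mx_ring.
have : map_mx (pd i) (map_mx (pd j) G) = map_mx (pd j) (map_mx (pd i) G).
  by apply/matrixP => a b; rewrite !mxE pdC.
rewrite !dd => /eqP; rewrite -subr_eq0 => /eqP E.
apply/eqP; rewrite -addr_eq0 -E; apply/eqP.
rewrite /curv_coef trmx_mul GT [_^T]linearB/= [_^T]linearD/= [_^T]linearB/= !trmx_mul.
by rewrite !(mulmxDl, mulmxDr, mulmxBl, mulmxBr, mulmxN, mulNmx) !mulmxA; mx_ring.
Qed.

Lemma curv_coef_bianchi i j l k : (forall i j l, C i j l = C j i l) ->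
  curv_coef pd C i j l k + curv_coef pd C j l i k + curv_coef pd C l i j k = 0.
Proof.
move=> Cs; rewrite /curv_coef !mx_linE !mxE (Cs j l) (Cs i l) (Cs i j).
have E a b d : \sum_s C a b s * C d s k = \sum_s C b a s * C d s k.
  by apply: eq_bigr => s _; rewrite Cs.
by rewrite (E j l) (E i l) (E i j); ring.
Qed.
End CurvatureSymmetries.

(** * Constant sectional curvature determines the curvature tensor *)

Section ConstantCurvature.
Variables (R : realFieldType) (m : nat) (G : 'M[R]_m) (Rm : 'I_m -> 'I_m -> 'M[R]_m).
Variable c : R.
Hypothesis G_sym : G^T = G.
Hypothesis RmN : forall i j, Rm j i = - Rm i j.
Hypothesis Rm_metric : forall i j, (Rm i j *m G)^T = - (Rm i j *m G).
Hypothesis Rm_bianchi : forall i j l k, Rm i j l k + Rm j l i k + Rm l i j k = 0.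

Local Notation ip u v := ((u *m G *m v^T) 0 0).
Definition Rm_op (u v : 'rV[R]_m) : 'M[R]_m := \sum_i \sum_j (u 0 i * v 0 j) *: Rm i j.

Hypothesis Rm_sec : forall u v : 'rV[R]_m,
  ip (v *m Rm_op u v) u = c * (ip u u * ip v v - ip u v ^+ 2).

(** The difference from the curvature tensor of a space form. It has all the algebraic symmetries of
    a curvature tensor and zero sectional curvature, which together make it vanish. *)
Let D (u v w z : 'rV[R]_m) :=
  ip (w *m Rm_op u v) z - c * (ip v w * ip u z - ip u w * ip v z).

Let ipC (u v : 'rV[R]_m) : ip u v = ip v u.
Proof.
transitivity ((u *m G *m v^T)^T 0 0); first by rewrite [RHS]mxE.
by rewrite !trmx_mul trmxK G_sym mulmxA.
Qed.

Let ipDl (u u' v : 'rV[R]_m) : ip (u + u') v = ip u v + ip u' v.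
Proof. by rewrite !mulmxDl mxE. Qed.

Let ipDr (u v v' : 'rV[R]_m) : ip u (v + v') = ip u v + ip u v'.
Proof. by rewrite (ipC u (v + v')) ipDl !(ipC u). Qed.

Let RmDl (u u' v : 'rV[R]_m) : Rm_op (u + u') v = Rm_op u v + Rm_op u' v.
Proof.
rewrite /Rm_op -big_split; apply: eq_bigr => i _; rewrite -big_split.
by apply: eq_bigr => j _; rewrite mxE mulrDl scalerDl.
Qed.

Let Rm_opN (u v : 'rV[R]_m) : Rm_op v u = - Rm_op u v.
Proof.
rewrite /Rm_op exchange_big -sumrN; apply: eq_bigr => i _; rewrite -sumrN.
by apply: eq_bigr => j _; rewrite RmN scalerN mulrC.
Qed.

Let DN12 (u v w z : 'rV[R]_m) : D v u w z = - D u v w z.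
Proof. by rewrite /D Rm_opN mulmxN !mulNmx mxE; ring. Qed.

Let DDl (u u' v w z : 'rV[R]_m) : D (u + u') v w z = D u v w z + D u' v w z.
Proof. by rewrite /D RmDl mulmxDr !ipDl; ring. Qed.
Let DD2 (u v v' w z : 'rV[R]_m) : D u (v + v') w z = D u v w z + D u v' w z.
Proof. by rewrite DN12 DDl opprD -!DN12. Qed.
Let DD3 (u v w w' z : 'rV[R]_m) : D u v (w + w') z = D u v w z + D u v w' z.
Proof. by rewrite /D mulmxDl !ipDl !ipDr; ring. Qed.
Let DD4 (u v w z z' : 'rV[R]_m) : D u v w (z + z') = D u v w z + D u v w z'.
Proof. by rewrite /D !ipDr; ring. Qed.

Let DN34 (u v w z : 'rV[R]_m) : D u v z w = - D u v w z.
Proof.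
have S : (Rm_op u v *m G)^T = - (Rm_op u v *m G).
  rewrite /Rm_op mulmx_suml linear_sum/= -sumrN; apply: eq_bigr => i _.
  rewrite mulmx_suml linear_sum/= -sumrN; apply: eq_bigr => j _.
  by rewrite -scalemxAl linearZ/= Rm_metric scalerN.
rewrite /D; have -> : ip (z *m Rm_op u v) w = - ip (w *m Rm_op u v) z.
  transitivity ((z *m (Rm_op u v *m G) *m w^T)^T 0 0); first by rewrite [RHS]mxE mulmxA.
  by rewrite trmx_mul [(z *m _)^T]trmx_mul trmxK S mulNmx mulmxN mx_linE !mulmxA.
ring.
Qed.

Let Dbianchi (u v w z : 'rV[R]_m) : D u v w z + D v w u z + D w u v z = 0.
Proof.
have B : w *m Rm_op u v + u *m Rm_op v w + v *m Rm_op w u = 0.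
  have E (a b d : 'rV[R]_m) k : (d *m Rm_op a b) 0 k =
      \sum_i \sum_j \sum_l (a 0 i * b 0 j * d 0 l) * Rm i j l k.
    rewrite mxE.
    transitivity (\sum_l \sum_i \sum_j (a 0 i * b 0 j * d 0 l) * Rm i j l k).
      apply: eq_bigr => l _; rewrite /Rm_op summxE mulr_sumr; apply: eq_bigr => i _.
      rewrite summxE mulr_sumr; apply: eq_bigr => j _; rewrite mxE; ring.
    rewrite exchange_big/=; apply: eq_bigr => i _; exact: exchange_big.
  apply/rowP => k; rewrite !mx_linE !E.
  have -> : \sum_i \sum_j \sum_l (v 0 i * w 0 j * u 0 l) * Rm i j l k =
      \sum_i \sum_j \sum_l (u 0 i * v 0 j * w 0 l) * Rm j l i k.
    under eq_bigr do rewrite exchange_big/=.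
    rewrite exchange_big/=; apply: eq_bigr => i _; apply: eq_bigr => j _.
    by apply: eq_bigr => l _; ring.
  have -> : \sum_i \sum_j \sum_l (w 0 i * u 0 j * v 0 l) * Rm i j l k =
      \sum_i \sum_j \sum_l (u 0 i * v 0 j * w 0 l) * Rm l i j k.
    rewrite exchange_big/=; apply: eq_bigr => i _.
    rewrite exchange_big/=; apply: eq_bigr => j _.
    by apply: eq_bigr => l _; ring.
  rewrite -!big_split big1// => i _; rewrite -!big_split big1// => j _.
  rewrite -!big_split big1//= => l _.
  by rewrite -!mulrDr Rm_bianchi mulr0.
have -> : D u v w z + D v w u z + D w u v z =
    ip (w *m Rm_op u v + u *m Rm_op v w + v *m Rm_op w u) z.
  by rewrite /D !ipDl (ipC v w) (ipC u w) (ipC u v); ring.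
by rewrite B !mul0mx mxE.
Qed.

Let Dsec (u v : 'rV[R]_m) : D u v v u = 0.
Proof. by rewrite /D Rm_sec (ipC v u); ring. Qed.

Let Dsec3 (u v w : 'rV[R]_m) : D u v w u + D u w v u = 0.
Proof.
by have := Dsec u (v + w); rewrite DD2 !DD3 !Dsec add0r addr0.
Qed.

Let Dsec4 (u v w z : 'rV[R]_m) : D u v w z + D z v w u + D u w v z + D z w v u = 0.
Proof.
have := Dsec3 (u + z) v w; rewrite !DDl !DD4.
by have := Dsec3 u v w; have := Dsec3 z v w; lra.
Qed.

Let D0 (u v w z : 'rV[R]_m) : D u v w z = 0.
Proof.
(* The rewriting below orders the arguments by the skew symmetries; the Bianchi identities and the
   polarised sectional condition then form a linear system whose only solution is zero. *)
have := Dbianchi u v w z; have := Dbianchi u v z w; have := Dbianchi u w z v.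
have := Dbianchi v w z u; have := Dsec4 u v w z; have := Dsec4 u v z w.
rewrite (DN12 u w v z) (DN34 u v w z) (DN12 u z v w) (DN34 u w v z).
rewrite (DN12 u z w v) (DN34 u z v w) (DN34 v w u z) (DN34 w z u v) (DN12 v z w u).
rewrite (DN34 v z u w) (DN12 w z v u) (DN34 w z u v) (DN12 v w z u) (DN34 v w u z).
lra.
Qed.

Lemma constant_curvature_tensor i j : G \in unitmx ->
  Rm i j = c *: (G *m (delta_mx j i - delta_mx i j)).
Proof.
move=> Gu; apply: (can_inj (mulmxK Gu)); apply/matrixP => l k.
have opE : Rm_op (delta_mx 0 i) (delta_mx 0 j) = Rm i j.
  rewrite /Rm_op (bigD1 i)//= [X in _ + X]big1 => [|a ai].
    rewrite (bigD1 j)//= [X in _ + X + _]big1 => [|b bj].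
      by rewrite !mxE !eqxx mul1r scale1r !addr0.
    by rewrite !mxE (negbTE bj) andbF mulr0 scale0r.
  by rewrite big1// => b _; rewrite !mxE (negbTE ai) andbF mul0r scale0r.
have ipE a b : ip (delta_mx 0 a : 'rV[R]_m) (delta_mx 0 b : 'rV[R]_m) = G a b.
  have -> : delta_mx 0 a *m G = row a G by rewrite rowE.
  by rewrite trmx_delta -colE !mxE.
have := D0 (delta_mx 0 i) (delta_mx 0 j) (delta_mx 0 l) (delta_mx 0 k).
rewrite /D opE !ipE => /eqP; rewrite subr_eq0 => /eqP E.
have -> : (Rm i j *m G) l k = ip (delta_mx 0 l *m Rm i j : 'rV[R]_m) (delta_mx 0 k : 'rV[R]_m).
  by rewrite -!mulmxA trmx_delta -colE -rowE !mxE; apply: eq_bigr => a _; rewrite !mxE.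
rewrite E -scalemxAl mx_linE -mulmxA mulmxBl mulmxBr !mx_linE.
have dM a b e : (delta_mx a b *m G) e k = (e == a)%:R * G b k.
  rewrite mxE (bigD1 b)//= big1 ?addr0 => [|f fb]; first by rewrite !mxE eqxx andbT.
  by rewrite mxE (negbTE fb) andbF mul0r.
have dE a b : (G *m (delta_mx a b *m G)) l k = G l a * G b k.
  rewrite mxE (bigD1 a)//= big1 ?addr0 => [|d da]; first by rewrite dM eqxx mul1r.
  by rewrite dM (negbTE da) mul0r mulr0.
have Gs a b : G a b = G b a by rewrite -[in LHS]G_sym mxE.
by rewrite !dE (Gs j l) (Gs i l).
Qed.
End ConstantCurvature.

(** Sectional curvature is only prescribed on independent pairs, while polarisation needs all pairs.
    If the Gram determinant vanishes, equality in the Cauchy-Schwarz inequality makes [u] zero or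
    [v] a multiple of [u], and both sides are zero. *)
Lemma sectional_polarizable (R : realFieldType) (m : nat) (G : 'M[R]_m)
    (Rm : 'I_m -> 'I_m -> 'M[R]_m) (c : R) :
  (forall i j, Rm j i = - Rm i j) -> G^T = G ->
  (forall v : 'rV[R]_m, v != 0 -> 0 < (v *m G *m v^T) 0 0) ->
  (forall u v : 'rV[R]_m, free [:: u; v] ->
    (v *m Rm_op Rm u v *m G *m u^T) 0 0 /
    ((u *m G *m u^T) 0 0 * (v *m G *m v^T) 0 0 - (u *m G *m v^T) 0 0 ^+ 2) = c) ->
  forall u v : 'rV[R]_m, (v *m Rm_op Rm u v *m G *m u^T) 0 0 =
    c * ((u *m G *m u^T) 0 0 * (v *m G *m v^T) 0 0 - (u *m G *m v^T) 0 0 ^+ 2).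
Proof.
move=> RmN GT Gpos sec u v; set den := _ - _ ^+ 2.
have RmZ k : Rm_op Rm u (k *: u) = 0.
  rewrite /Rm_op; set S := \sum_i _; suff SN : S = - S.
    apply/matrixP => i j; have /matrixP/(_ i j) := SN; rewrite !mxE => e.
    by apply/eqP; rewrite -[_ == 0](mulrn_eq0 _ 2) mulr2n {1}e addNr.
  rewrite {1}/S exchange_big -sumrN; apply: eq_bigr => i _; rewrite -sumrN.
  by apply: eq_bigr => j _; rewrite RmN scalerN !mxE; congr (- (_ *: _)); ring.
have ipC (a b : 'rV[R]_m) : (a *m G *m b^T) 0 0 = (b *m G *m a^T) 0 0.
  transitivity ((a *m G *m b^T)^T 0 0); first by rewrite [RHS]mxE.
  by rewrite !trmx_mul trmxK GT mulmxA.
have [den0|den_neq0] := eqVneq den 0.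
  rewrite den0 mulr0; have [->|u0] := eqVneq u 0; first by rewrite trmx0 mulmx0 mxE.
  have uu := Gpos u u0.
  pose k := (u *m G *m v^T) 0 0 / (u *m G *m u^T) 0 0.
  suff -> : v = k *: u by rewrite RmZ mulmx0 !mul0mx mxE.
  apply/eqP; rewrite -subr_eq0; apply: contraT => /Gpos.
  have -> : ((v - k *: u) *m G *m (v - k *: u)^T) 0 0 = den / (u *m G *m u^T) 0 0.
    rewrite [(v - _)^T]linearB/= [(k *: u)^T]linearZ/= !(mulmxBl, mulmxBr).
    rewrite !(=^~ scalemxAl, =^~ scalemxAr) !mx_linE (ipC v u) /den /k.
    by field; rewrite gt_eqF.
  by rewrite den0 mul0r ltxx.
have uv : free [:: u; v].
  rewrite free_cons seq1_free span_seq1; apply/andP; split; last first.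
    by apply: contraNneq den_neq0 => v0; rewrite /den v0 trmx0 !mulmx0 !mx_linE; apply/eqP; ring.
  apply: contraNN den_neq0 => /vlineP[k uk]; rewrite /den uk.
  by rewrite [(k *: v)^T]linearZ/= -!scalemxAl -!scalemxAr !mx_linE; apply/eqP; ring.
by rewrite -(sec u v uv) divfK.
Qed.

(** In a full rank factorisation of an idempotent, the product of the factors in the other order is
    the identity of size [\rank P]. *)
Lemma trace_idempotent (F : fieldType) p (P : 'M[F]_p) :
  P *m P = P -> \tr P = (\rank P)%:R.
Proof.
move=> PP; have /row_fullP[B BC] := col_base_full P.
have /row_freeP[D CD] := row_base_free P.
have RC : row_base P *m col_base P = 1%:M.
  have : B *m (col_base P *m row_base P *m (col_base P *m row_base P)) *m D =
      B *m (col_base P *m row_base P) *m D by rewrite !mulmx_base PP.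
  move: (col_base P) (row_base P) BC CD => C E BC ED.
  by rewrite !mulmxA BC !mul1mx -!mulmxA ED !mulmx1.
by rewrite -[X in \tr X]mulmx_base mxtrace_mulC RC mxtrace1.
Qed.

(* [- B / a] would be an idempotent of trace [1 / 2]. *)
Lemma half_trace_contradiction (F : numFieldType) p (B : 'M[F]_p) (a : F) :
  a != 0 -> a *: B + B *m B = 0 -> \tr B *+ 2 + a = 0 -> False.
Proof.
move=> a0 BB trB; pose P := - a^-1 *: B.
have PP : P *m P = P.
  rewrite /P -scalemxAl -scalemxAr; have -> : B *m B = - a *: B.
    by apply/eqP; rewrite -subr_eq0 -scaleNr opprK addrC BB.
  by rewrite !scalerA; congr (_ *: _); field.
have : \tr P *+ 2 = 1.
  rewrite /P linearZ/= -mulrnAr; have -> : \tr B *+ 2 = - a.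
    by apply/eqP; rewrite -addr_eq0 trB.
  by field.
rewrite trace_idempotent// => E.
have /eqP : (\rank P * 2)%:R = 1%:R :> F by rewrite natrM mulr_natr E.
by rewrite eqr_nat muln2 => /eqP/(congr1 odd); rewrite odd_double.
Qed.

(** Put [f = a + (2n - 1) c], which is nonnegative because [b] is. For [c >= 0] the two sides of the
    last equation have incompatible signs. For [c < 0] one has [n |c| <= a] and [f <= a + c] with
    [a + c > 0], so the left side is at most [a (a + c)] in absolute value, half of what the
    equation demands. *)
Lemma integrable_contradiction (F : realFieldType) n (a b c : F) : (2 <= n)%N ->
  0 < a -> 0 <= b -> b = (a + (n.*2%:R - 1) * c) * a ->
  (a + (n.*2%:R - 1) * c) * c *+ n = - (a * (a + c)) *+ 2 -> False.
Proof.
move=> n2 a0 b0 bE; rewrite -mulr_natr -muln2 natrM in bE *.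
set N : F := n%:R in bE *; have N2 : 2 <= N by rewrite ler_nat.
set f := a + _ in bE *; have fa : 0 <= f * a by rewrite -bE.
have f0 : 0 <= f by rewrite -(pmulr_lge0 _ a0).
rewrite mulr2n => E; have [c0|c0] := lerP 0 c.
  have : 0 <= f * c * N by rewrite !mulr_ge0//; lra.
  have : 0 < a * (a + c) by rewrite mulr_gt0// ltr_wpDr.
  lra.
have da : (N * 2 - 1) * (- c) <= a by rewrite /f in f0; lra.
have h1 : 0 <= (N - 1) * (- c) by apply: mulr_ge0; lra.
have h2 : N * (- c) <= a by lra.
have h3 : f <= a + c by rewrite /f; lra.
have h4 : 0 < a + c.
  have : 0 <= (N - 2) * (- c) by apply: mulr_ge0; lra.
  lra.
have h5 : f * (N * (- c)) <= f * a by rewrite ler_wpM2l.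
have h6 : f * a <= (a + c) * a by rewrite ler_wpM2r// ltW.
have h7 : 0 < a * (a + c) by rewrite mulr_gt0.
have h8 : f * c * N = - (f * (N * (- c))) by ring.
have h9 : (a + c) * a = a * (a + c) by rewrite mulrC.
lra.
Qed.

(** * Horizontal lifts and the vertical projection at a point *)

Section SubmersionAlgebra.
Variables (R : realFieldType) (n : nat) (F : 'M[R]_(n.+1, n)).
Variables (G : 'M[R]_n.+1) (h : 'M[R]_n).
Hypothesis G_sym : G^T = G.
Hypothesis G_pos : forall v : 'rV[R]_n.+1, v != 0 -> 0 < (v *m G *m v^T) 0 0.
Hypothesis F_surj : forall w : 'rV[R]_n, exists v : 'rV[R]_n.+1, v *m F = w.
Hypothesis F_iso : forall u v : 'rV[R]_n.+1,
  (forall t : 'rV[R]_n.+1, t *m F = 0 -> (u *m G *m t^T) 0 0 = 0) ->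
  (forall t : 'rV[R]_n.+1, t *m F = 0 -> (v *m G *m t^T) 0 0 = 0) ->
  (u *m F *m h *m (v *m F)^T) 0 0 = (u *m G *m v^T) 0 0.

Lemma posdef_unitmx p (B : 'M[R]_p) :
  (forall v : 'rV[R]_p, v != 0 -> 0 < (v *m B *m v^T) 0 0) -> B \in unitmx.
Proof.
move=> Bpos; rewrite -row_free_unit -kermx_eq0.
apply/eqP/row_matrixP => i; rewrite row0; apply/eqP; apply: contraT => k0.
by have := Bpos _ k0; rewrite -row_mul mulmx_ker row0 mul0mx mxE ltxx.
Qed.

Let Gu : G \in unitmx. Proof. exact: posdef_unitmx. Qed.
Let GV : G *m invmx G = 1%:M. Proof. exact: mulmxV. Qed.
Let VG : invmx G *m G = 1%:M. Proof. exact: mulVmx. Qed.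
Let GVT : (invmx G)^T = invmx G. Proof. by rewrite trmx_inv G_sym. Qed.

(** The rows of [F^T *m invmx G] span the orthogonal complement of the kernel of [F]; the factor [h]
    normalises them so that they project to the coordinate vectors. *)
Definition horizontal_lift : 'M[R]_(n, n.+1) := h *m F^T *m invmx G.
Local Notation X := horizontal_lift.
Local Notation K := (F^T *m invmx G *m F).

Let lift_horizontal (w : 'rV[R]_n) (t : 'rV[R]_n.+1) :
  t *m F = 0 -> (w *m F^T *m invmx G *m G *m t^T) 0 0 = 0.
Proof.
by move=> tF; rewrite -[_ *m invmx G *m G]mulmxA VG mulmx1 -mulmxA -trmx_mul tF trmx0 mulmx0 mxE.
Qed.

(** The isometry condition on the rows of [F^T *m invmx G] says [K *m h *m K = K], so it suffices
    that [K] is invertible. If [w *m K = 0], then [w *m F^T *m invmx G] has norm zero, hence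
    [w *m F^T = 0], and surjectivity of [F] gives [w = 0]. *)
Lemma dual_metric : K *m h = 1%:M.
Proof.
have entry p q (B : 'M[R]_(p, q)) i j :
    B i j = (delta_mx 0 i *m B *m (delta_mx 0 j)^T : 'M[R]_1) 0 0.
  by rewrite trmx_delta -rowE -colE !mxE.
have KhK : K *m h *m K = K.
  apply/matrixP => i j; rewrite [LHS]entry [RHS]entry.
  have := F_iso (@lift_horizontal (delta_mx 0 i)) (@lift_horizontal (delta_mx 0 j)).
  rewrite !trmx_mul !trmxK GVT -!mulmxA [invmx G *m (G *m _)]mulmxA VG mul1mx => E.
  by rewrite E.
have Ku : K \in unitmx.
  rewrite -row_free_unit -kermx_eq0; apply/eqP/row_matrixP => i; rewrite row0.
  set w := row i _; have wK : w *m K = 0 by rewrite /w -row_mul mulmx_ker row0.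
  clearbody w.
  have wF : w *m F^T = 0.
    have u0 : w *m F^T *m invmx G = 0.
      apply/eqP; apply: contraT => /G_pos.
      rewrite !trmx_mul trmxK GVT -!mulmxA [G *m _]mulmxA GV mul1mx.
      by rewrite !mulmxA in wK *; rewrite wK mul0mx mxE ltxx.
    by rewrite -[LHS]mulmx1 -VG mulmxA u0 mul0mx.
  have [v vF] := F_surj w.
  have ww : w *m w^T = 0 by rewrite -[in X in _ *m X]vF trmx_mul mulmxA wF mul0mx.
  apply/rowP => j; rewrite mxE; apply/eqP; rewrite -sqrf_eq0; apply/eqP.
  have /matrixP/(_ 0 0) := ww; rewrite !mxE => /eqP.
  rewrite psumr_eq0; last by move=> k _; rewrite mxE -expr2 sqr_ge0.
  by move=> /allP/(_ j (mem_index_enum j)); rewrite mxE -expr2 => /eqP.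
by rewrite -[LHS]mulmx1 -(mulmxV Ku) mulmxA KhK.
Qed.

Let hK : h *m K = 1%:M. Proof. exact: mulmx1C dual_metric. Qed.

Lemma lift_F : X *m F = 1%:M.
Proof. by rewrite /X -hK !mulmxA. Qed.

Hypothesis h_sym : h^T = h.

Lemma lift_metric : X *m G *m X^T = h.
Proof.
rewrite /X !trmx_mul trmxK GVT h_sym -!mulmxA [invmx G *m (G *m _)]mulmxA VG mul1mx.
by have := dual_metric; rewrite -!mulmxA => ->; rewrite mulmx1.
Qed.

Lemma lift_vertical p (v : 'M[R]_(p, n.+1)) : v *m F = 0 -> X *m G *m v^T = 0.
Proof.
move=> vF; rewrite /X -[_ *m invmx G *m G]mulmxA VG mulmx1.
by rewrite -mulmxA -trmx_mul vF trmx0 mulmx0.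
Qed.

Definition vertical_proj : 'M[R]_n.+1 := 1%:M - F *m X.

Lemma vertical_projF : vertical_proj *m F = 0.
Proof. by rewrite mulmxBl mul1mx -mulmxA lift_F mulmx1 subrr. Qed.

(** The trace of this projection is [(n + 1) - n = 1]. A nonzero diagonal entry is a scalar witness
    that row [i] is a nonzero vertical vector, also at nearby points. *)
Lemma vertical_proj_neq0 : exists i, vertical_proj i i != 0.
Proof.
apply/existsP; apply: contraT => /existsPn P0.
have : \tr vertical_proj = 1.
  rewrite /vertical_proj raddfB/= mxtrace1 mxtrace_mulC lift_F mxtrace1.
  by rewrite -natrB// subSnn.
rewrite /mxtrace big1 => [/eqP|i _]; first by rewrite eq_sym oner_eq0.
by apply/eqP; have := P0 i; rewrite negbK.
Qed.

Lemma frame_complete (V : 'rV[R]_n.+1) : V *m F = 0 -> V *m G *m V^T = 1%:M ->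
  invmx G = X^T *m invmx h *m X + V^T *m V.
Proof.
move=> VF VGV.
have hu : h \in unitmx by have [] := mulmx1_unit hK.
have XGV := lift_vertical VF.
have VGX : V *m G *m X^T = 0.
  apply: trmx_inj; rewrite trmx_mul [(V *m G)^T]trmx_mul trmxK G_sym mulmxA.
  by rewrite XGV trmx0.
pose Q : 'M[R]_(1 + n, n.+1) := col_mx V X.
pose B : 'M[R]_(1 + n) := block_mx 1%:M 0 0 (invmx h).
have QB : Q *m (G *m Q^T *m B) = 1%:M.
  rewrite mulmxA mulmxA /Q tr_col_mx mul_col_mx mul_col_row.
  rewrite VGV VGX XGV lift_metric mulmx_block.
  by rewrite !(mulmx0, mul0mx, addr0, add0r, mulmx1) mulmxV// -scalar_mx_block.
have BQ : G *m Q^T *m B *m Q = 1%:M by exact: (@mulmx1C _ n.+1 Q _ QB).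
have -> : invmx G = Q^T *m B *m Q.
  have BQ' : G *m (Q^T *m B *m Q) = 1%:M by rewrite !mulmxA.
  rewrite -[LHS]mulmx1 -BQ'.
  by move: (Q^T *m B *m Q) => S; rewrite mulmxA VG mul1mx.
rewrite /Q /B tr_col_mx mul_row_block !mulmx0 addr0 add0r mulmx1 mul_row_col.
by rewrite addrC.
Qed.
End SubmersionAlgebra.

(** * Local Riemannian submersions *)

(** A submersion read in a pair of charts. Only the source set [U] is shrunk later; the target set
    [W] merely has to contain the image. *)
Record local_submersion (R : realType) (n : nat) (c : R)
    (G : 'rV[R]_n.+1 -> 'M[R]_n.+1) (H : 'rV[R]_n -> 'M[R]_n)
    (f : 'rV[R]_n.+1 -> 'rV[R]_n) (W : set 'rV[R]_n) (U : set 'rV[R]_n.+1) : Prop :=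
  LocalSubmersion {
  ls_open : open U;
  ls_open_target : open W;
  ls_fun : forall x, U x -> W (f x);
  ls_f : smooth_on U f;
  ls_G : mx_smooth U G;
  ls_H : mx_smooth W H;
  ls_G_sym : forall x, U x -> (G x)^T = G x;
  ls_H_sym : forall y, W y -> (H y)^T = H y;
  ls_G_pos : forall x, U x -> forall v, v != 0 -> 0 < inner G x v v;
  ls_H_pos : forall y, W y -> forall v, v != 0 -> 0 < inner H y v v;
  ls_curv : forall x, U x -> forall u v : 'rV[R]_n.+1, free [:: u; v] ->
    sectional_curvature G x u v = c;
  ls_surj : forall x, U x -> forall w, exists v, 'D_v f x = w;
  ls_iso : forall x, U x -> forall u v,
    horizontal G f x u -> horizontal G f x v ->
    inner H (f x) ('D_u f x) ('D_v f x) = inner G x u v }.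

Lemma local_submersion_sub (R : realType) (n : nat) (c : R)
    (G : 'rV[R]_n.+1 -> 'M[R]_n.+1) (H : 'rV[R]_n -> 'M[R]_n)
    (f : 'rV[R]_n.+1 -> 'rV[R]_n) (W : set 'rV[R]_n) (U U' : set 'rV[R]_n.+1) :
  open U' -> U' `<=` U -> local_submersion c G H f W U ->
  local_submersion c G H f W U'.
Proof.
move=> oU' UU [oU oW fW sf sG sH Gs Hs Gp Hp sec surj iso]; split=> //.
- by move=> x /UU; exact: fW.
- exact: smooth_sub UU sf.
- by move=> i j; exact: smooth_sub UU (sG i j).
- by move=> x /UU; exact: Gs.
- by move=> x /UU; exact: Gp.
- by move=> x /UU; exact: sec.
- by move=> x /UU; exact: surj.
- by move=> x /UU; exact: iso.
Qed.

Definition differential_mx (R : realType) (m n : nat) (f : 'rV[R]_m -> 'rV[R]_n)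
    (x : 'rV[R]_m) : 'M[R]_(m, n) := \matrix_(i, a) partial i f x 0 a.

Lemma derive_differential (R : realType) (m n : nat) (f : 'rV[R]_m -> 'rV[R]_n)
    (x v : 'rV[R]_m) : differentiable f x -> 'D_v f x = v *m differential_mx f x.
Proof.
move=> df; rewrite derive_delta// mulmx_sum_row; apply: eq_bigr => i _.
by congr (_ *: _); apply/rowP => a; rewrite !mxE.
Qed.

Section LocalSubmersion.
Variables (R : realType) (n : nat) (c : R).
Variables (G : 'rV[R]_n.+1 -> 'M[R]_n.+1) (H : 'rV[R]_n -> 'M[R]_n).
Variables (f : 'rV[R]_n.+1 -> 'rV[R]_n) (W : set 'rV[R]_n) (U : set 'rV[R]_n.+1).
Hypothesis LS : local_submersion c G H f W U.
Let oU : open U := ls_open LS.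
Let oW : open W := ls_open_target LS.
Local Notation A := (sfun oU).
Local Notation pd := (@spd _ _ _ oU).
Local Notation dF := (differential_mx f).

Lemma f_differentiable x : U x -> differentiable f x.
Proof. exact: smooth_differentiable (ls_f LS). Qed.

Lemma G_unit x : U x -> G x \in unitmx.
Proof. by move=> Ux; apply: posdef_unitmx; exact: ls_G_pos LS _ Ux. Qed.

Lemma H_unit y : W y -> H y \in unitmx.
Proof. by move=> Wy; apply: posdef_unitmx; exact: ls_H_pos LS _ Wy. Qed.

Lemma comp_smooth p q (B : 'rV[R]_n -> 'M[R]_(p, q)) : mx_smooth W B ->
  mx_smooth U (fun x => B (f x)).
Proof.
move=> sB i j k.
exact: (@Ck_comp _ _ _ _ _ _ _ (fun y => B y i j) oU (ls_f LS) (ls_fun LS) (sB i j k)).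
Qed.

Lemma dF_smooth : mx_smooth U dF.
Proof.
move=> i a; rewrite (_ : (fun x => _) = (fun x => partial i f x 0 a)).
  by apply: smooth_coord => //; apply: smooth_derive; exact: ls_f LS.
by apply/funext => x; rewrite mxE.
Qed.

Definition lift_fun (x : 'rV[R]_n.+1) : 'M[R]_(n, n.+1) :=
  horizontal_lift (dF x) (G x) (H (f x)).

Lemma lift_smooth : mx_smooth U lift_fun.
Proof.
apply: mx_smoothM => //; last first.
  by apply: mx_smooth_inv => //; [exact: ls_G LS|exact: G_unit].
apply: mx_smoothM => //; first exact: comp_smooth (ls_H LS).
by apply: mx_smoothT; exact: dF_smooth.
Qed.

Lemma christoffel_f_smooth a : mx_smooth U (fun x => christoffel_mx H a (f x)).
Proof.
apply: (comp_smooth (B := christoffel_mx H a)).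
by apply: christoffel_smooth => //; [exact: ls_H LS|exact: H_unit].
Qed.

Definition dchristoffel (a b : 'I_n) (y : 'rV[R]_n) : 'M[R]_n :=
  \matrix_(i, j) partial a (fun y => christoffel_mx H b y i j) y.

Lemma partial_mx_smooth p q (B : 'rV[R]_n -> 'M[R]_(p, q)) a : mx_smooth W B ->
  mx_smooth W (fun y => \matrix_(i, j) partial a (fun z => B z i j) y).
Proof.
move=> sB i j; rewrite (_ : (fun x => _) = (fun y => partial a (fun z => B z i j) y)).
  by apply: smooth_derive; exact: sB.
by apply/funext => x; rewrite mxE.
Qed.

Lemma dchristoffel_f_smooth a b : mx_smooth U (fun x => dchristoffel a b (f x)).
Proof.
apply: (comp_smooth (B := dchristoffel a b)); apply: partial_mx_smooth.
by apply: christoffel_smooth => //; [exact: ls_H LS|exact: H_unit].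
Qed.

Definition rG : 'M[A]_n.+1 := metric_mx oU G.
Definition rGi : 'M[A]_n.+1 := mxmake oU (fun x => invmx (G x)).
Definition rC : 'I_n.+1 -> 'M[A]_n.+1 := levi_civita oU G.
Definition rh : 'M[A]_n := mxmake oU (fun x => H (f x)).
Definition rhi : 'M[A]_n := mxmake oU (fun x => invmx (H (f x))).
Definition rF : 'M[A]_(n.+1, n) := mxmake oU dF.
Definition rX : 'M[A]_(n, n.+1) := mxmake oU lift_fun.
Definition rom (a : 'I_n) : 'M[A]_n := mxmake oU (fun x => christoffel_mx H a (f x)).
Definition rdom (a b : 'I_n) : 'M[A]_n := mxmake oU (fun x => dchristoffel a b (f x)).

Lemma evm_rG x : U x -> evm rG x = G x.
Proof. by move=> Ux; rewrite evm_mxmake//; exact: ls_G LS. Qed.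
Lemma evm_rGi x : U x -> evm rGi x = invmx (G x).
Proof.
move=> Ux; rewrite evm_mxmake//; apply: mx_smooth_inv => //; last exact: G_unit.
exact: ls_G LS.
Qed.
Lemma evm_rh x : U x -> evm rh x = H (f x).
Proof.
by move=> Ux; rewrite evm_mxmake//; apply: comp_smooth; exact: ls_H LS.
Qed.
Lemma evm_rhi x : U x -> evm rhi x = invmx (H (f x)).
Proof.
move=> Ux; rewrite evm_mxmake//; apply: (comp_smooth (B := fun y => invmx (H y))).
by apply: mx_smooth_inv => //; [exact: ls_H LS|exact: H_unit].
Qed.
Lemma evm_rF x : U x -> evm rF x = dF x.
Proof. by move=> Ux; rewrite evm_mxmake//; exact: dF_smooth. Qed.
Lemma evm_rX x : U x -> evm rX x = lift_fun x.
Proof. by move=> Ux; rewrite evm_mxmake//; exact: lift_smooth. Qed.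
Lemma evm_rom a x : U x -> evm (rom a) x = christoffel_mx H a (f x).
Proof. by move=> Ux; rewrite evm_mxmake//; exact: christoffel_f_smooth. Qed.
Lemma evm_rdom a b x : U x -> evm (rdom a b) x = dchristoffel a b (f x).
Proof. by move=> Ux; rewrite evm_mxmake//; exact: dchristoffel_f_smooth. Qed.

Lemma rGT : rG^T = rG.
Proof. by apply: evmP => x Ux; rewrite evmT evm_rG// (ls_G_sym LS). Qed.
Lemma rhT : rh^T = rh.
Proof. by apply: evmP => x Ux; rewrite evmT evm_rh// (ls_H_sym LS)//; exact: ls_fun LS _ Ux. Qed.
Lemma rhiT : rhi^T = rhi.
Proof.
apply: evmP => x Ux; rewrite evmT evm_rhi// trmx_inv (ls_H_sym LS)//.
exact: ls_fun LS _ Ux.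
Qed.
Lemma rhhi : rh *m rhi = 1%:M.
Proof.
apply: evmP => x Ux; rewrite evmM// evm1// evm_rh// evm_rhi// mulmxV// H_unit//.
exact: ls_fun LS _ Ux.
Qed.
Lemma rhih : rhi *m rh = 1%:M.
Proof.
apply: evmP => x Ux; rewrite evmM// evm1// evm_rh// evm_rhi// mulVmx// H_unit//.
exact: ls_fun LS _ Ux.
Qed.
Lemma rGGi : rG *m rGi = 1%:M.
Proof.
by apply: evmP => x Ux; rewrite evmM// evm1// evm_rG// evm_rGi// mulmxV// G_unit.
Qed.

Lemma dF_surj x : U x -> forall w : 'rV_n, exists v : 'rV_n.+1, v *m dF x = w.
Proof.
move=> Ux w; have [v vw] := ls_surj LS Ux w; exists v.
by rewrite -derive_differential//; exact: f_differentiable.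
Qed.

Lemma dF_iso x : U x -> forall u v : 'rV_n.+1,
  (forall t : 'rV_n.+1, t *m dF x = 0 -> (u *m G x *m t^T) 0 0 = 0) ->
  (forall t : 'rV_n.+1, t *m dF x = 0 -> (v *m G x *m t^T) 0 0 = 0) ->
  (u *m dF x *m H (f x) *m (v *m dF x)^T) 0 0 = (u *m G x *m v^T) 0 0.
Proof.
move=> Ux u v uh vh; have dfx := f_differentiable Ux.
have hor w : (forall t : 'rV_n.+1, t *m dF x = 0 -> (w *m G x *m t^T) 0 0 = 0) ->
    horizontal G f x w.
  by move=> wh t; rewrite derive_differential//; exact: wh.
have := ls_iso LS Ux (hor _ uh) (hor _ vh).
by rewrite !derive_differential.
Qed.

Lemma rXF : rX *m rF = 1%:M.
Proof.
apply: evmP => x Ux; rewrite evmM// evm1// evm_rX// evm_rF//.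
apply: lift_F; [exact: ls_G_sym LS _ Ux|exact: ls_G_pos LS _ Ux| |exact: dF_iso].
exact: dF_surj.
Qed.

Lemma rXGX : rX *m rG *m rX^T = rh.
Proof.
apply: evmP => x Ux; rewrite !evmM// evmT evm_rX// evm_rG// evm_rh//.
apply: lift_metric; [exact: ls_G_sym LS _ Ux|exact: ls_G_pos LS _ Ux| | |].
- exact: dF_surj.
- exact: dF_iso.
- by apply: ls_H_sym LS _ _; exact: ls_fun LS _ Ux.
Qed.

Lemma rF_closed i j a : pd i (rF j a) = pd j (rF i a).
Proof.
have E k l x : U x -> pd k (rF l a) x =
    'D_(delta_mx 0 k) (fun y => 'D_(delta_mx 0 l) (fun z => f z 0 a) y) x.
  move=> Ux; rewrite spdE//; apply: near_eq_derive; apply: (near_open oU Ux) => y Uy.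
  have /matrixP/(_ l a) := evm_rF Uy; rewrite !mxE => ->.
  by rewrite /partial derive_mx ?mxE//; exact: diff_derivable (f_differentiable Uy).
apply: sfunP => x Ux; apply: (etrans (E i j x Ux)).
apply: (etrans _ (esym (E j i x Ux))); apply: (derive_comm _ _ oU) Ux.
by apply: smooth_coord => //; exact: ls_f LS.
Qed.

Lemma rom_sym a b d : rom a b d = rom b a d.
Proof.
apply: sfunP => x Ux.
have /matrixP/(_ b d) := evm_rom a Ux; rewrite !mxE => ->.
have /matrixP/(_ a d) := evm_rom b Ux; rewrite !mxE => ->.
apply: christoffel_sym; apply: (near_open oW (ls_fun LS Ux)) => y Wy.
exact: ls_H_sym LS _ Wy.
Qed.

Lemma pd_comp p q (B : 'rV[R]_n -> 'M[R]_(p, q)) i x : mx_smooth W B -> U x ->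
  evm (map_mx (pd i) (mxmake oU (fun x => B (f x)))) x =
  \sum_a dF x i a *: \matrix_(j, l) partial a (fun z => B z j l) (f x).
Proof.
move=> sB Ux; rewrite derive_mxmake//; last exact: comp_smooth.
apply/matrixP => j l; rewrite mxE summxE /partial.
rewrite (@derive_comp _ _ _ f (fun y => B y j l)); last 2 first.
- exact: f_differentiable.
- by apply: (smooth_differentiable (sB j l)); exact: ls_fun LS _ Ux.
by apply: eq_bigr => a _; rewrite !mxE.
Qed.

Lemma pd_rh i :
  map_mx (pd i) rh = \sum_a rF i a *: (rom a *m rh + rh *m (rom a)^T).
Proof.
apply: evmP => x Ux; rewrite pd_comp//; last exact: ls_H LS.
rewrite evm_sum//; apply: eq_bigr => a _; rewrite evmZ//.
have /matrixP/(_ i a) := evm_rF Ux; rewrite mxE => ->; congr (_ *: _).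
rewrite evmD// !evmM// evmT evm_rom// evm_rh//; apply/matrixP => j l; rewrite mxE.
have Wx := ls_fun LS Ux.
have Hs : \forall y \near f x, (H y)^T = H y.
  by apply: (near_open oW Wx) => y; exact: ls_H_sym LS y.
rewrite (christoffel_metric Hs (H_unit Wx)) big_split/= !mxE.
congr (_ + _); apply: eq_bigr => d _; rewrite !mxE//.
by rewrite mulrC.
Qed.

Lemma pd_rom i b : map_mx (pd i) (rom b) = \sum_a rF i a *: rdom a b.
Proof.
apply: evmP => x Ux; rewrite pd_comp//; last first.
  by apply: christoffel_smooth => //; [exact: ls_H LS|exact: H_unit].
rewrite evm_sum//; apply: eq_bigr => a _; rewrite evmZ// evm_rdom//.
by have /matrixP/(_ i a) := evm_rF Ux; rewrite [X in X = _ -> _]mxE => ->.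
Qed.

(** The symmetries are proved over the ring and evaluated; the polarisation of the sectional
    curvature takes place pointwise, over the real numbers. *)
Lemma rC_curv i j : curv_coef pd rC i j =
  scst oU c *: (rG *m (delta_mx j i - delta_mx i j)).
Proof.
apply: evmP => x Ux; rewrite evmZ// scstE// evmM// [X in _ *m X]evmB// !evm_delta// evm_rG//.
have Gs : mx_smooth U G by exact: ls_G LS.
have Gsym : forall x, U x -> (G x)^T = G x by exact: ls_G_sym LS.
have Cs := levi_civita_sym oU Gs Gsym G_unit.
have Cm := levi_civita_metric oU Gs Gsym G_unit.
apply: (@constant_curvature_tensor _ _ (G x) (fun i j => evm (curv_coef pd rC i j) x)) => //.
- exact: ls_G_sym LS _ Ux.
- by move=> a b; rewrite curv_coefN evmN.
- move=> a b.
  have := @curv_coef_metric A _ pd (@spd_deriv _ _ _ oU) (@spdC _ _ _ oU) rG rC a b rGT Cm.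
  move=> /(congr1 (fun B => evm B x)).
  move: (curv_coef pd rC a b) => P.
  by rewrite evmT [X in _ = X]evmN// evmM// evm_rG.
- move=> a b d k.
  have B0 := @curv_coef_bianchi _ _ pd rC a b d k Cs.
  move: (curv_coef pd rC a b) (curv_coef pd rC b d) (curv_coef pd rC d a) B0.
  by move=> P Q S B0; rewrite !evmE -saddE// -saddE// B0 s0E.
- apply: sectional_polarizable => [| | |u v uv].
  + by move=> a b; rewrite curv_coefN evmN.
  + exact: ls_G_sym LS _ Ux.
  + exact: ls_G_pos LS _ Ux.
  + by rewrite /Rm_op -(curvature_atE oU Gs G_unit u v v Ux); exact: ls_curv LS _ Ux u v uv.
- exact: G_unit.
Qed.

Definition rRN a b : 'M[A]_n :=
  rdom a b + rom b *m rom a - (rdom b a + rom a *m rom b).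

Lemma nabla_along_evm (X : 'rV[A]_n.+1) (S : 'rV[A]_n) x : U x ->
  nabla_along H f (evm X) (evm S) x = evm (cov pd (pull_conn rF rom) X S) x.
Proof.
move=> Ux; rewrite /nabla_along /cov evmD// derive_evm_dir//; congr (_ + _).
rewrite christoffel_formE evmM//; congr (_ *m _).
rewrite (derive_differential _ (f_differentiable Ux)) -(evm_rF Ux) -evmM//.
rewrite conn_form_pull evm_sum//; apply: eq_bigr => a _.
by rewrite evmZ// evm_rom// evmE.
Qed.

Lemma nabla_along_near (X X' : 'rV[R]_n.+1 -> 'rV[R]_n.+1)
    (S S' : 'rV[R]_n.+1 -> 'rV[R]_n) x : X x = X' x ->
  (\forall y \near x, S y = S' y) -> nabla_along H f X S x = nabla_along H f X' S' x.
Proof.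
move=> XX SS; rewrite /nabla_along XX (nbhs_singleton SS); congr (_ + _).
exact: near_eq_derive.
Qed.

Lemma evm_curv_coef m (Z : set 'rV[R]_m) (oZ : open Z) p
    (P Q S T : 'M[sfun oZ]_p) x (P' Q' S' T' : 'M[R]_p) : Z x ->
  evm P x = P' -> evm Q x = Q' -> evm S x = S' -> evm T x = T' ->
  evm (P - Q + S *m T - T *m S) x = P' - Q' + S' *m T' - T' *m S'.
Proof. by move=> Zx <- <- <- <-; rewrite evmB// evmD// evmB// !evmM. Qed.

Lemma curvature_at_target (u v w : 'rV[R]_n) x : U x ->
  curvature_at H (f x) u v w = w *m \sum_a \sum_b (u 0 a * v 0 b) *: evm (rRN a b) x.
Proof.
move=> Ux; have Wx := ls_fun LS Ux.
rewrite (curvature_atE oW (ls_H LS) H_unit u v w Wx); congr (_ *m _).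
apply: eq_bigr => a _; apply: eq_bigr => b _; congr (_ *: _).
have sC d : mx_smooth W (christoffel_mx H d).
  by apply: christoffel_smooth => //; [exact: ls_H LS|exact: H_unit].
have LC d : evm (levi_civita oW H d) (f x) = christoffel_mx H d (f x).
  by rewrite evm_mxmake.
have DLC d d' : evm (map_mx (@spd _ _ _ oW d) (levi_civita oW H d')) (f x) =
    dchristoffel d d' (f x) by rewrite derive_mxmake.
have -> : rRN a b = rdom a b - rdom b a + rom b *m rom a - rom a *m rom b.
  by rewrite /rRN; move: (rdom a b) (rdom b a) (rom b) (rom a) => P Q S T; mx_ring.
transitivity (dchristoffel a b (f x) - dchristoffel b a (f x)
    + christoffel_mx H b (f x) *m christoffel_mx H a (f x)
    - christoffel_mx H a (f x) *m christoffel_mx H b (f x)).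
  exact: (evm_curv_coef Wx (DLC a b) (DLC b a) (LC b) (LC a)).
apply/esym; exact: (evm_curv_coef Ux (evm_rdom a b Ux) (evm_rdom b a Ux)
  (evm_rom b Ux) (evm_rom a Ux)).
Qed.

(** * The tension and bitension fields as evaluations of ring elements *)

Section Frame.
Variable e : 'I_n.+1 -> 'rV[R]_n.+1 -> 'rV[R]_n.+1.
Hypothesis e_frame : orthonormal_frame G U e.

Definition frame_mx (x : 'rV[R]_n.+1) : 'M[R]_n.+1 := \matrix_i e i x.
Definition rE : 'M[A]_n.+1 := mxmake oU frame_mx.

Lemma evm_rE x : U x -> evm rE x = frame_mx x.
Proof.
move=> Ux; rewrite evm_mxmake// => i j.
rewrite (_ : (fun x => _) = (fun x => e i x 0 j)).
  by apply: smooth_coord => //; exact: e_frame.1.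
by apply/funext => y; rewrite mxE.
Qed.

Lemma evm_row_rE i x : U x -> evm (row i rE) x = e i x.
Proof. by move=> Ux; rewrite evm_row evm_rE// rowK. Qed.

(** Orthonormality says that [G x] times the transposed frame inverts the frame matrix on one side,
    hence on both. *)
Lemma rEE : rE^T *m rE = rGi.
Proof.
apply: evmP => x Ux; rewrite evmM// evmT evm_rE// evm_rGi//.
have EGE : frame_mx x *m (G x *m (frame_mx x)^T) = 1%:M.
  apply/matrixP => i j; have := e_frame.2 x Ux i j; rewrite /inner.
  rewrite -[e i x](rowK (fun i => e i x)) -/(frame_mx x).
  rewrite -[e j x](rowK (fun i => e i x)) -/(frame_mx x) => E.
  rewrite [RHS]mxE -E -row_mul mulmxA !mxE.
  by apply: eq_bigr => k _; rewrite !mxE.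
have := mulmx1C EGE; move: (frame_mx x) => E EG.
by rewrite -[LHS]mul1mx -(mulVmx (G_unit Ux)) -mulmxA mulmxA -[invmx _ *m _ *m _]mulmxA
  mulmxA -!mulmxA [G x *m _]mulmxA EG mulmx1.
Qed.

Lemma pushforward_evm (Y : 'rV[R]_n.+1 -> 'rV[R]_n.+1) (X : 'rV[A]_n.+1) x : U x ->
  Y x = evm X x -> Defs.pushforward f Y x = evm (X *m rF) x.
Proof.
move=> Ux YX; rewrite /Defs.pushforward YX evmM// evm_rF//.
exact: derive_differential (f_differentiable Ux).
Qed.

Lemma nabla_frame i x : U x ->
  nabla G (e i) (e i) x = evm (cov pd rC (row i rE) (row i rE)) x.
Proof.
move=> Ux; rewrite -(nabla_evm (ls_G LS) G_unit _ _ Ux).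
apply: nabla_near; first by rewrite evm_row_rE.
by apply: (near_open oU Ux) => y Uy; rewrite evm_row_rE.
Qed.

Lemma tension_evm x : U x ->
  tension G H f e x = evm (tension_alg pd rC rF rom rE) x.
Proof.
move=> Ux; rewrite /tension /tension_alg evm_sum//; apply: eq_bigr => i _.
rewrite /second_form evmB// -nabla_along_evm//; congr (_ - _).
  apply: nabla_along_near; first by rewrite evm_row_rE.
  by apply: (near_open oU Ux) => y Uy; apply: pushforward_evm; rewrite ?evm_row_rE.
by apply: pushforward_evm => //; rewrite nabla_frame.
Qed.

Lemma bitension_evm x : U x -> bitension G H f e x =
  evm (bitension_alg pd rC rF rom rRN rE (tension_alg pd rC rF rom rE)) x.
Proof.
move=> Ux; set t := tension_alg _ _ _ _ _.
have nt y : U y -> \forall z \near y, tension G H f e z = evm t z.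
  by move=> Uy; apply: (near_open oU Uy) => z; exact: tension_evm.
clearbody t; rewrite /bitension /bitension_alg evm_sum//; apply: eq_bigr => i _.
rewrite /hessian_along /jacobi_term !evmB// -!nabla_along_evm//; congr (_ - _ - _).
- apply: nabla_along_near; first by rewrite evm_row_rE.
  apply: (near_open oU Ux) => y Uy; rewrite -nabla_along_evm//.
  by apply: nabla_along_near; [rewrite evm_row_rE|exact: nt].
- by apply: nabla_along_near; [rewrite nabla_frame|exact: nt].
- have pf : Defs.pushforward f (e i) x = evm (row i rE *m rF) x.
    by apply: pushforward_evm; rewrite ?evm_row_rE.
  rewrite curvature_at_target// pf (nbhs_singleton (nt x Ux)) [RHS]evmM//; congr (_ *m _).
  rewrite /tensor_form [RHS]evm_sum//.
  apply: eq_bigr => a _; rewrite [RHS]evm_sum//.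
  by apply: eq_bigr => b _; rewrite evmZ// smulE// !evmE.
Qed.
End Frame.

(** * The contradictions in the presence of a unit vertical field *)

Section Vertical.
Variable v : 'rV[R]_n.+1 -> 'rV[R]_n.+1.
Hypothesis v_smooth : mx_smooth U v.
Hypothesis v_vertical : forall x, U x -> v x *m dF x = 0.
Hypothesis v_unit : forall x, U x -> inner G x (v x) (v x) = 1.

Definition rV : 'M[A]_(1, n.+1) := mxmake oU v.

Lemma evm_rV x : U x -> evm rV x = v x.
Proof. by move=> Ux; rewrite evm_mxmake. Qed.

Lemma v_unit_mx x : U x -> v x *m G x *m (v x)^T = 1%:M.
Proof.
move=> Ux; rewrite [LHS]mx11_scalar; congr _%:M; exact: v_unit.
Qed.

Lemma rVF : rV *m rF = 0.
Proof.
by apply: evmP => x Ux; rewrite evmM// evm0 evm_rV// evm_rF// v_vertical.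
Qed.

Lemma rVGV : rV *m rG *m rV^T = 1%:M.
Proof.
by apply: evmP => x Ux; rewrite !evmM// evm1// evmT evm_rV// evm_rG// v_unit_mx.
Qed.

Lemma rXGV : rX *m rG *m rV^T = 0.
Proof.
apply: evmP => x Ux; rewrite !evmM// evm0 evmT evm_rV// evm_rG// evm_rX//.
by apply: lift_vertical; [exact: ls_G_pos LS _ Ux|exact: v_vertical].
Qed.

Lemma rcomplete : rGi = rX^T *m rhi *m rX + rV^T *m rV.
Proof.
apply: evmP => x Ux; rewrite evmD// !evmM// !evmT evm_rV// evm_rhi// evm_rX// evm_rGi//.
apply: frame_complete; [exact: ls_G_sym LS _ Ux|exact: ls_G_pos LS _ Ux| | | | |].
- exact: dF_surj.
- exact: dF_iso.
- by apply: ls_H_sym LS _ _; exact: ls_fun LS _ Ux.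
- exact: v_vertical.
- exact: v_unit_mx.
Qed.

(** Stated with real-valued fields rather than over the ring, so that it does not depend on [U] and
    can serve to choose the open set on which the ring is formed. *)
Definition integrability (a b : 'I_n) (x : 'rV[R]_n.+1) : R :=
  inner G x (lie_bracket (fun y => row a (lift_fun y)) (fun y => row b (lift_fun y)) x)
    (v x).

Lemma integrability_evm a b x : U x ->
  (bracket pd (row a rX) (row b rX) *m rG *m rV^T) 0 0 x = integrability a b x.
Proof.
move=> Ux; rewrite -evmE !evmM// evmT evm_rG// evm_rV// /integrability /inner.
congr ((_ *m _ *m _) 0 0); rewrite /bracket evmB// -!derive_evm_dir// /lie_bracket.
have E d y : U y -> evm (row d rX) y = row d (lift_fun y).
  by move=> Uy; rewrite evm_row evm_rX.
have D d d' : 'D_(evm (row d rX) x) (evm (row d' rX)) x =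
    'D_(row d (lift_fun x)) (fun y => row d' (lift_fun y)) x.
  rewrite (E d x Ux); apply: near_eq_derive.
  by apply: (near_open oU Ux) => y; exact: E.
exact: (f_equal2 (fun s t => s - t) (D a b) (D b a)).
Qed.

Lemma integrability_smooth a b : smooth_on U (integrability a b).
Proof.
apply: (smooth_near oU _ (@sfun_smooth _ _ _ _
  ((bracket pd (row a rX) (row b rX) *m rG *m rV^T) 0 0))) => x.
exact: integrability_evm.
Qed.

Lemma rh_nondeg (w : 'rV[A]_n) : w *m rh *m w^T = 0 -> w = 0.
Proof.
move=> ww; apply: evmP => x Ux; rewrite evm0; apply/eqP; apply: contraT => w0.
have := ls_H_pos LS (ls_fun LS Ux) w0; rewrite /inner -(evm_rh Ux) -evmT -!evmM//.
by rewrite ww evm0 mxE ltxx.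
Qed.

Section Biharmonic.
Variable e : 'I_n.+1 -> 'rV[R]_n.+1 -> 'rV[R]_n.+1.
Hypothesis e_frame : orthonormal_frame G U e.
Hypothesis n_ge2 : (2 <= n)%N.
Hypothesis biharmonic : forall x, U x -> bitension G H f e x = 0.
Hypothesis tension_neq0 : forall x, U x -> tension G H f e x != 0.

Local Notation tau := (tension_alg pd rC rF rom (rE e)).

Lemma bitension_alg0 : bitension_alg pd rC rF rom rRN (rE e) tau = 0.
Proof. by apply: evmP => x Ux; rewrite evm0 -bitension_evm// biharmonic. Qed.

Lemma tau_norm_gt0 x : U x -> 0 < ((tau *m rh *m tau^T) 0 0 : A) x.
Proof.
move=> Ux; have := ls_H_pos LS (ls_fun LS Ux) (tension_neq0 Ux).
by rewrite /inner (tension_evm e_frame Ux) -(evm_rh Ux) -evmT -!evmM// evmE.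
Qed.

Lemma tau_norm_unit : exists ai : A, (tau *m rh *m tau^T) 0 0 * ai = 1.
Proof. by apply: s_unit => x Ux; rewrite gt_eqF// tau_norm_gt0. Qed.

Definition rJ : 'M[A]_n :=
  \matrix_(a, b) (cov pd rC (row a rX) rV *m rG *m rX^T *m rhi) 0 b.

Lemma row_rJ a : row a rJ = cov pd rC (row a rX) rV *m rG *m rX^T *m rhi.
Proof. by apply/rowP => b; rewrite [LHS]mxE [LHS]mxE. Qed.

Lemma nonintegrable_contradiction a b x0 : U x0 ->
  (forall x, U x -> integrability a b x != 0) -> False.
Proof.
move=> Ux0 om0.
have [g gE] : exists g : A, (bracket pd (row a rX) (row b rX) *m rG *m rV^T) 0 0 * g = 1.
  by apply: s_unit => x Ux; rewrite integrability_evm// om0.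
have [B [trB BB]] := biharmonic_nonintegrable (@spd_deriv _ _ _ oU) (@spdC _ _ _ oU)
  (@s_reduced _ _ _ oU) (@s_torsionfree _ _ _ oU) (fun i => spd_cst oU i c)
  rGT rhT rhiT rhhi rhih rXF rVF rXGX rXGV rVGV rGGi rcomplete rF_closed
  (levi_civita_sym oU (ls_G LS) (ls_G_sym LS) G_unit)
  (levi_civita_metric oU (ls_G LS) (ls_G_sym LS) G_unit)
  rC_curv rom_sym pd_rh pd_rom row_rJ erefl erefl erefl (rEE e_frame) n_ge2 rh_nondeg
  bitension_alg0 tau_norm_unit (ex_intro _ a (ex_intro _ b (ex_intro _ g gE))).
have t0 := tau_norm_gt0 Ux0; set t := (tau *m _ *m _) 0 0 in trB BB t0.
clearbody t.
apply: (@half_trace_contradiction _ _ (evm B x0) (t x0)).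
- by rewrite gt_eqF.
- by rewrite -evmZ// -evmM// -evmD// BB evm0.
- by rewrite -evm_tr// -smulrnE// -saddE// trB s0E.
Qed.

Lemma integrable_contradiction_at x0 : U x0 ->
  (forall a b x, U x -> integrability a b x = 0) -> False.
Proof.
move=> Ux0 om0.
have b0 a b : (bracket pd (row a rX) (row b rX) *m rG *m rV^T) 0 0 = 0.
  by apply: sfunP => x Ux; rewrite integrability_evm// om0// s0E.
have [nu /= [nuE tE]] := biharmonic_integrable (@spd_deriv _ _ _ oU) (@spdC _ _ _ oU)
  (@s_reduced _ _ _ oU) (@s_torsionfree _ _ _ oU) (fun i => spd_cst oU i c)
  rGT rhT rhiT rhhi rhih rXF rVF rXGX rXGV rVGV rGGi rcomplete rF_closed
  (levi_civita_sym oU (ls_G LS) (ls_G_sym LS) G_unit)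
  (levi_civita_metric oU (ls_G LS) (ls_G_sym LS) G_unit)
  rC_curv rom_sym pd_rh pd_rom row_rJ erefl erefl erefl (rEE e_frame)
  bitension_alg0 tau_norm_unit b0.
have t0 := tau_norm_gt0 Ux0; set t := (tau *m _ *m _) 0 0 in nuE tE t0.
clearbody t.
have q0 : 0 <= ((nu *m rh *m nu^T) 0 0 : A) x0.
  rewrite -evmE !evmM// evmT evm_rh//.
  have [->|/(ls_H_pos LS (ls_fun LS Ux0))/ltW//] := eqVneq (evm nu x0) 0.
  by rewrite trmx0 mulmx0 mxE.
set q := (nu *m rh *m nu^T) 0 0 in nuE q0; clearbody q.
apply: (@integrable_contradiction _ n (t x0) (q x0) c) => //.
  by rewrite nuE !(smulE, saddE, soppE, scstE, snatE, s1E).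
have := congr1 (fun g : A => g x0) tE.
by rewrite !(smulrnE, smulE, saddE, soppE, scstE, snatE, s1E).
Qed.
End Biharmonic.
End Vertical.
End LocalSubmersion.

(** * Biharmonic implies harmonic *)

Lemma open_neq0 (R : realType) m (U : set 'rV[R]_m) (g : 'rV[R]_m -> R) :
  open U -> smooth_on U g -> open [set x | U x /\ g x != 0].
Proof.
move=> oU sg; rewrite openE => x [Ux gx]; rewrite /interior.
have cg : {for x, continuous g} by exact: smooth_continuous sg Ux.
have g0 : \forall y \near x, g y != 0 by exact: cvgr_neq0 cg gx.
by apply: filterS2 (open_nbhs_nbhs (conj oU Ux)) g0 => y Uy gy; split.
Qed.

Lemma orthonormal_frame_sub (R : realType) m (G : 'rV[R]_m -> 'M[R]_m)
    (U U' : set 'rV[R]_m) (e : 'I_m -> 'rV[R]_m -> 'rV[R]_m) : U' `<=` U ->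
  orthonormal_frame G U e -> orthonormal_frame G U' e.
Proof.
move=> UU [se oe]; split=> [i|x /UU]; last exact: oe.
exact: smooth_sub UU (se i).
Qed.

Section LocalTheorem.
Variables (R : realType) (n : nat) (c : R).
Variables (G : 'rV[R]_n.+1 -> 'M[R]_n.+1) (H : 'rV[R]_n -> 'M[R]_n).
Variables (f : 'rV[R]_n.+1 -> 'rV[R]_n) (W : set 'rV[R]_n).

(** A row of the vertical projection is a smooth vertical field; it is normalised on the open set
    where the chosen diagonal entry is nonzero. *)
Lemma vertical_field (U : set 'rV[R]_n.+1) x0 : local_submersion c G H f W U -> U x0 ->
  exists (U' : set 'rV[R]_n.+1) (v : 'rV[R]_n.+1 -> 'rV[R]_n.+1),
  [/\ open U', U' `<=` U, U' x0, mx_smooth U' v &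
    forall x, U' x -> v x *m differential_mx f x = 0 /\ inner G x (v x) (v x) = 1].
Proof.
move=> LS Ux0; have oU := ls_open LS.
pose P x := vertical_proj (differential_mx f x) (G x) (H (f x)).
have P_smooth : mx_smooth U P.
  move=> i j; rewrite (_ : (fun x => P x i j) = (fun x => (i == j)%:R
      + - (differential_mx f x *m lift_fun G H f x) i j)); last first.
    by apply/funext => x; rewrite !mxE.
  apply: smoothD => //; first exact: smooth_cst.
  apply: smoothN => //; apply: mx_smoothM => //; first exact: dF_smooth LS.
  exact: lift_smooth LS.
have PF x : U x -> P x *m differential_mx f x = 0.
  move=> Ux; apply: vertical_projF; [exact: ls_G_sym LS _ Ux|exact: ls_G_pos LS _ Ux| |].
    exact: dF_surj LS _ Ux.
  exact: dF_iso LS _ Ux.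
have [i Pi] : exists i, P x0 i i != 0.
  apply: vertical_proj_neq0; [exact: ls_G_sym LS _ Ux0|exact: ls_G_pos LS _ Ux0| |].
    exact: dF_surj LS _ Ux0.
  exact: dF_iso LS _ Ux0.
pose U' := [set x | U x /\ P x i i != 0].
have oU' : open U' by apply: open_neq0 => //; exact: P_smooth.
have UU : U' `<=` U by move=> x [].
pose w x := row i (P x); pose q x := inner G x (w x) (w x).
have w_smooth : mx_smooth U' w.
  move=> a b; rewrite (_ : (fun x => _) = (fun x => P x i b)).
    exact: smooth_sub UU (P_smooth i b).
  by apply/funext => x; rewrite mxE.
have q_gt0 x : U' x -> 0 < q x.
  move=> [Ux Px]; apply: (ls_G_pos LS Ux); apply: contraNneq Px => /rowP/(_ i).
  by rewrite !mxE => ->.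
have q_smooth : smooth_on U' q.
  apply: mx_smoothM => //; last exact: mx_smoothT.
  by apply: mx_smoothM => // a b; exact: smooth_sub UU (ls_G LS a b).
exists U', (fun x => (Num.sqrt (q x))^-1 *: w x); split=> //.
- move=> a b; rewrite (_ : (fun x => _) = (fun x => (Num.sqrt (q x))^-1 * w x a b)).
    apply: smoothM => // k; apply: CkV => //; last by apply: Ck_sqrt.
    by move=> x Ux; rewrite sqrtr_eq0 -ltNge q_gt0.
  by apply/funext => x; rewrite mxE.
- move=> x U'x; have Ux := UU _ U'x; split.
    by rewrite -scalemxAl /w -row_mul PF// row0 scaler0.
  rewrite /inner linearZ/= -!scalemxAl -scalemxAr !mx_linE mulrA -invfM -expr2.
  by rewrite sqr_sqrtr ?ltW ?q_gt0// mulVf// gt_eqF// q_gt0.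
Qed.

(** One component of the tension field is nonzero on an open set around [x0]. Either the horizontal
    distribution is integrable on all of that set, or some bracket component is nonzero at one of
    its points and hence on a smaller open set. This point need not be [x0], but the tension field
    does not vanish there either. *)
Lemma local_biharmonic_harmonic (U : set 'rV[R]_n.+1)
    (e : 'I_n.+1 -> 'rV[R]_n.+1 -> 'rV[R]_n.+1) : (2 <= n)%N ->
  local_submersion c G H f W U -> orthonormal_frame G U e ->
  (forall x, U x -> bitension G H f e x = 0) ->
  forall x, U x -> tension G H f e x = 0.
Proof.
move=> n2 LS eU bih x0 Ux0; apply/eqP; apply: contraT => t0.
have [k tk] : exists k, tension G H f e x0 0 k != 0.
  apply/existsP; apply: contraT => /existsPn tk; case/eqP: t0; apply/rowP => k.
  by rewrite mxE; apply/eqP; have := tk k; rewrite negbK.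
have [U1 [v [oU1 UU1 U1x sv vP]]] := vertical_field LS Ux0.
have t_smooth : smooth_on U1 (fun x => tension G H f e x 0 k).
  apply: smooth_sub UU1 _; apply: smooth_near (ls_open LS) _ _.
    by move=> x Ux; rewrite (tension_evm LS eU Ux).
  exact: evm_smooth.
pose U2 := [set x | U1 x /\ tension G H f e x 0 k != 0].
have oU2 : open U2 by exact: open_neq0.
have key (V : set 'rV[R]_n.+1) : open V -> V `<=` U2 -> [/\ local_submersion c G H f W V,
    orthonormal_frame G V e, mx_smooth V v,
    (forall x, V x -> v x *m differential_mx f x = 0) /\
    (forall x, V x -> inner G x (v x) (v x) = 1) &
    (forall x, V x -> bitension G H f e x = 0) /\
    (forall x, V x -> tension G H f e x != 0)].
  move=> oV VU; have VU1 : V `<=` U1 by move=> x /VU[].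
  have VU0 : V `<=` U by move=> x /VU1/UU1.
  split.
  - exact: local_submersion_sub oV VU0 LS.
  - exact: orthonormal_frame_sub VU0 eU.
  - by move=> i j; exact: smooth_sub VU1 (sv i j).
  - by split=> x /VU1/vP[].
  - split=> x Vx; first exact/bih/VU0.
    have [_] := VU x Vx; apply: contraNneq => ->.
    by rewrite mxE.
have [LS2 e2 v2 [vF2 v12] [b2 t2]] := key U2 oU2 (@subset_refl _ _).
have [[y [a [b [U2y ab]]]]|no] :=
    pselect (exists y a b, U2 y /\ integrability G H f v a b y != 0).
  pose U3 := [set x | U2 x /\ integrability G H f v a b x != 0].
  have oU3 : open U3 by apply: open_neq0 => //; exact: (integrability_smooth LS2 v2).
  have UU3 : U3 `<=` U2 by move=> x [].
  have [LS3 e3 v3 [vF3 v13] [b3 t3]] := key U3 oU3 UU3.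
  have := nonintegrable_contradiction LS3 v3 vF3 v13 e3 n2 b3 t3 (conj U2y ab).
  by case/(_ a b) => // x [].
have U2x : U2 x0 by [].
case: (integrable_contradiction_at LS2 v2 vF2 v12 e2 n2 b2 t2 U2x) => a b x U2x'.
by apply/eqP; apply: contraT => ab; case: no; exists x, a, b.
Qed.
End LocalTheorem.

(** * Harmonic maps are biharmonic *)

Section HarmonicBiharmonic.
Variables (R : realType) (m n : nat) (H : 'rV[R]_n -> 'M[R]_n).

Lemma nabla0 (X Y : 'rV[R]_n -> 'rV[R]_n) x : X x = 0 -> nabla H X Y x = 0.
Proof.
move=> X0; rewrite /nabla X0 derive0 add0r christoffel_formE.
by rewrite big1 ?mulmx0// => i _; rewrite mxE scale0r.
Qed.

Lemma curvature_at0 (x u w : 'rV[R]_n) : curvature_at H x u 0 w = 0.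
Proof.
rewrite /curvature_at /curvature !(@nabla0 (fun=> 0))// [X in _ - X]nabla0; last first.
  by rewrite /lie_bracket derive_cst derive0 subrr.
have -> : nabla H (fun=> 0) (fun=> w) = fun=> 0.
  by apply/funext => y; exact: nabla0.
by rewrite /nabla derive_cst christoffel_formE mul0mx addr0 !subr0.
Qed.

(** The tension field vanishes on an open set, so its covariant derivatives vanish there too, and
    the curvature term has a zero argument. *)
Lemma harmonic_bitension (G : 'rV[R]_m -> 'M[R]_m) (f : 'rV[R]_m -> 'rV[R]_n)
    (e : 'I_m -> 'rV[R]_m -> 'rV[R]_m) (U : set 'rV[R]_m) : open U ->
  (forall x, U x -> tension G H f e x = 0) ->
  forall x, U x -> bitension G H f e x = 0.
Proof.
move=> oU t0 x Ux; rewrite /bitension big1// => i _.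
have near0 (S : 'rV[R]_m -> 'rV[R]_n) (X : 'rV[R]_m -> 'rV[R]_m) y : U y ->
    (forall z, U z -> S z = 0) -> nabla_along H f X S y = 0.
  move=> Uy S0; rewrite /nabla_along S0// christoffel_formE mul0mx addr0.
  rewrite -[RHS](derive_cst (0 : 'rV[R]_n) y (X y)); apply: near_eq_derive.
  exact: (near_open oU Uy).
rewrite !near0// => [|y Uy]; last exact: near0.
by rewrite t0// curvature_at0 subrr subr0.
Qed.
End HarmonicBiharmonic.

Theorem theorem1p2 (R : realType) (n : nat) (hn : (2 <= n)%N) (c : R)
    (M : smoothManifold R n.+1) (g : riemannianMetric M)
    (N : smoothManifold R n) (h : riemannianMetric N) (phi : M -> N)
    (hM : constant_sectional_curvature g c)
    (hphi : riemannian_submersion g h phi) :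
  biharmonic_map g h phi <-> harmonic_map g h phi.
Proof.
have [[_ phi_smooth] sub] := hphi.
split=> Hphi a b U e aa ab oU Ud eU; last first.
  by apply: harmonic_bitension => //; exact: (Hphi a b U e).
have Ua x : U x -> img a x by move=> /Ud[p [ap _] <-]; exists p.
apply: (@local_biharmonic_harmonic _ _ c _ _ _ (img b)) => //; last exact: (Hphi a b U e).
split=> //.
- exact: img_open.
- move=> x /Ud[p [ap bp] <-]; exists (phi p) => //.
  by rewrite /local_rep /= coordK.
- exact: smooth_sub Ud (phi_smooth a b aa ab).
- move=> i j; apply: smooth_coord => //; apply: smooth_sub (gram_smooth g aa).
  by move=> x /Ua.
- move=> i j; apply: smooth_coord; first exact: img_open.
  exact: gram_smooth.
- by move=> x Ux; apply: gram_sym => //; exact: Ua.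
- by move=> y Wy; exact: gram_sym.
- by move=> x Ux; apply: gram_posdef => //; exact: Ua.
- by move=> y Wy; exact: gram_posdef.
- by move=> x Ux; apply: hM => //; exact: Ua.
- by move=> x Ux; have [] := sub a b aa ab x (Ud x Ux).
- by move=> x Ux; have [] := sub a b aa ab x (Ud x Ux).
Qed.
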